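(* For every $k$-graph $F$ and $1\leq d<k$, we have $$\delta_d(\mathsf{Til}_F)=\max\big\{\delta_d(\mathsf{Spa}_F),\ \delta_d(\mathsf{Div}_F),\ \delta_d(\mathsf{Cov}_F)\big\}.$$
   Context: A $k$-uniform hypergraph ($k$-graph) $G$ consists of a finite vertex set $V(G)$ and a set $E(G)$ of $k$-element subsets of $V(G)$. For $k$-graphs $F,G$, $\mathrm{Hom}(F;G)$ is the set of homomorphisms, i.e. functions $\phi\colon V(F)\to V(G)$ mapping edges of $F$ to edges of $G$. A perfect $F$-tiling of $G$ is a set of copies of $F$ in $G$ such that every vertex of $G$ is covered exactly once. A weighting $w\colon \mathrm{Hom}(F;G)\to\mathbb{R}$ is a perfect $\mathrm{Hom}(F)$-tiling of $G$ if $\sum_{\phi\in \mathrm{Hom}(F;G)}w(\phi)\,|\phi^{-1}(v)|=1$ for every $v\in V(G)$; it is fractional if $w$ takes values in $[0,1]$ and integral if $w$ takes values in $\mathbb{Z}$. $G$ is $\mathrm{Hom}(F)$-covered if for every $v\in V(G)$ there is $\phi\in\mathrm{Hom}(F;G)$ with $|\phi^{-1}(v)|=1$. $\mathsf{Til}_F$, $\mathsf{Spa}_F$, $\mathsf{Div}_F$, $\mathsf{Cov}_F$ denote the sets of $k$-graphs that, respectively, have a perfect $F$-tiling, have a perfect fractional $\mathrm{Hom}(F)$-tiling, have a perfect integral $\mathrm{Hom}(F)$-tiling, are $\mathrm{Hom}(F)$-covered. The minimum $d$-degree $\delta_d(G)$ of a $k$-graph $G$ is the largest $\ell$ such that every $d$-subset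 of $V(G)$ is contained in at least $\ell$ edges. For $\mathsf{X}\in\{\mathsf{Til}_F,\mathsf{Spa}_F,\mathsf{Div}_F,\mathsf{Cov}_F\}$ and $m=v(F)=|V(F)|$, the threshold $\delta_d(\mathsf{X})$ is the infimum over all $\delta\in[0,1]$ such that for all $\mu>0$ and all large enough $n$ divisible by $m$, every $n$-vertex $k$-graph $G$ with $\delta_d(G)\geq(\delta+\mu)\binom{n-d}{k-d}$ belongs to $\mathsf{X}$. *)

(* Defs.v *)
From HB Require Import structures.
From mathcomp Require Import all_boot all_order all_algebra.
From mathcomp Require Import all_classical all_reals.

Set Implicit Arguments.
Unset Strict Implicit.
Unset Printing Implicit Defensive.

Import Order.TTheory GRing.Theory Num.Theory.

Local Open Scope ring_scope.

Record kgraph (k : nat) := KGraph {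
  vert : finType;
  edges : {set {set vert}};
  edges_uniform : forall e, e \in edges -> #|e| = k }.

Section Degree.
Variables (k : nat) (G : kgraph k).

Definition set_degree (S : {set vert G}) : nat :=
  #|[set e in edges G | S \subset e]|.

(* The bound l <= #|edges G| only makes the maximum finite; it is no
   restriction as soon as G has at least d vertices. *)
Definition min_degree (d : nat) : nat :=
  \max_(l < #|edges G|.+1 |
          [forall S : {set vert G}, (#|S| == d) ==> (l <= set_degree S)%N]) l.

End Degree.

Section Properties.
Variables (R : realType) (k : nat) (F G : kgraph k).

Definition is_hom (phi : {ffun vert F -> vert G}) : bool :=
  [forall e in edges F, phi @: e \in edges G].

Definition khom := {phi : {ffun vert F -> vert G} | is_hom phi}.

Definition fiber_size (phi : khom) (v : vert G) : nat :=
  #|[set x | val phi x == v]|.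

(* Subgraphs of G are encoded as pairs (vertex set, edge set). *)
Definition is_copy (c : {set vert G} * {set {set vert G}}) : Prop :=
  exists2 phi : khom, injective (val phi) &
    c = ([set val phi x | x : vert F], [set val phi @: e | e : {set vert F} in edges F]).

Definition perfect_tiling (T : {set {set vert G} * {set {set vert G}}}) : Prop :=
  (forall c, c \in T -> is_copy c) /\
  (forall v : vert G, #|[set c in T | v \in c.1]| = 1%N).

Definition perfect_hom_tiling (w : khom -> R) : Prop :=
  forall v : vert G, \sum_(phi : khom) w phi * (fiber_size phi v)%:R = 1.

Definition Til : Prop := exists T, perfect_tiling T.

Definition Spa : Prop :=
  exists2 w : khom -> R, (forall phi, 0 <= w phi <= 1) & perfect_hom_tiling w.

Definition Div : Prop :=
  exists2 w : khom -> R,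
    (forall phi, w phi \is a Num.int) & perfect_hom_tiling w.

Definition Cov : Prop :=
  forall v : vert G, exists phi : khom, fiber_size phi v = 1%N.

End Properties.

Definition threshold (R : realType) (k d m : nat) (X : kgraph k -> Prop) : R :=
  inf [set delta : R | 0 <= delta <= 1 /\
    forall mu : R, 0 < mu -> exists N : nat, forall n : nat,
      (N <= n)%N -> (m %| n)%N ->
      forall G : kgraph k, #|vert G| = n ->
        (delta + mu) * 'C(n - d, k - d)%:R <= (min_degree G d)%:R -> X G]%classic.

(* Main.v *)
(* By sampling (a bounded difference inequality and a union bound), for a large
   constant s divisible by v(F) almost all s-tuples of vertices, even through a
   prescribed vertex, induce a k-graph whose minimum d-degree still exceeds the
   three thresholds, so that it lies in Spa, Div and Cov.  If all s-subsets of an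
   (s+1)-tuple have this property, then on the k-graph R it induces the
   homomorphism vectors span the full lattice of vectors with sum divisible by
   v(F), since 1_u - 1_v is a difference of two all-one vectors of s-subsets, and
   their cone contains all nearly constant vectors.  Hence a complete blow-up of R
   with nearly equal parts and order divisible by v(F) has a perfect F-tiling.

   Such blow-ups ("tiles") of any constant size cover almost all vertices: a
   tiling with large tiles that misses a positive proportion is improved to one
   with smaller tiles by taking equal small amounts from all parts of s tiles and
   the uncovered vertices, and this is iterated a bounded number of times.  The
   uncovered vertices are then grouped v(F) at a time; Cov covers each of them once,
   and the lattice property completes this by copies of F so that one part of
   each of s+1 tiles loses a bounded number of vertices, divisible by v(F).  Every
   tile is used at most once, so all the remainders are still perfectly tileable. *)
Require Import Defs.
From mathcomp Require Import all_boot all_order all_algebra.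
From mathcomp Require Import all_classical all_reals sequences exp.
From mathcomp Require Import fintype finset zify ring lra.

Set Implicit Arguments.
Unset Strict Implicit.
Unset Printing Implicit Defensive.

Import Order.TTheory GRing.Theory Num.Theory.

(** * Counting functions on a finite set *)

Section Counting.
Local Open Scope nat_scope.

(** Probabilities are cardinalities throughout: a random tuple is an element of [{ffun 'I_n -> V}],
    so its entries are independent and may repeat, and an estimate compares a number of tuples with
    [#|V| ^ n]. Repetitions are harmless, because a homomorphism into the pullback of G along a
    tuple composes to a homomorphism into G.

    That G itself lies in Spa, Div and Cov says nothing about its small subgraphs. Tuples of
    constant length s carry these properties to finitely many types of k-graphs, among which
    pigeonhole finds blow-ups. The proportion of failing tuples has to survive union bounds over
    subtuples, cyclic shifts and leftover vertices. These are polynomial in s, whence the factor 256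
    s^3, which the exponentially small sampling error beats once s is large. The bound is needed
    through every vertex and not just on average, since an uncovered block in the iteration and a
    leftover vertex in the absorption must be treated whichever they are. Constants are chosen
    backwards: s from the thresholds, b from s, the sizes of the earlier tiles from b, and n
    last. *)

Definition fupd (I : finType) (V : Type) (x : {ffun I -> V}) (a : I) (c : V) :
  {ffun I -> V} := [ffun i => if i == a then c else x i].

Definition fins (V : Type) n (u : 'I_n.+1) (a : V) (y : {ffun 'I_n -> V}) :
  {ffun 'I_n.+1 -> V} := [ffun i => oapp y a (unlift u i)].

Lemma fins_lift (V : Type) n (u : 'I_n.+1) (a : V) y i : fins u a y (lift u i) = y i.
Proof. by rewrite ffunE liftK. Qed.

Lemma fins_id (V : Type) n (u : 'I_n.+1) (a : V) y : fins u a y u = a.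
Proof. by rewrite ffunE unlift_none. Qed.

Lemma big_fins (R : Type) (idx : R) (op : Monoid.com_law idx) (V : finType) n
    (u : 'I_n.+1) (F : {ffun 'I_n.+1 -> V} -> R) :
  \big[op/idx]_x F x = \big[op/idx]_a \big[op/idx]_y F (fins u a y).
Proof.
rewrite pair_big /=.
rewrite (reindex (fun p : V * {ffun 'I_n -> V} => fins u p.1 p.2)) //.
exists (fun x : {ffun _ -> V} => (x u, [ffun i => x (lift u i)])) => [[a y] _ | x _] /=.
  congr (_, _); first by rewrite fins_id.
  by apply/ffunP => i; rewrite ffunE fins_lift.
apply/ffunP => i; rewrite ffunE.
by case: unliftP => [j ->|->] //=; rewrite ffunE.
Qed.

Global Arguments big_fins {R idx op V n} u F.

Lemma card_sum_mem (T : finType) (P : pred T) : #|[set x | P x]| = \sum_x (P x : nat).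
Proof. by rewrite -sum1dep_card big_mkcond; apply: eq_bigr => x _; case: (P x). Qed.

(** The coordinates outside the image of [e] are free, so every fibre of the restriction along [e]
    has [#|V| ^ (#|J| - #|I|)] elements. *)
Lemma card_comp_inj (I J V : finType) (e : I -> J) (Q : pred {ffun I -> V}) :
  injective e ->
  #|[set x : {ffun J -> V} | Q [ffun i => x (e i)]]| =
  #|[set u | Q u]| * #|V| ^ (#|J| - #|I|).
Proof.
move=> inje.
rewrite -[in LHS]sum1dep_card.
rewrite (partition_big (fun x : {ffun J -> V} => [ffun i => x (e i)] : {ffun I -> V}) Q) /=; last by [].
rewrite -[in RHS]sum1dep_card big_distrl /=; apply: eq_bigr => u Qu.
rewrite mul1n sum1dep_card.
pose F j : pred V := [pred v | [forall i, (e i == j) ==> (v == u i)]].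
have -> : #|[set x : {ffun J -> V} | Q [ffun i => x (e i)] & [ffun i => x (e i)] == u]|
          = #|family F|.
  apply: eq_card => x; rewrite !inE; apply/andP/familyP => [[_ /eqP xu] j|H].
    by rewrite /F -xu inE; apply/forallP => i; apply/implyP => /eqP<-; rewrite ffunE.
  have -> : [ffun i => x (e i)] = u.
    by apply/ffunP => i; rewrite ffunE; have /forallP/(_ i) := H (e i); rewrite eqxx => /eqP.
  by rewrite Qu.
rewrite card_family.
have -> : foldr muln 1 [seq #|F x| | x : J] = \prod_j #|F j|.
  by rewrite foldrE big_map big_enum.
rewrite (bigID (mem (codom e))) /= big1 ?mul1n.
  rewrite (eq_bigr (fun=> #|V|)) => [|j jN].
    rewrite prod_nat_const; congr (_ ^ _).
    have -> : #|J| = #|[pred j | j \in codom e]| + #|[pred j | j \notin codom e]|.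
      by rewrite -(cardC (mem (codom e))); congr (_ + _); apply: eq_card => j.
    rewrite (_ : #|[pred j | j \in codom e]| = #|I|) ?addKn //.
    by rewrite -(card_codom inje); apply: eq_card.
  apply: eq_card => v; rewrite !inE; apply/forallP => i; apply/implyP => /eqP eij.
  by move: jN; rewrite -eij codom_f.
move=> j /codomP[i ->]; rewrite -(card1 (u i)); apply: eq_card => v; rewrite !inE.
apply/forallP/idP => [/(_ i)|/eqP-> i']; first by rewrite eqxx.
by apply/implyP => /eqP/inje ->.
Qed.

(** Conditioning on [x a = c]: overwriting the coordinate [a] forgets its old value only, so each
    tuple with value [c] at [a] arises from [#|V|] tuples. *)
Lemma card_fupd (I V : finType) (a : I) (c : V) (Q : pred {ffun I -> V}) :
  #|[set x | Q (fupd x a c)]| =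
  #|V| * #|[set x : {ffun I -> V} | (x a == c) && Q x]|.
Proof.
rewrite -sum1dep_card.
rewrite (partition_big (fun x : {ffun I -> V} => fupd x a c) (fun x : {ffun I -> V} => (x a == c) && Q x)) /=; last first.
  by move=> x Qx; rewrite Qx ffunE !eqxx.
rewrite -[in RHS]sum1dep_card big_distrr /=; apply: eq_bigr => y /andP[/eqP ya Qy].
rewrite muln1 sum1dep_card.
rewrite -(card_imset _ (_ : injective (fun v => fupd y a v))); last first.
  by move=> v w /ffunP/(_ a); rewrite !ffunE eqxx.
apply: eq_card => x; rewrite !inE; apply/andP/imsetP => [[_ /eqP xy]|[v _ ->]].
  exists (x a) => //; apply/ffunP => i; rewrite -xy !ffunE.
  by case: eqP => [->|].
have -> : fupd (fupd y a v) a c = y; last by rewrite Qy eqxx.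
by apply/ffunP => i; rewrite !ffunE; case: eqP => // ->.
Qed.

Lemma card_bigcup_le (T I : finType) (P : pred I) (F : I -> {set T}) :
  #|\bigcup_(i | P i) F i| <= \sum_(i | P i) #|F i|.
Proof.
elim/big_rec2: _ => [|i n U _ leUn]; first by rewrite cards0.
by rewrite (leq_trans (leq_card_setU _ _).1) ?leq_add2l.
Qed.

(** Resampling one coordinate preserves the uniform distribution. This reduces a count of tuples to
    a count over a single entry while the others are frozen. *)
Lemma card_resample (I V : finType) (j : I) (P : pred {ffun I -> V}) :
  #|V| * #|[set y | P y]| = \sum_(y : {ffun I -> V}) #|[set a | P (fupd y j a)]|.
Proof.
transitivity (\sum_(a : V) #|[set y : {ffun I -> V} | P (fupd y j a)]|).
  rewrite (eq_bigr (fun a => #|V| * #|[set y : {ffun I -> V} | (y j == a) && P y]|)); last first.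
    by move=> a _; exact: (card_fupd j a P).
  rewrite -big_distrr /=; congr (_ * _).
  under eq_bigr do rewrite card_sum_mem.
  rewrite exchange_big card_sum_mem /=; apply: eq_bigr => y _.
  by rewrite (bigD1 (y j)) //= eqxx big1 ?addn0 // => a; rewrite eq_sym => /negbTE->.
under eq_bigr do rewrite card_sum_mem.
rewrite exchange_big /=; apply: eq_bigr => y _.
by rewrite card_sum_mem.
Qed.

End Counting.

(** * Complete partite subfamilies *)

Section Erdos.
Local Open Scope nat_scope.

Lemma pigeonhole_sum (T : finType) (D : pred T) (f : T -> nat) N :
  0 < N -> N <= \sum_(S | D S) f S -> exists2 S, D S & N <= #|[set S | D S]| * f S.
Proof.
move=> N0 HN.
case: (pickP [pred S | D S & N <= #|[set S | D S]| * f S]) => [S /andP[DS HS]|H].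
  by exists S.
have D0 : 0 < #|[set S | D S]|.
  rewrite lt0n cards_eq0; apply: contraTneq (leq_trans N0 HN) => D0.
  rewrite big1 // => S DS; have : S \in [set S | D S] by rewrite inE.
  by rewrite D0 inE.
have : \sum_(S | D S) (#|[set S | D S]| * f S).+1 <= \sum_(S | D S) N.
  by apply: leq_sum => S DS; have := H S; rewrite /= DS /= => /negbT; rewrite -ltnNge.
rewrite sum_nat_const.
rewrite (eq_bigr (fun S => #|[set S | D S]| * f S + 1)) => [|S _]; last by rewrite addn1.
rewrite big_split /= -big_distrr /= sum1_card.
have -> : #|(fun i => D i)| = #|[set S | D S]| by rewrite cardsE.
have := leq_mul (leqnn #|[set S | D S]|) HN; lia.
Qed.

Lemma exists_subset_card (T : finType) (A : {set T}) n :
  n <= #|A| -> exists2 B : {set T}, B \subset A & #|B| = n.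
Proof.
move=> nA; exists [set x in take n (enum A)].
  apply/subsetP => x; rewrite inE => /mem_take; by rewrite mem_enum.
rewrite cardsE (card_uniqP _) ?take_uniq ?enum_uniq // size_take -cardE.
by case: ltngtP nA.
Qed.

Lemma card_box (t : nat) (V : finType) (P : 'I_t -> {set V}) B (Y : {set {ffun 'I_t -> V}}) :
  (forall i, #|P i| <= B) -> (forall x, x \in Y -> forall i, x i \in P i) -> #|Y| <= B ^ t.
Proof.
move=> PB YP; apply: (@leq_trans #|family (fun i => mem (P i))|).
  by apply: subset_leq_card; apply/subsetP => x xY; apply/familyP => i; exact: YP.
rewrite card_family foldrE big_map big_enum /=.
apply: (@leq_trans (\prod_(i < t) B)); last by rewrite prod_nat_const card_ord.
by apply: leq_prod => i _.
Qed.

(** Erdős's theorem on complete partite subsystems, by induction on [t]. Many [a] of the part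
    [P ord0] have a dense link [Xa a]; among [m0] of them, many [y] lie in at least [b] links;
    pigeonhole fixes a common [b]-set [S] of such [a] for a positive proportion of these [y], to
    which the induction hypothesis applies. *)
Lemma erdos_partite t b den : 0 < b -> 0 < den ->
  exists B0, forall (V : finType) B (X : {set {ffun 'I_t -> V}}) (P : 'I_t -> {set V}),
    B0 <= B -> (forall i, #|P i| <= B) ->
    (forall x, x \in X -> forall i, x i \in P i) -> B ^ t <= den * #|X| ->
    exists2 W : 'I_t -> {set V}, (forall i, #|W i| = b) &
      forall x : {ffun 'I_t -> V}, (forall i, x i \in W i) -> x \in X.
Proof.
move=> b0; elim: t den => [|t IHt] den den0.
  exists 0 => V B X P _ _ _; rewrite expn0 => H.
  exists (fun=> set0) => [[]//|x _].
  have : 0 < #|X| by move: H; rewrite muln_gt0 => /andP[].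
  case/card_gt0P => y yX; suff -> : x = y by [].
  by apply/ffunP => -[].
(* The [m0] chosen links have total size at least [2 * b * B ^ t]. Those [y] in fewer than [b] links
   account for at most [b * B ^ t] of it, so at least [b * B ^ t / m0], that is [B ^ t / (4 * den)],
   of the [y] lie in [b] links. *)
pose m0 := 4 * den * b.
(* The factor [2 ^ m0] pays for the pigeonhole over subsets of a set of size [m0]. *)
have den'0 : 0 < 4 * den * 2 ^ m0 by rewrite !muln_gt0 den0 expn_gt0.
have [B0 HB0] := IHt _ den'0.
exists (maxn 1 (maxn B0 (2 * den * m0))) => V B X P.
rewrite !geq_max => /and3P[B1 BB0 Bm] PB XP HX.
pose Xa a := [set y : {ffun 'I_t -> V} | fins ord0 a y \in X].
pose P' i := P (lift ord0 i).
have XaP a y : y \in Xa a -> (a \in P ord0) /\ forall i, y i \in P' i.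
  rewrite inE => yX; split; first by have := XP _ yX ord0; rewrite fins_id.
  by move=> i; have := XP _ yX (lift ord0 i); rewrite fins_lift.
have cXa a : #|Xa a| <= B ^ t.
  by apply: (card_box (P := P')) => [i|y /XaP[]//]; exact: PB.
have sumXa : #|X| = \sum_(a in P ord0) #|Xa a|.
  have -> : #|X| = #|[set x | x \in X]| by apply: eq_card => x; rewrite inE.
  rewrite card_sum_mem (big_fins ord0) /=.
  rewrite [RHS]big_mkcond /=; apply: eq_bigr => a _.
  rewrite -card_sum_mem -/(Xa a); case: ifP => // aP.
  by apply/eqP; rewrite cards_eq0 -subset0; apply/subsetP => y /XaP[]; rewrite aP.
pose A := [set a in P ord0 | B ^ t <= 2 * den * #|Xa a|].
have cA : B <= 2 * den * #|A|.
  have Bt0 : 0 < B ^ t by rewrite expn_gt0 B1.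
  have h1 : 2 * den * #|X| <= 2 * den * #|A| * B ^ t + B * B ^ t.
    rewrite sumXa (bigID (fun a => B ^ t <= 2 * den * #|Xa a|)) /= mulnDr.
    apply: leq_add.
      rewrite -[leqRHS]mulnA leq_mul2l -sum_nat_const; apply/orP; right.
      rewrite (eq_bigl (mem A)) => [|a]; last by rewrite !inE.
      by apply: leq_sum => a _; exact: cXa.
    rewrite big_distrr /=; apply: (@leq_trans (\sum_(a in P ord0) B ^ t)).
      rewrite [leqRHS](bigID (fun a => B ^ t <= 2 * den * #|Xa a|)) /=.
      by apply: leq_trans (leq_addl _ _); apply: leq_sum => a /andP[_]; rewrite -ltnNge => /ltnW.
    by rewrite sum_nat_const leq_mul2r PB orbT.
  rewrite -(leq_pmul2r Bt0).
  by move: HX; rewrite expnS; lia.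
have cA' : m0 <= #|A|.
  have d20 : 0 < 2 * den by rewrite muln_gt0.
  by rewrite -(leq_pmul2l d20); apply: leq_trans cA.
have [A0 A0A cA0] := exists_subset_card cA'.
pose N y := [set a in A0 | y \in Xa a].
pose Y := [set y | b <= #|N y|].
have YP y : y \in Y -> forall i, y i \in P' i.
  rewrite inE => bN; have : 0 < #|N y| by apply: leq_trans bN.
  by case/card_gt0P => a; rewrite inE => /andP[_ /XaP[]].
have cY : B ^ t <= 4 * den * #|Y|.
  have h1 : m0 * B ^ t <= 2 * den * \sum_y #|N y|.
    under eq_bigr do rewrite /N -sum1dep_card big_mkcondr /=.
    rewrite exchange_big /= -cA0 -sum_nat_const big_distrr /=; apply: leq_sum => a aA0.
    have := subsetP A0A a aA0; rewrite inE => /andP[_ H]; apply: leq_trans H _.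
    rewrite leq_mul2l; apply/orP; right.
    by rewrite -sum1_card big_mkcond.
  have h2 : \sum_y #|N y| <= #|Y| * m0 + b * B ^ t.
    rewrite (bigID (mem Y)) /=; apply: leq_add.
      rewrite -sum_nat_const; apply: leq_sum => y _; rewrite -cA0.
      by apply: subset_leq_card; apply/subsetP => a; rewrite inE => /andP[].
    pose Z := [set y : {ffun 'I_t -> V} | [forall i, y i \in P' i]].
    apply: (@leq_trans (\sum_(y in Z) b)); last first.
      rewrite sum_nat_const mulnC leq_mul2l; apply/orP; right.
      by apply: (card_box (P := P')) => [i|y]; [exact: PB|rewrite inE => /forallP].
    rewrite big_mkcond [leqRHS]big_mkcond /=; apply: leq_sum => y _.
    case: ifP => // yY; case: ifP => [_|/negbT yZ].
      by rewrite leqNgt; apply/negP => bN; move: yY; rewrite inE ltnW.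
    rewrite leqn0 cards_eq0 -subset0; apply/subsetP => a; rewrite inE => /andP[_ /XaP[_ yP]].
    by case/negP: yZ; rewrite inE; apply/forallP.
  have h3 : m0 * B ^ t <= 2 * den * (#|Y| * m0 + b * B ^ t).
    by apply: leq_trans h1 _; rewrite leq_mul2l h2 orbT.
  have m00 : 0 < 2 * den * b by rewrite !muln_gt0 den0.
  rewrite -(leq_pmul2l m00).
  have e1 : m0 * B ^ t = 2 * (2 * den * b * B ^ t) by rewrite /m0; ring.
  have e2 : 2 * den * (#|Y| * m0 + b * B ^ t) = 2 * den * b * (4 * den * #|Y|) + 2 * den * b * B ^ t.
    by rewrite /m0; ring.
  by move: h3; rewrite e1 e2; lia.
have Bt0 : 0 < B ^ t by rewrite expn_gt0 B1.
have Y0 : 0 < #|Y| by move: (leq_trans Bt0 cY); rewrite muln_gt0 => /andP[].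
have [S /andP[SA0 Sb] cS] : exists2 S : {set V}, (S \subset A0) && (#|S| == b) &
   #|Y| <= #|[set S : {set V} | (S \subset A0) && (#|S| == b)]| * #|[set y | S \subset N y]|.
  apply: pigeonhole_sum => //.
  apply: (@leq_trans #|\bigcup_(S : {set V} | (S \subset A0) && (#|S| == b)) [set y | S \subset N y]|).
    apply: subset_leq_card; apply/subsetP => y; rewrite inE => /exists_subset_card[S SN cS].
    apply/bigcupP; exists S; last by rewrite inE.
    rewrite cS eqxx andbT; apply: subset_trans SN _.
    by apply/subsetP => a; rewrite inE => /andP[].
  exact: card_bigcup_le.
have cS2 : #|[set S : {set V} | (S \subset A0) && (#|S| == b)]| <= 2 ^ m0.
  rewrite -cA0 -card_powerset; apply: subset_leq_card; apply/subsetP => S'.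
  by rewrite !inE => /andP[].
have SX y : y \in [set y | S \subset N y] -> forall a, a \in S -> fins ord0 a y \in X.
  by rewrite inE => /subsetP H a /H; rewrite !inE => /andP[].
have [W cW HW] : exists2 W : 'I_t -> {set V}, (forall i, #|W i| = b) &
      forall x : {ffun 'I_t -> V}, (forall i, x i \in W i) -> x \in [set y | S \subset N y].
  apply: (HB0 V B _ P') => //; first by move=> i; exact: PB.
    move=> y; rewrite inE => SN; apply: YP; rewrite inE -(eqP Sb).
    exact: subset_leq_card.
  apply: leq_trans cY _; rewrite -[leqRHS]mulnA leq_mul2l; apply/orP; right.
  by apply: leq_trans cS _; rewrite leq_mul2r cS2 orbT.
exists (fun i => oapp W S (unlift ord0 i)) => [i|x xW].
  by case: unliftP => [j _|_] /=; rewrite ?cW ?(eqP Sb).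
pose y := [ffun i => x (lift ord0 i)] : {ffun 'I_t -> V}.
have -> : x = fins ord0 (x ord0) y.
  by apply/ffunP => i; rewrite ffunE; case: unliftP => [j ->|->] //=; rewrite ffunE.
apply: SX; last by have := xW ord0; rewrite unlift_none.
by apply: HW => i; have := xW (lift ord0 i); rewrite liftK ffunE.
Qed.

End Erdos.

(** * Monochromatic tiles *)

Section SetLemmas.
Local Open Scope nat_scope.
Variable V : finType.
Implicit Types X Y Z : {set V}.

Lemma card_disjointU X Y : [disjoint X & Y] -> #|X :|: Y| = #|X| + #|Y|.
Proof. by move=> dXY; apply/eqP; rewrite (leq_card_setU _ _).2. Qed.

Lemma disjointUr Z X Y : [disjoint Z & X :|: Y] = [disjoint Z & X] && [disjoint Z & Y].
Proof. by rewrite -!setI_eq0 setIUr setU_eq0. Qed.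

Lemma disjointUl Z X Y : [disjoint X :|: Y & Z] = [disjoint X & Z] && [disjoint Y & Z].
Proof. by rewrite -!setI_eq0 setIUl setU_eq0. Qed.

Lemma disjoint_bigcupl (I : finType) (P : pred I) (F : I -> {set V}) Z :
  (forall i, P i -> [disjoint F i & Z]) -> [disjoint \bigcup_(i | P i) F i & Z].
Proof.
move=> H; rewrite disjoints_subset; apply/bigcupsP => i Pi; rewrite -disjoints_subset; exact: H.
Qed.

Lemma disjoint_bigcupr (I : finType) (P : pred I) (F : I -> {set V}) Z :
  (forall i, P i -> [disjoint Z & F i]) -> [disjoint Z & \bigcup_(i | P i) F i].
Proof.
by move=> H; rewrite disjoint_sym; apply: disjoint_bigcupl => i Pi; rewrite disjoint_sym H.
Qed.

Definition pwdisjoint (J : finType) (F : J -> {set V}) :=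
  forall i j, i != j -> [disjoint F i & F j].

Lemma pwdisjoint_sub (J : finType) (F F' : J -> {set V}) :
  (forall i, F' i \subset F i) -> pwdisjoint F -> pwdisjoint F'.
Proof. by move=> sF dF i j /dF; apply: disjointW. Qed.

Lemma pwdisjointP (J : finType) (F : J -> {set V}) i j v :
  pwdisjoint F -> v \in F i -> v \in F j -> i = j.
Proof.
move=> dF vi vj; apply/eqP/negPn/negP => /dF.
by rewrite -setI_eq0 => /eqP/setP/(_ v); rewrite !inE vi vj.
Qed.

(** Tracks a disjoint union together with an additive weight; it serves cardinalities and, with zero
    weights, unions of tiles and of copies of F. *)
Lemma bigcup_disjoint_ind (J : finType) (F : J -> {set V}) (P : pred J)
    (K : {set V} -> nat -> Prop) (n : J -> nat) :
  pwdisjoint F -> K set0 0 ->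
  (forall j X m, P j -> [disjoint F j & X] -> K X m -> K (F j :|: X) (n j + m)) ->
  K (\bigcup_(j | P j) F j) (\sum_(j | P j) n j).
Proof.
move=> dF K0 KU; rewrite -!(big_filter _ P).
have : all P [seq i <- index_enum J | P i] by rewrite filter_all.
have := filter_uniq P (index_enum_uniq J).
elim: [seq i <- _ | _] => [|j s IHs] /=; first by rewrite !big_nil.
move=> /andP[js us] /andP[Pj Ps]; rewrite !big_cons; apply: KU => //; last exact: IHs.
rewrite disjoint_sym disjoints_subset big_tnth; apply/bigcupsP => i _.
rewrite -disjoints_subset; apply: dF; apply: contraNneq js => <-; exact: mem_tnth.
Qed.

Lemma card_pwbigcup (J : finType) (F : J -> {set V}) (P : pred J) :
  pwdisjoint F -> #|\bigcup_(j | P j) F j| = \sum_(j | P j) #|F j|.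
Proof.
move=> dF; apply: (bigcup_disjoint_ind (K := fun X m => #|X| = m)) => //.
  by rewrite cards0.
by move=> j X m _ /card_disjointU-> ->.
Qed.

Lemma disjoint_subsets n B (L : {set V}) : n * B <= #|L| ->
  exists P : 'I_n -> {set V},
    [/\ forall i, #|P i| = B, forall i, P i \subset L & pwdisjoint P].
Proof.
elim: n L => [|n IHn] L; first by exists (fun=> set0); split=> [[]|[]|[]].
rewrite mulSn => HL.
have [Y YL cY] : exists2 Y : {set V}, Y \subset L & #|Y| = B.
  by apply: exists_subset_card; apply: leq_trans HL; rewrite leq_addr.
have [P [cP sP dP]] := IHn (L :\: Y) ltac:(by rewrite cardsD (setIidPr YL) cY; lia).
have sPi i : (P i \subset L) && [disjoint P i & Y].
  by have := sP i; rewrite subsetD.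
exists (fun i => oapp P Y (unlift ord0 i)); split=> [i|i|i j].
- by case: unliftP => [k _|_] /=; rewrite ?cP ?cY.
- by case: unliftP => [k _|_] //=; have /andP[] := sPi k.
case: (unliftP ord0 i) => [i' ->|->]; case: (unliftP ord0 j) => [j' ->|->] //= ij.
- by apply: dP; apply: contraNneq ij => ->.
- by have /andP[] := sPi i'.
- by rewrite disjoint_sym; have /andP[] := sPi j'.
Qed.

Lemma disjoint_subsets_fin (J : finType) B (L : {set V}) : #|J| * B <= #|L| ->
  exists P : J -> {set V},
    [/\ forall i, #|P i| = B, forall i, P i \subset L & pwdisjoint P].
Proof.
move=> /disjoint_subsets[P [cP sP dP]]; exists (fun j => P (enum_rank j)).
by split=> // i j ij; apply: dP; rewrite (inj_eq enum_rank_inj).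
Qed.

End SetLemmas.

Section Tiles.
Local Open Scope nat_scope.
Variables (t : nat) (C V : finType) (chi : {ffun 'I_t -> V} -> C) (gd : pred C).

Implicit Types (W U : 'I_t -> {set V}) (X Y : {set V}).

Definition transversal (W : 'I_t -> {set V}) (x : {ffun 'I_t -> V}) :=
  forall i, x i \in W i.

(** Later [chi] is [pull], so a monochromatic family is a complete blow-up of one k-graph on ['I_t],
    and [gd] selects the useful k-graphs. *)
Definition mono (W : 'I_t -> {set V}) :=
  exists2 c, gd c & forall x, transversal W x -> chi x = c.

Definition tsup (W : 'I_t -> {set V}) := \bigcup_i W i.

Definition tile b (W : 'I_t -> {set V}) :=
  [/\ forall i, #|W i| = b, pwdisjoint W & mono W].

(** An inductive predicate lets unions and refinements be formed without naming the family of tiles;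
    [btil_index] recovers an indexed family when the parts are needed. *)
Inductive btil b : {set V} -> Prop :=
| btil0 : btil b set0
| btilU (W : 'I_t -> {set V}) (X : {set V}) : tile b W -> [disjoint tsup W & X] -> btil b X -> btil b (tsup W :|: X).

Lemma btil_tile b W : tile b W -> btil b (tsup W).
Proof.
move=> tW; rewrite -(setU0 (tsup W)); apply: btilU => //; last exact: btil0.
by rewrite disjoint_sym disjoints_subset sub0set.
Qed.

Lemma btil_union b X Y : btil b X -> btil b Y -> [disjoint X & Y] -> btil b (X :|: Y).
Proof.
move=> bX bY; elim: bX => [|W X' tW dW bX' IH]; first by rewrite set0U.
rewrite disjointUl => /andP[dWY dXY]; rewrite -setUA; apply: btilU => //.
  by rewrite disjointUr dW.
exact: IH.
Qed.

Lemma btil_bigcup b (J : finType) (P : pred J) (F : J -> {set V}) :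
  pwdisjoint F -> (forall j, P j -> btil b (F j)) -> btil b (\bigcup_(j | P j) F j).
Proof.
move=> dF bF.
apply: (bigcup_disjoint_ind (K := fun X _ => btil b X) (n := fun=> 0)) => //.
  exact: btil0.
by move=> j X _ Pj dX bX; apply: btil_union => //; exact: bF.
Qed.

Lemma tsup_sub W W' : (forall i, W i \subset W' i) -> tsup W \subset tsup W'.
Proof. by move=> sW; apply/bigcupsP => i _; apply: (subset_trans (sW i)); exact: bigcup_sup. Qed.

Lemma card_tsup b W : (forall i, #|W i| = b) -> pwdisjoint W -> #|tsup W| = t * b.
Proof.
move=> cW dW; rewrite card_pwbigcup // (eq_bigr (fun=> b)) //.
by rewrite sum_nat_const card_ord.
Qed.

Lemma mono_sub W W' : (forall i, W i \subset W' i) -> mono W' -> mono W.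
Proof.
move=> sW [c gc Hc]; exists c => // x xW; apply: Hc => i.
exact: (subsetP (sW i)).
Qed.

Lemma btil_split b l W : pwdisjoint W -> (forall i, #|W i| = l * b) -> mono W ->
  btil b (tsup W).
Proof.
elim: l W => [|l IHl] W dW cW mW.
  suff -> : tsup W = set0 by exact: btil0.
  by apply: big1 => i _; apply/eqP; rewrite -cards_eq0 cW.
have ex i : exists U : {set V}, (U \subset W i) && (#|U| == b).
  have [] := @exists_subset_card V (W i) b; first by rewrite cW mulSn leq_addr.
  by move=> U sU cU; exists U; rewrite sU cU eqxx.
pose U i := xchoose (ex i).
have sU i : U i \subset W i by have /andP[] := xchooseP (ex i).
have cU i : #|U i| = b by have /andP[_ /eqP] := xchooseP (ex i).
have -> : tsup W = tsup U :|: tsup (fun i => W i :\: U i).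
  rewrite /tsup -big_split /=; apply: eq_bigr => i _.
  by rewrite -{1}(setIidPr (sU i)) setID.
have sD i : W i :\: U i \subset W i by rewrite subsetDl.
apply: btil_union.
- apply: btil_tile; split=> //; [exact: pwdisjoint_sub dW|exact: mono_sub mW].
- apply: IHl; [exact: pwdisjoint_sub dW| |exact: mono_sub mW].
  by move=> i; rewrite cardsD (setIidPr (sU i)) cU cW; lia.
apply: disjoint_bigcupl => i _; apply: disjoint_bigcupr => j _.
have [->|ij] := eqVneq i j.
  by rewrite -setI_eq0 setIDA setIC -setIDA setDv setI0.
exact: disjointW (sU i) (sD j) (dW _ _ ij).
Qed.

Lemma btil_refine b l X : btil (l * b) X -> btil b X.
Proof.
elim=> [|W X' [cW dW mW] dWX _ IH]; first exact: btil0.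
by apply: btil_union => //; exact: btil_split mW.
Qed.

Lemma btil_index b X : btil b X ->
  exists (Gam : finType) (P : Gam -> 'I_t -> {set V}),
    [/\ forall g, tile b (P g), pwdisjoint (fun p : Gam * 'I_t => P p.1 p.2)
      & X = \bigcup_g tsup (P g)].
Proof.
elim=> [|W X' tW dW _ [Gam [P [tP dP eX]]]].
  by exists void, (fun=> fun=> set0); split=> [[]|[[]]|] //; rewrite big1 // => -[].
exists (option Gam), (fun g => oapp P W g); split.
- by case.
- have [_ dWW _] := tW.
  have dWP i g j : [disjoint W i & P g j].
    apply: disjointW (_ : W i \subset tsup W) (_ : P g j \subset X') dW.
      exact: bigcup_sup.
      rewrite eX; have sub1 : P g j \subset tsup (P g) by apply: bigcup_sup.
      by apply: subset_trans sub1 _; apply: (@bigcup_sup _ _ g xpredT (fun g => tsup (P g))).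
  move=> [[g|] i] [[g'|] j] /= ij.
  + by apply: (dP (g, i) (g', j)); apply: contraNneq ij => -[-> ->].
  + by rewrite disjoint_sym.
  + exact: dWP.
  + by apply: dWW; apply: contraNneq ij => ->.
apply/setP => v; rewrite eX inE; apply/orP/bigcupP => [[vW|/bigcupP[g _ vg]]|[[g|] _ vg]].
- by exists None.
- by exists (Some g).
- by right; apply/bigcupP; exists g.
- by left.
Qed.

End Tiles.

(** * Almost perfect tilings by tiles *)

Section Dense.
Local Open Scope nat_scope.

Definition boxed (t : nat) (V : finType) (W : 'I_t -> {set V}) (x : {ffun 'I_t -> V}) :=
  [forall i, x i \in W i].

Lemma card_boxed (t : nat) (V : finType) (W : 'I_t -> {set V}) :
  #|[set x | boxed W x]| = \prod_i #|W i|.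
Proof.
transitivity #|family (fun i => mem (W i))|.
  apply: eq_card => x; rewrite inE.
  by apply/forallP/familyP => H i; have := H i.
by rewrite card_family foldrE big_map big_enum.
Qed.

Lemma dense_tuple_tiling (t : nat) (C : finType) b : 0 < b -> 0 < t ->
  exists B0, forall l (V : finType) (chi : {ffun 'I_t -> V} -> C) (gd : pred C)
     (W : 'I_t -> {set V}),
   B0 <= l -> pwdisjoint W -> (forall i, #|W i| = 4 * t * l * b) ->
   (4 * t * l * b) ^ t <= 2 * #|[set x | boxed W x && gd (chi x)]| ->
   exists U : 'I_t -> {set V}, [/\ forall i, U i \subset W i,
     forall i, #|U i| = l * b & btil chi gd b (tsup U)].
Proof.
move=> b0 t0.
have C10 : 0 < 4 * #|C|.+1 by [].
have [B0 HB0] := @erdos_partite t b (4 * #|C|.+1) b0 C10.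
exists B0 => l V chi gd W Bl dW cW; set B := 4 * t * l * b in cW *; move=> dense.
have BB0 : B0 <= B.
  apply: (leq_trans Bl); rewrite /B mulnAC leq_pmull // !muln_gt0 t0 b0 //.
suff H l' : l' <= l -> exists U : 'I_t -> {set V}, [/\ forall i, U i \subset W i,
     forall i, #|U i| = l' * b & btil chi gd b (tsup U)] by exact: H.
elim: l' => [_|l' IH l'l].
  exists (fun=> set0); split=> [i|i|]; rewrite ?sub0set ?cards0 //.
  by rewrite /tsup big1 //; exact: btil0.
have [U [sU cU bU]] := IH (ltnW l'l).
have B_gt0 : 0 < B by rewrite !muln_gt0 t0 b0 (leq_ltn_trans (leq0n l') l'l).
pose X := [set x | boxed (fun i => W i :\: U i) x && gd (chi x)].
pose H i := [set x | boxed (fun j => if j == i then U i else W j) x].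
have cH i : #|H i| = l' * b * B ^ t.-1.
  rewrite card_boxed (bigD1 i) //= eqxx cU; congr (_ * _).
  rewrite (eq_bigr (fun=> B)) => [|j /negbTE->//].
  by rewrite prod_nat_const cardC1 card_ord.
have sub : [set x | boxed W x && gd (chi x)] \subset X :|: \bigcup_i H i.
  apply/subsetP => x; rewrite !inE => /andP[/forallP xW gx].
  case: (boolP (boxed _ x)) => [_|]; first by rewrite gx.
  move/forallPn => [i]; rewrite inE xW andbT negbK => xU.
  apply/orP; right; apply/bigcupP; exists i => //; rewrite inE.
  by apply/forallP => j; case: eqP => [->|].
have cX : B ^ t <= 4 * #|X|.
  have h1 : #|[set x | boxed W x && gd (chi x)]| <= #|X| + t * (l' * b * B ^ t.-1).
    apply: leq_trans (subset_leq_card sub) _; apply: leq_trans (leq_card_setU _ _).1 _.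
    rewrite leq_add2l.
    have -> : t * (l' * b * B ^ t.-1) = \sum_(i < t) #|H i|.
      by rewrite (eq_bigr (fun=> l' * b * B ^ t.-1)) => [|i _]; rewrite ?cH // sum_nat_const card_ord.
    exact: card_bigcup_le.
  have h2 : 4 * (t * (l' * b * B ^ t.-1)) <= B ^ t.
    rewrite -[in leqRHS](prednK t0) expnS {2}/B.
    have -> : 4 * (t * (l' * b * B ^ t.-1)) = 4 * t * l' * b * B ^ t.-1 by ring.
    by rewrite !leq_mul2r leq_mul2l (ltnW l'l) !orbT.
  lia.
have X0 : 0 < #|X|.
  have : 0 < B ^ t by rewrite expn_gt0 B_gt0.
  by move/leq_trans => /(_ _ cX); rewrite muln_gt0.
have [c gc cXc] : exists2 c, gd c & #|X| <= #|[set c | gd c]| * #|[set x in X | chi x == c]|.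
  apply: pigeonhole_sum => //.
  rewrite -sum1_card (partition_big chi gd) /=; last by move=> x; rewrite inE => /andP[].
  by apply: leq_sum => c gc; rewrite -sum1dep_card.
have [T cT HT] : exists2 T : 'I_t -> {set V}, (forall i, #|T i| = b) &
   forall x : {ffun 'I_t -> V}, (forall i, x i \in T i) -> x \in [set x in X | chi x == c].
  apply: (HB0 V B _ W) => //; first by move=> i; rewrite cW.
    by move=> x; rewrite !inE => /andP[/andP[/forallP Hx _] _] i; have := Hx i; rewrite inE => /andP[].
  apply: (leq_trans cX); rewrite -mulnA leq_mul2l /=; apply: (leq_trans cXc).
  by rewrite leq_mul2r (leq_trans (max_card _)) ?orbT.
have sT i : T i \subset W i :\: U i.
  apply/subsetP => v vT.
  have ex j : exists w, w \in T j by apply/card_gt0P; rewrite cT.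
  pose x := [ffun j => if j == i then v else xchoose (ex j)].
  have : x \in [set x in X | chi x == c].
    by apply: HT => j; rewrite ffunE; case: eqP => [->//|_]; exact: xchooseP.
  by rewrite !inE => /andP[/andP[/forallP/(_ i)]]; rewrite ffunE eqxx inE.
exists (fun i => U i :|: T i); split.
- by move=> i; rewrite subUset sU (subset_trans (sT i)) // subsetDl.
- move=> i; rewrite card_disjointU ?cU ?cT ?mulSn 1?addnC //.
  by have := sT i; rewrite subsetD disjoint_sym => /andP[].
rewrite /tsup big_split /=; apply: btil_union => //.
  apply: btil_tile; split=> //.
    by apply: pwdisjoint_sub dW => i; rewrite (subset_trans (sT i)) // subsetDl.
  by exists c => // x /HT; rewrite inE => /andP[_ /eqP].
apply: disjoint_bigcupl => i _; apply: disjoint_bigcupr => j _.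
have := sT j; rewrite subsetD => /andP[TjW TjU].
have [<-|ij] := eqVneq j i; first by rewrite disjoint_sym.
by apply: disjointW (sU i) TjW (dW _ _ _); rewrite eq_sym.
Qed.

End Dense.

(** * Random choice of distinct groups *)

Section Selection.
Local Open Scope nat_scope.

(** A union bound for a uniformly random [p]: entries in [U] spoil at most a quarter of the choices,
    coincidences of groups less than a quarter, and [Bad] at most half. *)
Lemma select_groups (t : nat) (Gam : finType) (Bad : {set {ffun 'I_t -> Gam * 'I_t}})
    (U : {set Gam}) :
  0 < t -> 4 * t * #|U| <= #|Gam| -> 4 * t ^ 2 < #|Gam| ->
  2 * #|Bad| <= (#|Gam| * t) ^ t ->
  exists p : {ffun 'I_t -> Gam * 'I_t},
    [/\ p \notin Bad, forall a, (p a).1 \notin U & injective (fun a => (p a).1)].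
Proof.
move=> t0 cU cG cBad.
pose T : finType := (Gam * 'I_t)%type.
have cT : #|T| = #|Gam| * t by rewrite card_prod card_ord.
have cTt : #|{ffun 'I_t -> T}| = (#|Gam| * t) ^ t by rewrite card_ffun card_ord cT.
set N := (#|Gam| * t) ^ t in cBad cTt *.
have G0 : 0 < #|Gam| by apply: leq_trans cG.
have N0 : 0 < N by rewrite expn_gt0 muln_gt0 G0 t0.
pose B1 a := [set p : {ffun 'I_t -> T} | (p a).1 \in U].
pose B2 (q : 'I_t * 'I_t) := [set p : {ffun 'I_t -> T} | (q.1 != q.2) && ((p q.1).1 == (p q.2).1)].
have card_fst (A : {set Gam}) : #|[set c : T | c.1 \in A]| = #|A| * t.
  rewrite -[X in _ = _ * X](card_ord t) -[X in _ = _ * X]cardsT -cardsX.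
  by apply: eq_card => c; rewrite !inE andbT.
have cB1 a : #|Gam| * #|B1 a| = N * #|U|.
  apply/eqP; rewrite -(eqn_pmul2r t0) mulnAC -cT.
  have -> := card_resample a (fun p : {ffun 'I_t -> T} => (p a).1 \in U).
  rewrite (eq_bigr (fun=> #|U| * t)) => [|p _].
    by rewrite sum_nat_const cTt mulnA.
  by rewrite -card_fst; apply: eq_card => c; rewrite !inE ffunE eqxx.
have cB2 q : #|Gam| * #|B2 q| <= N.
  case: (eqVneq q.1 q.2) => [qq|qq].
    rewrite (_ : B2 q = set0) ?cards0 ?muln0 //; apply/setP => p.
    by rewrite !inE qq eqxx.
  rewrite -(leq_pmul2r t0) mulnAC -cT.
  have -> := card_resample q.1 (fun p : {ffun 'I_t -> T} => (q.1 != q.2) && ((p q.1).1 == (p q.2).1)).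
  rewrite (eq_bigr (fun=> t)) => [|p _].
    by rewrite sum_nat_const cTt.
  rewrite -[RHS]mul1n -(cards1 (p q.2).1) -card_fst; apply: eq_card => c.
  by rewrite !inE !ffunE eqxx qq /= [q.2 == q.1]eq_sym (negbTE qq).
case: (pickP [pred p : {ffun 'I_t -> T} | (p \notin Bad) && [forall a, p \notin B1 a] &&
   [forall q, p \notin B2 q]]) => [p /andP[/andP[pB /forallP p1] /forallP p2]|Hall].
  exists p; split=> // [a|a a' paa']; first by have := p1 a; rewrite inE.
  by have := p2 (a, a'); rewrite inE /= paa' eqxx andbT negbK => /eqP.
have cover : [set: {ffun 'I_t -> T}] \subset Bad :|: ((\bigcup_a B1 a) :|: \bigcup_q B2 q).
  apply/subsetP => p _; have /negbT := Hall p; rewrite /= !negb_and negbK !negb_forall !in_setU.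
  case/orP => [/orP[->//|/existsP[a]]|/existsP[q]]; rewrite negbK => H.
    by apply/orP; right; apply/orP; left; apply/bigcupP; exists a.
  by apply/orP; right; apply/orP; right; apply/bigcupP; exists q.
have h : N <= #|Bad| + (\sum_a #|B1 a| + \sum_q #|B2 q|).
  rewrite -cTt -cardsT; apply: leq_trans (subset_leq_card cover) _.
  apply: leq_trans (leq_card_setU _ _).1 _; rewrite leq_add2l.
  apply: leq_trans (leq_card_setU _ _).1 _; apply: leq_add; exact: card_bigcup_le.
have h1 : #|Gam| * \sum_a #|B1 a| = t * (N * #|U|).
  by rewrite big_distrr /= (eq_bigr (fun=> N * #|U|)) // sum_nat_const card_ord.
have h2 : #|Gam| * \sum_q #|B2 q| <= t ^ 2 * N.
  rewrite big_distrr /=; apply: leq_trans (leq_sum _ (fun q _ => cB2 q)) _.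
  by rewrite sum_nat_const card_prod card_ord.
have h3 : 4 * (t * (N * #|U|)) <= N * #|Gam|.
  have -> : 4 * (t * (N * #|U|)) = N * (4 * t * #|U|) by ring.
  by rewrite leq_mul2l cU orbT.
have h4 : 4 * (t ^ 2 * N) < N * #|Gam|.
  have -> : 4 * (t ^ 2 * N) = N * (4 * t ^ 2) by ring.
  by rewrite ltn_pmul2l.
have h5 : #|Gam| * (2 * #|Bad|) <= #|Gam| * N by rewrite leq_mul2l cBad orbT.
have h6 : #|Gam| * N <= #|Gam| * (#|Bad| + (\sum_a #|B1 a| + \sum_q #|B2 q|)).
  by rewrite leq_mul2l h orbT.
rewrite -h1 [N * _]mulnC in h3; rewrite [N * _]mulnC in h4; rewrite !mulnDr in h6.
rewrite mulnCA in h5.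
move: h2 h3 h4 h5 h6.
move: (#|Gam| * N) (#|Gam| * \sum_a _) (#|Gam| * \sum_q _) (#|Gam| * #|Bad|) (t ^ 2 * N).
lia.
Qed.

End Selection.

Section Boxes.
Local Open Scope nat_scope.
Variables (t B : nat) (Gam V : finType) (P : Gam -> 'I_t -> {set V}).
Hypothesis dP : pwdisjoint (fun p : Gam * 'I_t => P p.1 p.2).
Hypothesis cP : forall g i, #|P g i| = B.

Definition box (p : {ffun 'I_t -> Gam * 'I_t}) (a : 'I_t) : {set V} :=
  P (p a).1 (p a).2.

Definition halfbad (Bad : {set {ffun 'I_t -> V}}) (p : {ffun 'I_t -> Gam * 'I_t}) :=
  B ^ t < 2 * #|[set x in Bad | boxed (box p) x]|.

(** Markov's inequality: the boxes of different [p] share no tuple, because the cells are disjoint,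
    so an element of [Bad] is counted for at most one [p]. *)
Lemma card_halfbad (Bad : {set {ffun 'I_t -> V}}) :
  B ^ t * #|[set p | halfbad Bad p]| <= 2 * #|Bad|.
Proof.
apply: (@leq_trans (\sum_(p | halfbad Bad p) 2 * #|[set x in Bad | boxed (box p) x]|)).
  rewrite -sum1dep_card big_distrr /=; apply: leq_sum => p; rewrite muln1 => /ltnW; exact.
rewrite -big_distrr leq_mul2l /=.
apply: (@leq_trans (\sum_p #|[set x in Bad | boxed (box p) x]|)).
  by rewrite [leqRHS](bigID (halfbad Bad)) leq_addr.
under eq_bigr do rewrite -sum1dep_card big_mkcondr /=.
rewrite exchange_big /= -sum1_card; apply: leq_sum => x xB.
case: (pickP (fun p => boxed (box p) x)) => [p px|H]; last first.
  by rewrite big1 // => p _; rewrite H.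
rewrite (bigD1 p) //= px big1 // => q qp; case: ifP => // qx.
case/eqP: qp; apply/ffunP => a.
apply: (pwdisjointP (v := x a) dP); first by have /forallP := qx; exact.
by have /forallP := px; exact.
Qed.

Lemma dense_of_not_halfbad (good : pred {ffun 'I_t -> V}) p :
  ~~ halfbad [set x | ~~ good x] p -> B ^ t <= 2 * #|[set x | boxed (box p) x && good x]|.
Proof.
rewrite /halfbad -leqNgt => H.
have : B ^ t = #|[set x | boxed (box p) x]|.
  rewrite card_boxed (eq_bigr (fun=> B)); last by move=> i _; exact: cP.
  by rewrite prod_nat_const card_ord.
rewrite -(cardsID [set x | good x]) => eB.
have e1 : [set x | boxed (box p) x] :&: [set x | good x] = [set x | boxed (box p) x && good x].
  by apply/setP => x; rewrite !inE.
have e2 : [set x | boxed (box p) x] :\: [set x | good x]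
    = [set x in [set x | ~~ good x] | boxed (box p) x].
  by apply/setP => x; rewrite !inE.
rewrite e1 e2 in eB; move: H; rewrite eB.
move: #|_| #|_| => u w; lia.
Qed.

End Boxes.

Section Step.
Local Open Scope nat_scope.

Lemma leq_expl m n e : m <= n -> m ^ e <= n ^ e.
Proof. by case: e => // e mn; rewrite leq_exp2r. Qed.

(** From [(1 + 1/a)^j (1 - j/a) <= 1], as [1 - m/a] is at least 1/2. *)
Lemma expn_succ_le a m : 2 * m <= a -> a.+1 ^ m <= 2 * a ^ m.
Proof.
move=> ma.
have H j : j <= m -> a.+1 ^ j * (a - j) <= a ^ j.+1.
  elim: j => [|j IHj] jm; first by rewrite expn0 mul1n subn0 expn1.
  apply: (@leq_trans (a * (a.+1 ^ j * (a - j)))); last by rewrite [leqRHS]expnS leq_mul2l IHj ?orbT // ltnW.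
  rewrite expnSr mulnCA -mulnA leq_mul2l; apply/orP; right.
  rewrite mulSn; nia.
case: a => [|a] in ma H *.
  by have -> : m = 0 by lia.
have h := H m (leqnn m).
rewrite -(leq_pmul2r (ltn0Sn a)) -mulnA -expnSr.
apply: (@leq_trans (2 * (a.+2 ^ m * (a.+1 - m)))); last by rewrite leq_mul2l h.
rewrite mulnCA leq_mul2l; apply/orP; right; lia.
Qed.

Variables (s : nat) (C : finType).
Let t := s.+1.

(* Group [g] contributes its parts in cyclically shifted order to the [t]
   transversal families, so each of its parts is used exactly once. *)
Definition cshift (Gam : finType) (i : 'I_s.+1) (p : {ffun 'I_s.+1 -> Gam * 'I_s.+1}) :
  {ffun 'I_s.+1 -> Gam * 'I_s.+1} := [ffun a => ((p a).1, ((p a).2 + i)%R)].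

Lemma cshift_inj (Gam : finType) i : injective (@cshift Gam i).
Proof.
move=> p q /ffunP H; apply/ffunP => a; have := H a; rewrite !ffunE => e.
have /= e1 := congr1 fst e; have /= /addIr e2 := congr1 snd e.
by rewrite [p a]surjective_pairing [q a]surjective_pairing e1 e2.
Qed.

(** A random choice of [s] groups to accompany [g0]. Bad tuples are few through every vertex, hence
    few with first entry in any given part of [g0]; so each of the [t] shifts fails with small
    probability, and a union bound treats them all. *)
Lemma select_shifts (V Gam : finType) (chi : {ffun 'I_t -> V} -> C) (gd : pred C)
    (P : Gam -> 'I_t -> {set V}) (B : nat) (U : {set Gam}) (g0 : Gam) :
  pwdisjoint (fun p : Gam * 'I_t => P p.1 p.2) -> (forall g i, #|P g i| = B) -> 0 < B ->
  (forall v, 32 * t ^ 2 * #|[set x | ~~ gd (chi (fupd x ord0 v))]| <= #|V| ^ t) ->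
  #|V| <= t * B * (#|Gam| + 1) -> 4 * t ^ 2 < #|Gam| ->
  g0 \notin U -> 4 * t * (#|U| + 1) <= #|Gam| ->
  exists p : {ffun 'I_t -> Gam * 'I_t},
    [/\ (p ord0).1 = g0, forall a, (p a).1 \notin U, injective (fun a => (p a).1) &
      forall i, B ^ t <= 2 * #|[set x | boxed (box P (cshift i p)) x && gd (chi x)]|].
Proof.
move=> dP cP B0 Hgd nG tG gU UG.
set n := #|V| in Hgd nG.
have G0 : 0 < #|Gam| by apply: leq_ltn_trans tG.
have n0 : 0 < n.
  rewrite /n; apply: (@leq_trans B) => //; rewrite -(cP g0 ord0); exact: max_card.
pose T : finType := (Gam * 'I_t)%type.
have cT : #|T| = #|Gam| * t by rewrite card_prod card_ord.
have T0 : 0 < #|T| by rewrite cT muln_gt0 G0.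
(* The entry at [ord0] is drawn and then overwritten, so that choices are still counted among all
   functions [p]. *)
pose fix0 (p : {ffun 'I_t -> T}) := fupd p ord0 (g0, ord0 : 'I_t).
pose NG := [set x | ~~ gd (chi x)].
pose BadP := [set p | [exists i, halfbad B P NG (cshift i (fix0 p))]].
have Bad_i i : 16 * t * B ^ s * #|[set p | halfbad B P NG (cshift i (fix0 p))]| * t <= #|T| * n ^ s.
  pose Bi := [set x in NG | x ord0 \in P g0 i].
  have cBi : 32 * t ^ 2 * #|Bi| <= B * n ^ s.
    rewrite -(leq_pmul2l n0).
    have -> : n * (B * n ^ s) = B * n ^ t by rewrite mulnCA -expnS.
    have -> : n * (32 * t ^ 2 * #|Bi|) = 32 * t ^ 2 * (n * #|Bi|) by ring.
    have -> : n * #|Bi| = \sum_(v in P g0 i) #|[set x | ~~ gd (chi (fupd x ord0 v))]|.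
      rewrite -sum1_card (partition_big (fun x : {ffun 'I_t -> V} => x ord0) (mem (P g0 i))) /=; last first.
        by move=> x; rewrite !inE => /andP[].
      rewrite big_distrr /=; apply: eq_bigr => v vP.
      rewrite (card_fupd ord0 v (fun x => ~~ gd (chi x))) sum1dep_card; congr (_ * _).
      apply: eq_card => x; rewrite !inE andbC; case: eqP => //= ->.
      by rewrite vP andbT.
    rewrite big_distrr /= -[X in _ <= X * _](cP g0 i) -sum_nat_const; apply: leq_sum => v _; exact: Hgd.
  have e1 : #|[set p | halfbad B P NG (cshift i (fix0 p))]| =
     #|T| * #|[set p : {ffun 'I_t -> T} | (p ord0 == (g0, ord0 : 'I_t)) && halfbad B P NG (cshift i p)]|.
    exact: (card_fupd ord0 (g0, ord0 : 'I_t) (fun p => halfbad B P NG (cshift i p))).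
  have e2 : #|[set p : {ffun 'I_t -> T} | (p ord0 == (g0, ord0 : 'I_t)) && halfbad B P NG (cshift i p)]|
     <= #|[set p | halfbad B P Bi p]|.
    rewrite -(card_imset _ (@cshift_inj Gam i)); apply: subset_leq_card.
    apply/subsetP => q /imsetP[p]; rewrite inE => /andP[/eqP p0 hp] ->; rewrite inE.
    apply: leq_trans hp _; rewrite leq_mul2l /=; apply: subset_leq_card.
    apply/subsetP => x; rewrite !inE => /andP[-> bx]; rewrite bx /= andbT.
    by have /forallP/(_ ord0) := bx; rewrite /box !ffunE p0 /= add0r.
  have e3 := card_halfbad B dP Bi.
  rewrite e1.
  set A1 := #|[set p : {ffun 'I_t -> T} | _]| in e2 *.
  set A2 := #|[set p | halfbad B P Bi p]| in e2 e3.
  rewrite -(leq_pmul2l B0).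
  have -> : B * (16 * t * B ^ s * (#|T| * A1) * t) = #|T| * (16 * t ^ 2 * (B ^ t * A1)).
    by rewrite [B ^ t]expnS; ring.
  rewrite [leqRHS]mulnCA leq_mul2l; apply/orP; right.
  apply: leq_trans cBi.
  have -> : 32 * t ^ 2 * #|Bi| = 16 * t ^ 2 * (2 * #|Bi|) by ring.
  rewrite leq_mul2l; apply/orP; right; apply: leq_trans e3.
  by rewrite leq_mul2l e2 orbT.
have cBad : 2 * #|BadP| <= (#|Gam| * t) ^ t.
  have h1 : #|BadP| <= \sum_(i < t) #|[set p | halfbad B P NG (cshift i (fix0 p))]|.
    apply: (@leq_trans #|\bigcup_(i < t) [set p | halfbad B P NG (cshift i (fix0 p))]|).
      apply: subset_leq_card; apply/subsetP => p; rewrite inE => /existsP[i Hi].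
      by apply/bigcupP; exists i => //; rewrite inE.
    exact: card_bigcup_le.
  have h2 : 16 * t * B ^ s * #|BadP| <= #|T| * n ^ s.
    rewrite -(leq_pmul2r (ltn0Sn s)) -/t.
    apply: (@leq_trans (\sum_(i < t) #|T| * n ^ s)); last first.
      by rewrite sum_nat_const card_ord mulnC.
    apply: (@leq_trans (\sum_(i < t) 16 * t * B ^ s * #|[set p | halfbad B P NG (cshift i (fix0 p))]| * t)).
      by rewrite -big_distrl -big_distrr /= leq_mul2r leq_mul2l h1 !orbT.
    by apply: leq_sum => i _; exact: Bad_i.
  (* The summand 1 next to [#|Gam|] allows for vertices outside all groups; it costs a factor 2,
     because [#|Gam|] is at least [2 * s]. *)
  have h3 : n ^ s <= B ^ s * t ^ s * (2 * #|Gam| ^ s).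
    apply: (@leq_trans ((t * B * (#|Gam| + 1)) ^ s)).
      exact: leq_expl.
    rewrite !expnMn addn1 [t ^ s * _]mulnC leq_mul2l; apply/orP; right.
    apply: expn_succ_le; apply: leq_trans (ltnW tG); rewrite /t; nia.
  have Bs0 : 0 < B ^ s by rewrite expn_gt0 B0.
  rewrite -cT -(leq_pmul2l Bs0).
  have h4 : #|T| * n ^ s <= #|T| * (B ^ s * t ^ s * (2 * #|Gam| ^ s)).
    by rewrite leq_mul2l h3 orbT.
  have e4 : #|T| * (B ^ s * t ^ s * (2 * #|Gam| ^ s)) = 2 * (B ^ s * #|T| ^ t).
    by rewrite [#|T| ^ t]expnS cT expnMn; ring.
  have h5 : 16 * t * B ^ s * #|BadP| <= 2 * (B ^ s * #|T| ^ t).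
    by rewrite -e4; apply: leq_trans h2 h4.
  have h6 : 4 * (B ^ s * #|BadP|) <= 16 * t * B ^ s * #|BadP|.
    have -> : 16 * t * B ^ s * #|BadP| = t * (16 * (B ^ s * #|BadP|)) by ring.
    apply: leq_trans (leq_pmull _ (ltn0Sn s)); lia.
  rewrite mulnCA; lia.
(* Forbidding [g0] as well keeps the groups distinct once the entry at [ord0] becomes [g0]. *)
have cU' : 4 * t * #|g0 |: U| <= #|Gam| by rewrite cardsU1 gU addnC.
have [p [pB pU pinj]] := select_groups (ltn0Sn s) cU' tG cBad.
have p0 : fix0 p ord0 = (g0, ord0) by rewrite ffunE eqxx.
have pN a : a != ord0 -> fix0 p a = p a by rewrite ffunE => /negbTE->.
exists (fix0 p); split.
- by rewrite p0.
- move=> a; have [->|a0] := eqVneq a ord0; first by rewrite p0.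
  by rewrite pN //; have := pU a; rewrite !inE negb_or => /andP[].
- have pg a : (p a).1 <> g0 by move=> e; have := pU a; rewrite e !inE eqxx.
  move=> a a'; have [->|a0] := eqVneq a ord0; have [->|a'0] := eqVneq a' ord0 => //.
  + by rewrite p0 pN //= => /esym/pg.
  + by rewrite p0 pN //= => /pg.
  + by rewrite !pN //; exact: pinj.
- move=> i; apply: dense_of_not_halfbad => //.
  by move: pB; rewrite inE negb_exists => /forallP/(_ i).
Qed.

End Step.

Section Improve.
Local Open Scope nat_scope.

Lemma pwdisjoint_inj (V I J : finType) (F : J -> {set V}) (f : I -> J) :
  injective f -> pwdisjoint F -> pwdisjoint (fun i => F (f i)).
Proof. by move=> fI dF i j ij; apply: dF; rewrite (inj_eq fI). Qed.

Variables (s : nat) (C V Gam : finType).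
Let t := s.+1.
Variables (chi : {ffun 'I_s.+1 -> V} -> C) (gd : pred C) (b l B0 : nat).
Let B := 4 * t * l * b.
Variables (P : Gam -> 'I_s.+1 -> {set V}) (real : pred Gam).
Hypotheses (b0 : 0 < b) (l0 : 0 < l).
Hypothesis dense_tiling : forall W : 'I_t -> {set V}, pwdisjoint W ->
   (forall i, #|W i| = B) ->
   B ^ t <= 2 * #|[set x | boxed W x && gd (chi x)]| ->
   exists U : 'I_t -> {set V}, [/\ forall i, U i \subset W i,
     forall i, #|U i| = l * b & btil chi gd b (tsup U)].
Hypothesis dP : pwdisjoint (fun p : Gam * 'I_t => P p.1 p.2).
Hypothesis cP : forall g i, #|P g i| = B.
Hypothesis realP : forall g, real g -> mono chi gd (P g).
Hypothesis Hgd : forall v,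
  32 * t ^ 2 * #|[set x | ~~ gd (chi (fupd x ord0 v))]| <= #|V| ^ t.
Hypothesis VG : #|V| <= t * B * (#|Gam| + 1).
Hypothesis tG : 4 * t ^ 2 < #|Gam|.

Let dPg g : pwdisjoint (P g).
Proof. by apply: (pwdisjoint_inj (f := fun i => (g, i)) _ dP) => i j /(congr1 snd). Qed.

(** Groups satisfying [real] are tiles, the others blocks of uncovered vertices. The [t] shifts
    together take [l * b] vertices from each part of each selected group, so real groups stay
    balanced and their remainder is cut into small tiles. The shifts cover [t * t * l * b] vertices;
    at most [s] selected groups are real, as [g0] is not, and each of these gives up [t * l * b].
    Hence the gain of [t * l * b]. *)
Lemma improve_step (U : {set Gam}) (g0 : Gam) :
  ~~ real g0 -> g0 \notin U -> 4 * t * (#|U| + 1) <= #|Gam| ->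
  exists (U' : {set Gam}) (X : {set V}),
   [/\ [disjoint U' & U], #|U'| = t, btil chi gd b X,
       X \subset \bigcup_(g in U') tsup (P g) &
       t * B * #|[set g in U' | real g]| + t * (l * b) <= #|X|].
Proof.
move=> rg0 gU UG.
have B_gt0 : 0 < B by rewrite !muln_gt0 l0 b0.
have [p [p0 pU pinj pdense]] := @select_shifts s C V Gam chi gd P B U g0 dP cP B_gt0 Hgd VG tG gU UG.
pose h a := (p a).1; pose c a := (p a).2.
pose cell (ia : 'I_t * 'I_t) : Gam * 'I_t := (h ia.2, (c ia.2 + ia.1)%R).
have cell_inj : injective cell.
  move=> [i a] [i' a'] e; have /= e1 : (cell (i, a)).1 = (cell (i', a')).1 by rewrite e.
  have /= e2 : (cell (i, a)).2 = (cell (i', a')).2 by rewrite e.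
  by move/pinj: e1 e2 => -> /addrI->.
have dcell := pwdisjoint_inj cell_inj dP.
have boxE i a : box P (cshift i p) a = P (cell (i, a)).1 (cell (i, a)).2.
  by rewrite /box ffunE.
have /fin_all_exists[W HW] : forall i, exists U : 'I_t -> {set V},
   [/\ forall a, U a \subset box P (cshift i p) a,
     forall a, #|U a| = l * b & btil chi gd b (tsup U)].
  move=> i; apply: dense_tiling; last exact: pdense.
  - move=> a a' aa'; rewrite !boxE; apply: dcell.
    by apply: contraNneq aa' => -[->].
  - by move=> a; rewrite /box cP.
have sW i a : W i a \subset P (h a) (c a + i)%R.
  by have [/(_ a) + _ _] := HW i; rewrite boxE.
have cW i a : #|W i a| = l * b by have [_ ->] := HW i.
have dW : pwdisjoint (fun ia : 'I_t * 'I_t => W ia.1 ia.2).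
  by apply: (pwdisjoint_sub _ dcell) => -[i a]; exact: sW.
have dW1 : pwdisjoint (fun i => tsup (W i)).
  move=> i j ij; apply: disjoint_bigcupl => a _; apply: disjoint_bigcupr => a' _.
  by apply: (dW (i, a) (j, a')); apply: contraNneq ij => -[->].
pose X1 := \bigcup_i tsup (W i).
have cX1 : #|X1| = t * (t * (l * b)).
  rewrite card_pwbigcup // (eq_bigr (fun=> t * (l * b))) => [|i _].
    by rewrite sum_nat_const card_ord.
  apply: card_tsup; first by move=> a; exact: cW.
  by apply: (pwdisjoint_inj (f := fun a => (i, a)) _ dW) => a a' /(congr1 snd).
have bX1 : btil chi gd b X1 by apply: btil_bigcup => // i _; have [] := HW i.
pose D a j := P (h a) j :\: X1.
have sD a j : D a j \subset P (h a) j by rewrite subsetDl.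
(* Part [j] of the group [h a] is met by exactly one shift, namely [j - c a] in the cyclic group
   ['I_t]. *)
have cD a j : #|D a j| = (4 * t * l - l) * b.
  rewrite cardsD cP mulnBl -/B -(cW (j - c a)%R a); congr (_ - #|pred_of_set _|).
  apply/setP => v; rewrite inE; apply/andP/idP => [[vP /bigcupP[i _ /bigcupP[a' _ vW]]]|vW].
    have vP' := subsetP (sW i a') v vW.
    have e : (h a, j) = cell (i, a') by apply: (pwdisjointP (v := v) dP).
    have /= e1 := congr1 fst e; have /= e2 := congr1 snd e.
    by move/pinj: e1 e2 => -> ->; rewrite addrC addKr.
  split; first by have := subsetP (sW (j - c a)%R a) v vW; rewrite addrC subrK.
  by apply/bigcupP; exists (j - c a)%R => //; apply/bigcupP; exists a.
have dD : pwdisjoint (fun a => tsup (D a)).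
  move=> a a' aa'; apply: disjoint_bigcupl => j _; apply: disjoint_bigcupr => j' _.
  apply: disjointW (sD a j) (sD a' j') _.
  apply: (dP (i := (h a, j)) (j := (h a', j'))).
  by apply: contraNneq aa' => /(congr1 fst)/pinj->.
have dDa a : pwdisjoint (D a) by apply: pwdisjoint_sub (sD a) (dPg _).
pose X2 := \bigcup_(a | real (h a)) tsup (D a).
have cX2 : #|X2| = #|[set a | real (h a)]| * (t * ((4 * t * l - l) * b)).
  rewrite card_pwbigcup // (eq_bigr (fun=> t * ((4 * t * l - l) * b))) => [|i _].
    by rewrite sum_nat_const cardsE.
  exact: card_tsup.
have bX2 : btil chi gd b X2.
  apply: btil_bigcup => // a ra; apply: btil_split (dDa a) (cD a) _.
  exact: mono_sub (sD a) (realP ra).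
have dX : [disjoint X1 & X2].
  apply: disjoint_bigcupr => a _; apply: disjoint_bigcupr => j _.
  by rewrite -setI_eq0 /D setIDA setIC -setIDA setDv setI0.
exists [set h a | a in [set: 'I_t]], (X1 :|: X2); split.
- rewrite disjoint_subset; apply/subsetP => g /imsetP[a _ ->]; exact: pU.
- by rewrite card_imset // cardsT card_ord.
- exact: btil_union.
- rewrite subUset; apply/andP; split; apply/subsetP => v.
    move=> /bigcupP[i _ /bigcupP[a _ /(subsetP (sW i a)) vP]].
    by apply/bigcupP; exists (h a); [exact: imset_f|apply/bigcupP; exists (c a + i)%R].
  move=> /bigcupP[a _ /bigcupP[j _ /(subsetP (sD a j)) vP]].
  by apply/bigcupP; exists (h a); [exact: imset_f|apply/bigcupP; exists j].
have -> : #|[set g in [set h a | a in [set: 'I_t]] | real g]| = #|[set a | real (h a)]|.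
  rewrite -(card_imset _ pinj); apply: eq_card => g; rewrite !inE.
  apply/andP/imsetP => [[/imsetP[a _ ->] ra]|[a]]; first by exists a; rewrite ?inE.
  by rewrite inE => ra ->; split=> //; apply/imsetP; exists a; rewrite ?inE.
have cr : #|[set a | real (h a)]| <= s.
  have : [set a | real (h a)] \subset [set~ ord0].
    by apply/subsetP => a; rewrite !inE; apply: contraTneq => ->; rewrite /h p0.
  by move/subset_leq_card; rewrite cardsC1 card_ord.
rewrite card_disjointU // cX1 cX2.
move: cr; set r := #|[set a | real (h a)]| => cr.
have -> : (4 * t * l - l) * b = B - l * b by rewrite mulnBl.
have lB : l * b <= B by rewrite /B /t; nia.
have -> : r * (t * (B - l * b)) = t * B * r - r * (t * (l * b)).
  by rewrite [LHS]mulnA mulnBr; congr (_ - _); ring.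
have h1 : r * (t * (l * b)) + t * (l * b) <= t * (t * (l * b)).
  by rewrite -mulSnr leq_mul2r; apply/orP; right.
have h2 : r * (t * (l * b)) <= t * B * r.
  rewrite mulnC leq_mul2r leq_mul2l lB !orbT //.
lia.
Qed.

(** Each step uses [t] new groups, so [t * J] unreal groups always leave a fresh [g0], and
    [4 * t ^ 2 * J <= #|Gam|] keeps the used groups a small fraction of all. *)
Lemma improve (J : nat) : 4 * t ^ 2 * J <= #|Gam| ->
  t * J <= #|[set g | ~~ real g]| ->
  exists (U : {set Gam}) (X : {set V}),
   [/\ btil chi gd b X, X \subset \bigcup_(g in U) tsup (P g) &
       t * B * #|[set g in U | real g]| + J * (t * (l * b)) <= #|X|].
Proof.
move=> JG Jr.
suff H j : j <= J -> exists (U : {set Gam}) (X : {set V}),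
   [/\ #|U| = t * j, btil chi gd b X, X \subset \bigcup_(g in U) tsup (P g) &
       t * B * #|[set g in U | real g]| + j * (t * (l * b)) <= #|X|].
  by have [U [X [_ bX sX cX]]] := H J (leqnn J); exists U, X.
elim: j => [_|j IHj jJ].
  exists set0, set0; split; rewrite ?cards0 ?muln0 ?sub0set //; first exact: btil0.
  rewrite (_ : [set g in _ | _] = set0) ?cards0 ?muln0 //.
  by apply/setP => g; rewrite !inE.
have [U [X [cU bX sX cX]]] := IHj (ltnW jJ).
have [g0 gr gU] : exists2 g0, ~~ real g0 & g0 \notin U.
  have : ~~ ([set g | ~~ real g] \subset U).
    apply/negP => /subset_leq_card; rewrite cU leqNgt => /negP; apply.
    apply: leq_trans Jr; by rewrite ltn_pmul2l.
  by case/subsetPn => g; rewrite inE; exists g.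
have UG : 4 * t * (#|U| + 1) <= #|Gam|.
  apply: leq_trans JG; rewrite cU.
  have -> : 4 * t ^ 2 * J = 4 * t * (t * J) by ring.
  rewrite leq_mul2l; apply/orP; right; move: jJ; rewrite /t; nia.
have [U' [X' [dU' cU' bX' sX' cX']]] := improve_step gr gU UG.
have dX : [disjoint X' & X].
  apply: disjointW sX' sX _; apply: disjoint_bigcupl => g gU'; apply: disjoint_bigcupr => g' g'U.
  apply: disjoint_bigcupl => i _; apply: disjoint_bigcupr => i' _.
  apply: (dP (i := (g, i)) (j := (g', i'))); apply: contraTneq g'U => /(congr1 fst) /= <-.
  by have := dU'; rewrite disjoint_subset => /subsetP/(_ g gU').
exists (U' :|: U), (X' :|: X); split.
- by rewrite card_disjointU // cU' cU mulnS.
- exact: btil_union.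
- rewrite bigcup_setU; exact: setUSS.
have -> : [set g in U' :|: U | real g] = [set g in U' | real g] :|: [set g in U | real g].
  by apply/setP => g; rewrite !inE andb_orl.
have dr : [disjoint [set g in U' | real g] & [set g in U | real g]].
  by apply: disjointW dU'; apply/subsetP => g; rewrite inE => /andP[].
rewrite !card_disjointU // mulnDr mulSn; lia.
Qed.

End Improve.

Section Almost.
Local Open Scope nat_scope.
Variables (s : nat) (C : finType) (gd : pred C) (g : nat).
Let t := s.+1.
Hypothesis g0 : 0 < g.

(** The good tuples through each vertex are almost all of them; the constant is the one required by
    [select_shifts]. *)
Definition mindeg_good (V : finType) (chi : {ffun 'I_s.+1 -> V} -> C) :=
  forall v, 32 * s.+1 ^ 2 * #|[set x | ~~ gd (chi (fupd x ord0 v))]| <= #|V| ^ s.+1.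

(** Chosen so that [K] times the gain [J * (t * (l * b))] of one round is at least [#|V|]. *)
Let K := 128 * g * t ^ 3.

(* Every increment of j saves |V| / K vertices, but needs the previous tiling at
   the larger scale B = 4 * t * l * b. *)
Lemma almost_tiling_step (j b : nat) : 0 < b -> j <= K ->
  exists N, forall (V : finType) (chi : {ffun 'I_t -> V} -> C),
    N <= #|V| -> mindeg_good chi ->
    exists2 X : {set V}, btil chi gd b X &
      (g * #|~: X| <= #|V|) \/ (K * #|~: X| <= (K - j) * #|V|).
Proof.
move=> + jK; elim: j jK b => [_|j IHj jK] b b0.
  exists 0 => V chi _ _; exists set0; first exact: btil0.
  by right; rewrite subn0 setC0 cardsT.
have [B0 HB0] := @dense_tuple_tiling t C b b0 (ltn0Sn s).
pose l := B0.+1; pose B := 4 * t * l * b.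
have B_gt0 : 0 < B by rewrite !muln_gt0 b0.
have [N HN] := IHj (ltnW jK) B B_gt0.
pose q0 := 16 * g * t ^ 2.
exists (maxn N (t * B * (q0 + 1) + 1)) => V chi; rewrite geq_max => /andP[VN Vbig] Hgd.
have [X bX [HX|HX]] := HN V chi VN Hgd.
  by exists X; [apply: btil_refine bX|left].
have [HgX|HgX] := leqP (g * #|~: X|) #|V|.
  by exists X; [apply: btil_refine bX|left].
have [Gam2 [P2 [tP2 dP2 eX]]] := btil_index bX.
(* The uncovered vertices are cut into as many blocks of the shape of a tile as possible; fewer than
   [t * B] of them remain. *)
pose q1 := #|~: X| %/ (t * B).
have tB0 : 0 < t * B by rewrite muln_gt0.
have [P1 [cP1 sP1 dP1]] : exists P : 'I_q1 * 'I_t -> {set V},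
    [/\ forall i, #|P i| = B, forall i, P i \subset ~: X & pwdisjoint P].
  apply: disjoint_subsets_fin; rewrite card_prod !card_ord -mulnA; exact: leq_trunc_div.
pose Gam : finType := ('I_q1 + Gam2)%type.
pose P (h : Gam) (i : 'I_t) : {set V} := match h with inl h => P1 (h, i) | inr h => P2 h i end.
pose real (h : Gam) := if h is inr _ then true else false.
have sP2 h i : P2 h i \subset X.
  rewrite eX; have sub1 : P2 h i \subset tsup (P2 h) by apply: bigcup_sup.
  by apply: subset_trans sub1 _; apply: (@bigcup_sup _ _ h xpredT (fun h => tsup (P2 h))).
have dX : [disjoint ~: X & X] by rewrite -setI_eq0 setIC setICr.
have dP : pwdisjoint (fun p : Gam * 'I_t => P p.1 p.2).
  move=> [[h|h] i] [[h'|h'] i'] /= hh.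
  - by apply: dP1; apply: contraNneq hh => -[-> ->].
  - exact: disjointW (sP1 _) (sP2 _ _) dX.
  - by rewrite disjoint_sym; exact: disjointW (sP1 _) (sP2 _ _) dX.
  - by apply: (dP2 (h, i) (h', i')); apply: contraNneq hh => -[-> ->].
have cP h i : #|P h i| = B by case: h => h; [exact: cP1|have [-> //] := tP2 h].
have realP h : real h -> mono chi gd (P h) by case: h => // h _; have [_ _] := tP2 h.
have cX : #|X| = t * B * #|Gam2|.
  rewrite eX card_pwbigcup.
    rewrite (eq_bigr (fun=> t * B)) => [|h _]; first by rewrite sum_nat_const mulnC.
    by have [c2 d2 _] := tP2 h; exact: card_tsup.
  move=> h h' hh'; apply: disjoint_bigcupl => i _; apply: disjoint_bigcupr => i' _.
  by apply: (dP2 (h, i) (h', i')); apply: contraNneq hh' => -[->].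
set q := #|Gam|.
have qE : q = q1 + #|Gam2| by rewrite /q card_sum card_ord.
have VE : #|V| = #|X| + #|~: X| by rewrite cardsC.
have cXC : #|~: X| < t * B * (q1 + 1).
  by rewrite addn1 mulnC -/q1 ltn_ceil.
have cXC2 : t * B * q1 <= #|~: X| by rewrite mulnC leq_trunc_div.
have VG : #|V| < t * B * (q + 1) by rewrite VE cX qE; nia.
have VG2 : t * B * q <= #|V| by rewrite VE cX qE; nia.
have qbig : q0 < q + 1.
  rewrite -(ltn_pmul2l tB0); apply: leq_ltn_trans VG; apply: leq_trans Vbig.
  by rewrite addn1 leqW // leq_mul2l leq_addr orbT.
have tq : 4 * t ^ 2 < q.
  have t20 : 0 < t ^ 2 by [].
  have : 16 * t ^ 2 <= q0.
    have -> : q0 = g * (16 * t ^ 2) by rewrite /q0; ring.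
    exact: leq_pmull.
  move: t20 qbig; clear; move: (q0) (q) (t ^ 2) => a1 a2 a3; lia.
(* Small enough for disjoint selections and, as more than [#|V| / g] vertices are uncovered, for the
   supply of unreal groups. *)
pose J := q %/ (8 * g * t ^ 2).
have d0 : 0 < 8 * g * t ^ 2 by rewrite !muln_gt0 g0.
have J1 : 8 * g * t ^ 2 * J <= q by rewrite mulnC leq_trunc_div.
have J2 : q < 8 * g * t ^ 2 * (J + 1) by rewrite addn1 mulnC ltn_ceil.
have dense W : pwdisjoint W -> (forall i, #|W i| = B) ->
   B ^ t <= 2 * #|[set x | boxed W x && gd (chi x)]| ->
   exists U : 'I_t -> {set V}, [/\ forall i, U i \subset W i,
     forall i, #|U i| = l * b & btil chi gd b (tsup U)].
  by apply: HB0; rewrite leqnSn.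
have JG : 4 * t ^ 2 * J <= q.
  apply: leq_trans J1; rewrite leq_mul2r; apply/orP; right.
  by rewrite leq_mul2r -{1}(muln1 4) leq_mul ?orbT.
have Jr : t * J <= #|[set h | ~~ real h]|.
  have -> : #|[set h | ~~ real h]| = q1.
    rewrite -[RHS](card_ord q1) -[RHS]cardsT -(card_imset _ (@inl_inj 'I_q1 Gam2)).
    apply: eq_card => -[h|h]; rewrite inE /=; apply/esym.
      by apply/imsetP; exists h.
    by apply/imsetP => -[].
  have h1 : g * (t * J) <= q.
    apply: leq_trans J1; rewrite mulnA leq_mul2r; apply/orP; right.
    have -> : 8 * g * t ^ 2 = g * t * (8 * t) by ring.
    exact: leq_pmulr.
  have h2 : t * B * q < t * B * (g * (q1 + 1)).
    apply: leq_ltn_trans VG2 _; apply: leq_trans HgX _.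
    by rewrite [leqRHS]mulnCA leq_mul2l ltnW ?orbT.
  rewrite ltn_pmul2l // in h2.
  have : g * (t * J) < g * (q1 + 1) by apply: leq_ltn_trans h1 h2.
  by rewrite ltn_pmul2l // addn1 ltnS.
have [U [Y [bY sY cY]]] := @improve s C V Gam chi gd b l P real b0 (ltn0Sn _) dense dP cP realP Hgd (ltnW VG) tq J JG Jr.
pose Z := \bigcup_(h | real h && (h \notin U)) tsup (P h).
have dPt : pwdisjoint (fun h => tsup (P h)).
  move=> h h' hh'; apply: disjoint_bigcupl => i _; apply: disjoint_bigcupr => i' _.
  by apply: (dP (h, i) (h', i')); apply: contraNneq hh' => /(congr1 fst) /= ->.
have dPg h : pwdisjoint (P h).
  by apply: (pwdisjoint_inj (f := fun i => (h, i)) _ dP) => i i' /(congr1 snd).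
have bZ : btil chi gd b Z.
  apply: btil_bigcup => // h /andP[rh _].
  by apply: (btil_split (l := 4 * t * l)) (dPg h) (cP h) (realP _ rh).
have cZ : #|Z| = t * B * #|[set h | real h && (h \notin U)]|.
  rewrite card_pwbigcup // (eq_bigr (fun=> t * B)) => [|h _].
    by rewrite sum_nat_const mulnC cardsE.
  exact: card_tsup.
have dYZ : [disjoint Y & Z].
  apply: disjointWl sY _; apply: disjoint_bigcupl => h hU; apply: disjoint_bigcupr => h' /andP[_ h'U].
  by apply: dPt; apply: contraNneq h'U => <-.
have cG2 : #|[set h in U | real h]| + #|[set h | real h && (h \notin U)]| = #|Gam2|.
  transitivity #|[set h | real h]|.
    rewrite -(cardsID U [set h | real h]); congr (_ + _); apply: eq_card => h;
      by rewrite !inE andbC.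
  rewrite -[RHS]cardsT -(card_imset _ (@inr_inj 'I_q1 Gam2)).
  apply: eq_card => -[h|h]; rewrite inE /=; apply/esym.
    by apply/imsetP => -[].
  by apply/imsetP; exists h.
exists (Y :|: Z); [exact: btil_union|right].
have cYZ : #|X| + J * (t * (l * b)) <= #|Y :|: Z|.
  rewrite card_disjointU // cZ cX -cG2 mulnDr.
  by rewrite -[leqLHS]addnA [X in _ + X <= _]addnC addnA leq_add2r.
have cN : #|~: (Y :|: Z)| + J * (t * (l * b)) <= #|~: X|.
  have := cardsC (Y :|: Z); rewrite [#|predT|]VE; move: cYZ; clear; lia.
have J0 : 0 < J.
  rewrite divn_gt0 //; move: qbig; rewrite addn1 ltnS; apply: leq_trans.
  by rewrite /q0 !leq_mul2r !orbT.
have nJ : #|V| <= K * (J * (t * (l * b))).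
  have -> : K * (J * (t * (l * b))) = t * B * (32 * g * t ^ 2 * J).
    by rewrite /K /B; ring.
  apply: leq_trans (ltnW VG) _; rewrite leq_mul2l; apply/orP; right.
  rewrite addn1; apply: leq_trans J2 _.
  have -> : 32 * g * t ^ 2 * J = 8 * g * t ^ 2 * (4 * J) by ring.
  rewrite leq_mul2l; apply/orP; right; move: J0; clear; lia.
have h3 : K * #|~: (Y :|: Z)| + K * (J * (t * (l * b))) <= K * #|~: X|.
  by rewrite -mulnDr leq_mul2l cN orbT.
have h4 : (K - j) * #|V| = (K - j.+1) * #|V| + #|V|.
  by rewrite -mulSnr -subSn.
move: h3 h4 nJ HX; clear.
move: (K * #|~: (Y :|: Z)|) (K * (J * _)) (K * #|~: X|) ((K - j) * #|V|) ((K - j.+1) * #|V|) #|V|.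
by move=> a1 a2 a3 a4 a5 a6 h3 -> ha /(leq_trans h3) hb; rewrite -(leq_add2r a6); apply: leq_trans hb; rewrite leq_add2l.
Qed.

Lemma almost_tiling (b : nat) : 0 < b ->
  exists N, forall (V : finType) (chi : {ffun 'I_t -> V} -> C),
    N <= #|V| -> mindeg_good chi ->
    exists2 X : {set V}, btil chi gd b X & g * #|~: X| <= #|V|.
Proof.
move=> b0; have [N HN] := almost_tiling_step b0 (leqnn K).
exists N => V chi VN Hgd; have [X bX [HX|HX]] := HN V chi VN Hgd; exists X => //.
move: HX; rewrite subnn mul0n leqn0 muln_eq0 => /orP[|/eqP->]; last by rewrite muln0.
by rewrite eqn0Ngt !muln_gt0 g0.
Qed.

End Almost.

(** * A bounded difference inequality *)

Section McDiarmid.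
Local Open Scope ring_scope.
Variable R : realType.

(** From [expR u <= 1 / (1 - u)] and [(1 + u + 2 u^2) (1 - u) = 1 + u^2 (1 - 2 u)]. *)
Lemma expR_le_quadratic (u : R) : u <= 1 / 2%:R -> expR u <= 1 + u + 2%:R * u ^+ 2.
Proof.
move=> u12.
have h1 : expR u * (1 - u) <= 1.
  rewrite -[leRHS](expRxMexpNx_1 u) ler_wpM2l ?expR_ge0 //.
  by have := expR_ge1Dx (- u).
have h2 : 0 < 1 - u by lra.
rewrite -(ler_pM2r h2); apply: (le_trans h1); nra.
Qed.

Definition favg (V : finType) n (f : {ffun 'I_n -> V} -> R) : R :=
  (\sum_x f x) / (#|V| ^ n)%:R.

(* Induction on n, averaging over all coordinates but the first. *)
Lemma mcdiarmid_exp (V : finType) n (f : {ffun 'I_n -> V} -> R) (c l : R) :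
  (0 < #|V|)%N -> (forall x i v, f (fupd x i v) - f x <= c) ->
  0 <= l -> l * c <= 1 / 2%:R ->
  \sum_x expR (l * (favg f - f x)) <=
    (#|V| ^ n)%:R * expR (n%:R * (2%:R * (l * c) ^+ 2)).
Proof.
move=> V0 + l0 lc; elim: n f => [|n IHn] f bd.
  have eqf x y : f x = f y by congr f; apply/ffunP => -[].
  rewrite mul0r expR0 expn0 mulr1.
  rewrite (eq_bigr (fun=> 1)) => [|x _].
    by rewrite sumr_const card_ffun card_ord expn0.
  rewrite /favg (eq_bigr (fun=> f x)) => [|y _]; last exact: eqf.
  by rewrite sumr_const card_ffun card_ord expn0 divr1 subrr mulr0 expR0.
pose h a (y : {ffun 'I_n -> V}) := f (fins ord0 a y).
pose g a := favg (h a).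
have VN m : (#|V| ^ m)%:R != 0 :> R by rewrite pnatr_eq0 -lt0n expn_gt0 V0.
have V0R : 0 < #|V|%:R :> R by rewrite ltr0n.
have FE : favg f = (\sum_a g a) / #|V|%:R.
  by rewrite /g /favg (big_fins ord0) /= -mulr_suml -mulrA -invfM -natrM -expnSr.
have updE a y i v : h a (fupd y i v) = f (fupd (fins ord0 a y) (lift ord0 i) v).
  congr f; apply/ffunP => j; rewrite !ffunE.
  case: unliftP => [k ->|->] /=; first by rewrite ffunE (inj_eq lift_inj).
  by [].
have hdiff a a' y : h a' y - h a y <= c.
  rewrite /h -(_ : fupd (fins ord0 a y) ord0 a' = fins ord0 a' y) //.
  apply/ffunP => j; rewrite !ffunE; by case: unliftP => [k ->|->].
have gdiff a a' : g a' - g a <= c.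
  rewrite /g /favg -mulrBl -sumrB ler_pdivrMr ?ltr0n ?expn_gt0 ?V0 //.
  apply: le_trans (ler_sum _ (fun y _ => hdiff a a' y)) _.
  by rewrite sumr_const card_ffun card_ord mulr_natr.
have Fg a : - c <= favg f - g a <= c.
  have e1 : (favg f - g a) * #|V|%:R = \sum_a' (g a' - g a).
    by rewrite sumrB sumr_const mulrBl FE divfK ?gt_eqF // mulr_natr.
  apply/andP; split.
    rewrite -(ler_pM2r V0R) e1 mulNr -lerN2 opprK -sumrN mulr_natr -sumr_const.
    by apply: ler_sum => a' _; rewrite opprB.
  rewrite -(ler_pM2r V0R) e1 mulr_natr -sumr_const.
  by apply: ler_sum => a' _.
have c0 : 0 <= c.
  by have := gdiff; case/card_gt0P: V0 => a _ /(_ a a); rewrite subrr.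
rewrite (big_fins ord0) /=.
set K := 2%:R * (l * c) ^+ 2 in IHn *.
apply: (@le_trans _ _ (\sum_a (1 + l * (favg f - g a) + K) *
   ((#|V| ^ n)%:R * expR (n%:R * K)))).
  apply: ler_sum => a _.
  rewrite (eq_bigr (fun y => expR (l * (favg f - g a)) * expR (l * (g a - h a y)))); last first.
    by move=> y _; rewrite -expRD -mulrDr; congr expR; rewrite /h; ring.
  rewrite -mulr_sumr; apply: ler_pM; rewrite ?expR_ge0 //.
  - by apply: sumr_ge0 => y _; rewrite expR_ge0.
  - have /andP[H1 H2] := Fg a.
    apply: le_trans (expR_le_quadratic _) _.
      by apply: le_trans lc; rewrite ler_wpM2l.
    rewrite lerD2l /K ler_wpM2l // !exprMn ler_wpM2l ?sqr_ge0 //.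
    by nra.
  - apply: IHn => x i v; rewrite updE; exact: bd.
rewrite -mulr_suml big_split big_split /= -mulr_sumr.
(* The deviations of the conditional averages sum to zero, so the linear term drops out and a
   coordinate costs only a factor [1 + K]. *)
have -> : \sum_a (favg f - g a) = 0.
  by rewrite sumrB sumr_const FE -[X in X - _]mulr_natr divfK ?gt_eqF // subrr.
rewrite mulr0 addr0 !sumr_const -[K *+ _]mulr_natr -[X in _ + X]mulrC.
rewrite expnS natrM [leLHS](_ : _ = (#|V|%:R * (#|V| ^ n)%:R) * ((1 + K) * expR (n%:R * K))); last by rewrite -/(1 *+ #|V|); ring.
apply: ler_wpM2l; first by rewrite mulr_ge0 ?ler0n.
have -> : n.+1%:R * K = K + n%:R * K by rewrite -(natr1 n); ring.
by rewrite expRD ler_wpM2r ?expR_ge0 ?expR_ge1Dx.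
Qed.

(** Markov's inequality for the exponential moment; [l] is left free, to be optimised where the
    bound is used. *)
Lemma mcdiarmid (V : finType) n (f : {ffun 'I_n -> V} -> R) (c l e : R) :
  (0 < #|V|)%N -> (forall x i v, f (fupd x i v) - f x <= c) ->
  0 <= l -> l * c <= 1 / 2%:R ->
  #|[set x | f x < favg f - e]|%:R <=
    (#|V| ^ n)%:R * expR (n%:R * (2%:R * (l * c) ^+ 2) - l * e).
Proof.
move=> V0 bd l0 lc.
rewrite expRD expRN mulrA ler_pdivlMr ?expR_gt0 //.
apply: le_trans (mcdiarmid_exp V0 bd l0 lc).
rewrite -sum1dep_card natr_sum mulr_suml.
rewrite [leRHS](bigID (fun x => f x < favg f - e)) /=.
rewrite ler_wpDr ?sumr_ge0 // => [x _|]; first exact: expR_ge0.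
apply: ler_sum => x fx; rewrite mul1r ler_expR ler_wpM2l //; lra.
Qed.

End McDiarmid.

(** * Minimum degree of random induced subgraphs *)

Section Pull.
Variables (k : nat) (G : kgraph k).

(** Entries of [x] may coincide. The condition on [#|e|] and the uniformity of G make [x] injective
    on each edge, and composition with [x] sends homomorphisms into the pullback to homomorphisms
    into G. *)
Definition pull (I : finType) (x : {ffun I -> vert G}) : {set {set I}} :=
  [set e : {set I} | (#|e| == k) && (x @: e \in edges G)].

Lemma pull_uniform (I : finType) (x : {ffun I -> vert G}) e :
  e \in pull x -> #|e| = k.
Proof. by rewrite inE => /andP[/eqP]. Qed.

Definition pullG (I : finType) (x : {ffun I -> vert G}) : kgraph k :=
  KGraph (@pull_uniform I x).

End Pull.

Section Degrees.
Local Open Scope nat_scope.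
Variables (k d : nat) (G : kgraph k).

Lemma min_degree_le (S : {set vert G}) : #|S| = d -> min_degree G d <= set_degree S.
Proof.
move=> dS; apply/bigmax_leqP => l /forallP/(_ S); rewrite dS eqxx; exact.
Qed.

(** Some [d]-set has smallest degree, and this degree is at most the number of edges, hence among
    the values over which [min_degree] takes its maximum. *)
Lemma min_degree_ge (R : realType) (a : R) : d <= #|vert G| ->
  (forall S : {set vert G}, #|S| = d -> a <= (set_degree S)%:R)%R ->
  (a <= (min_degree G d)%:R)%R.
Proof.
move=> dG H.
have [S0 /eqP S0d] : exists S : {set vert G}, #|S| == d.
  have : 0 < #|[set S : {set vert G} | #|S| == d]| by rewrite card_draws bin_gt0.
  by case/card_gt0P => S; rewrite inE; exists S.
case: (@arg_minnP _ S0 (fun S : {set vert G} => #|S| == d) (@set_degree k G)).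
  by rewrite S0d.
move=> S /eqP Sd Smin.
have lS : set_degree S < #|edges G|.+1.
  by rewrite ltnS; apply: subset_leq_card; apply/subsetP => e; rewrite inE => /andP[].
apply: le_trans (H S Sd) _; rewrite ler_nat.
apply: (@leq_bigmax_cond _ _ _ (Ordinal lS)) => /=.
by apply/forallP => S'; apply/implyP => /Smin.
Qed.

(** Counts the orderings of [e :\: S] for the edges [e] containing [S]: a union with [k] elements
    forces [u] to be injective with image disjoint from [S]. *)
Lemma card_link (S : {set vert G}) : #|S| = d -> d <= k ->
  #|[set u : {ffun 'I_(k - d) -> vert G} | S :|: u @: [set: 'I_(k - d)] \in edges G]|
  = (k - d)`! * set_degree S.
Proof.
move=> Sd dk; rewrite -sum1dep_card.
rewrite (partition_big (fun u : {ffun 'I_(k - d) -> vert G} => S :|: u @: [set: 'I_(k - d)])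
  (mem [set e in edges G | S \subset e])) /=; last first.
  by move=> u Hu; rewrite inE Hu subsetUl.
rewrite mulnC -sum_nat_const; apply: eq_bigr => e; rewrite inE => /andP[eG Se].
have cES : #|e :\: S| = k - d.
  by rewrite cardsD (setIidPr Se) Sd (edges_uniform eG).
rewrite sum1dep_card -[in RHS]ffactnn -[X in X ^_ _]cES -[X in _ ^_ X](card_ord (k - d)).
rewrite -card_inj_ffuns_on; apply: eq_card => u; rewrite !inE.
apply/andP/andP => [[_ /eqP Hu]|[/ffun_onP uon /injectiveP uinj]].
  have cu : #|u @: [set: 'I_(k - d)]| = k - d.
    apply/eqP; rewrite eqn_leq; apply/andP; split.
      by apply: leq_trans (leq_imset_card _ _) _; rewrite cardsT card_ord.
    have := (leq_card_setU S (u @: [set: 'I_(k - d)])).1.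
    by rewrite Hu (edges_uniform eG) Sd; lia.
  have dis : [disjoint S & u @: [set: 'I_(k - d)]].
    rewrite -(leq_card_setU _ _).2.
    by rewrite Hu (edges_uniform eG) cu Sd; apply/eqP; lia.
  split.
    apply/ffun_onP => i; rewrite inE -Hu inE imset_f ?inE // orbT andbT.
    apply: contraL (dis) => uiS; apply/pred0Pn; exists (u i).
    by rewrite /= uiS imset_f ?inE.
  apply/injectiveP => i j; apply: (imset_injP _) => //; rewrite ?inE //.
  by rewrite cu cardsT card_ord.
have uE : u @: [set: 'I_(k - d)] = e :\: S.
  apply/eqP; rewrite eqEcard; apply/andP; split.
    by apply/subsetP => v /imsetP[i _ ->]; exact: uon.
  by rewrite cES card_imset // cardsT card_ord.
have HU : S :|: u @: [set: 'I_(k - d)] = e.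
  by rewrite uE -{1}(setIidPr Se) setID.
by rewrite HU eG eqxx.
Qed.

End Degrees.

Section Estimates.
Local Open Scope ring_scope.
Variable R : realType.

Lemma ler_nat_eventually (x : R) : exists N, forall n, (N <= n)%N -> x <= n%:R.
Proof.
exists (Num.truncn `|x|).+1 => n nN; apply: le_trans (ler_norm x) _.
apply: ltW; apply: lt_le_trans (truncnS_gt _) _.
by rewrite ler_nat.
Qed.

(** Induction on [r], spending half of [e] on the new factor, as [(1 - e/2)^2 >= 1 - e]; when
    [e >= 2] the left-hand side is not positive. *)
Lemma ffact_lower (a r : nat) (e : R) : 0 < e ->
  exists N, forall n, (N <= n)%N -> (1 - e) * n%:R ^+ r <= ((n - a) ^_ r)%:R.
Proof.
elim: r e => [|r IHr] e e0.
  by exists 0%N => n _; rewrite ffactn0 expr0 mulr1; lra.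
have e2 : 0 < e / 2 by lra.
have [N HN] := IHr (e / 2) e2.
have [M HM] := ler_nat_eventually ((a + r)%:R / (e / 2)).
exists (N + M + a + r)%N => n nN.
rewrite ffactnSr natrM exprSr -subnDA natrB; last lia.
have h1 : (1 - e / 2) * n%:R ^+ r <= ((n - a) ^_ r)%:R by apply: HN; lia.
have h2 : (a + r)%:R <= e / 2 * n%:R.
  by rewrite mulrC -ler_pdivrMr //; apply: HM; lia.
have h3 : 0 <= n%:R ^+ r :> R by rewrite exprn_ge0 ?ler0n.
have h4 : 0 <= n%:R :> R by rewrite ler0n.
have [e1|e1] := lerP 1 (e / 2).
  apply: (@le_trans _ _ 0); last first.
    by rewrite mulr_ge0 ?ler0n // subr_ge0 ler_nat; lia.
  rewrite mulr_le0_ge0 ?mulr_ge0 //; lra.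
have h5 : (1 - e / 2) * n%:R <= n%:R - (a + r)%:R by lra.
have h6 := ler_pM (mulr_ge0 (ltW (_ : 0 < 1 - e / 2)) h3) (mulr_ge0 (ltW (_ : 0 < 1 - e / 2)) h4) h1 h5.
apply: le_trans (h6 _ _); [|lra|lra].
rewrite [leRHS](_ : _ = ((1 - e / 2) ^+ 2) * (n%:R ^+ r * n%:R)); last by ring.
rewrite ler_wpM2r ?mulr_ge0 //; nra.
Qed.

Lemma leq_ffact2l r n m : (n <= m)%N -> (n ^_ r <= m ^_ r)%N.
Proof.
move=> nm; elim: r => [|r IHr]; first by rewrite !ffactn0.
by rewrite !ffactnSr leq_mul // leq_sub2r.
Qed.

Lemma ffact_le_expn n m : (n ^_ m <= n ^ m)%N.
Proof.
elim: m => [|m IHm]; first by rewrite ffactn0.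
by rewrite ffactnSr expnSr leq_mul // leq_subr.
Qed.

Lemma bin_le_expn n m : ('C(n, m) <= n ^ m)%N.
Proof.
apply: leq_trans (ffact_le_expn n m).
by rewrite -bin_ffact leq_pmulr ?fact_gt0.
Qed.

(** With [b = a / (q + 1)], [expR (n a)] is the power [q + 1] of [expR (b n)], hence at least
    [(b n)^(q + 1)], which has one power of [n] to spare. *)
Lemma poly_expR_small (a C : R) (q : nat) : 0 < a -> 0 <= C ->
  exists N, forall n, (N <= n)%N -> C * n%:R ^+ q * expR (- (n%:R * a)) <= 1 / 2.
Proof.
move=> a0 C0.
pose b := a / q.+1%:R.
have b0 : 0 < b by rewrite divr_gt0 ?ltr0Sn.
have [N HN] := ler_nat_eventually (2 * C / b ^+ q.+1).
exists N => n /HN.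
have bq : 0 < b ^+ q.+1 by rewrite exprn_gt0.
rewrite ler_pdivrMr // => H.
rewrite expRN ler_pdivrMr ?expR_gt0 //.
have -> : n%:R * a = (b * n%:R) *+ q.+1.
  by rewrite -[RHS]mulr_natr [RHS]mulrAC divfK ?pnatr_eq0 // mulrC.
rewrite -[_ *+ q.+1]mulr_natl expRM_natl.
have n0 : 0 <= n%:R :> R by rewrite ler0n.
have bn0 : 0 <= b * n%:R by rewrite mulr_ge0 // ltW.
have h1 : (b * n%:R) ^+ q.+1 <= expR (b * n%:R) ^+ q.+1.
  rewrite lerXn2r ?nnegrE ?expR_ge0 ?bn0 //.
  by apply: le_trans (expR_ge1Dx _); rewrite lerDr ler01.
apply: (@le_trans _ _ (1 / 2 * (b * n%:R) ^+ q.+1)); last by rewrite ler_wpM2l //; lra.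
rewrite exprMn.
have h2 : 0 <= n%:R ^+ q :> R by rewrite exprn_ge0.
rewrite [n%:R ^+ q.+1]exprSr; nra.
Qed.

End Estimates.

Section Glue.
Local Open Scope nat_scope.
Variables (I V : finType).

Definition glue (A : {set I}) (z x : {ffun I -> V}) : {ffun I -> V} :=
  [ffun i => if i \in A then z i else x i].

(** Exchanging the coordinates in [A] between [z] and [x] is an involution on pairs; so freezing
    random values on [A] and then drawing the others gives a uniform tuple. *)
Lemma card_glue (A : {set I}) (Q : pred {ffun I -> V}) :
  #|V| ^ #|I| * #|[set y | Q y]| = \sum_(z : {ffun I -> V}) #|[set x | Q (glue A z x)]|.
Proof.
rewrite -card_ffun.
transitivity (\sum_(z : {ffun I -> V}) \sum_(y : {ffun I -> V}) (Q y : nat)).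
  by rewrite sum_nat_const card_sum_mem.
under [RHS]eq_bigr do rewrite card_sum_mem.
rewrite !pair_big /=.
rewrite [RHS](reindex (fun p : {ffun I -> V} * {ffun I -> V} => (glue A p.2 p.1, glue A p.1 p.2))) /=.
  apply: eq_bigr => -[z y] _ /=; congr (nat_of_bool (Q _)).
  by apply/ffunP => i; rewrite !ffunE; case: ifP => //= ->.
exists (fun p : {ffun I -> V} * {ffun I -> V} => (glue A p.2 p.1, glue A p.1 p.2)) => -[z y] _ /=.
  by congr (_, _); apply/ffunP => i; rewrite !ffunE; case: (i \in A).
by congr (_, _); apply/ffunP => i; rewrite !ffunE; case: (i \in A).
Qed.

(** Redrawing the coordinate [j] leaves [w y] fixed, so the two agree with probability
    [1 / #|V|]. *)
Lemma card_collision (i j : I) (w : {ffun I -> V} -> V) :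
  (forall y a, w (fupd y j a) = w y) ->
  #|V| * #|[set y : {ffun I -> V} | w y == y j]| = #|V| ^ #|I|.
Proof.
move=> wE; rewrite (card_resample j (fun y => w y == y j)) -card_ffun -[RHS]sum1_card.
apply: eq_bigr => y _; rewrite -(cards1 (w y)); apply: eq_card => a.
by rewrite !inE wE ffunE eqxx eq_sym.
Qed.

End Glue.

Section NonInjective.
Local Open Scope nat_scope.

Lemma card_noninj (V : finType) s (v : V) :
  #|V| * #|[set y : {ffun 'I_s.+1 -> V} | ~~ injectiveb (fupd y ord0 v)]|
    <= s.+1 ^ 2 * #|V| ^ s.+1.
Proof.
(* When [p.1 < p.2], the position [p.2] is not [ord0], so its entry is random and the left-hand side
   does not depend on it. *)
pose T (p : 'I_s.+1 * 'I_s.+1) :=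
   [set y : {ffun 'I_s.+1 -> V} | fupd y ord0 v p.1 == y p.2].
apply: (@leq_trans (#|V| * #|\bigcup_(p : 'I_s.+1 * 'I_s.+1 | (p.1 < p.2)) T p|)).
  rewrite leq_mul2l; apply/orP; right; apply: subset_leq_card.
  apply/subsetP => y; rewrite inE => /injectivePn[i [j ij Hij]].
  have [ltij|leji] := ltnP i j.
    apply/bigcupP; exists (i, j) => //=; rewrite inE /= Hij ffunE.
    by case: ifP => [/eqP ji|_]; [rewrite ji in ltij|rewrite eqxx].
  have ltji : j < i by rewrite ltn_neqAle leji andbT eq_sym.
  apply/bigcupP; exists (j, i) => //=; rewrite inE /= -Hij ffunE.
  by case: ifP => [/eqP ji|_]; [rewrite ji in ltji|rewrite eqxx].
apply: leq_trans (leq_mul (leqnn _) (card_bigcup_le _ _)) _.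
rewrite big_distrr /= big_mkcond /=.
apply: (@leq_trans (\sum_(p : 'I_s.+1 * 'I_s.+1) #|V| ^ s.+1)); last first.
  by rewrite sum_nat_const card_prod card_ord.
apply: leq_sum => -[i j] _ /=; case: ifP => // ij.
rewrite card_collision ?card_ord // => y a.
rewrite !ffunE /=; case: eqP => // _; case: eqP => // ji.
by rewrite ji ltnn in ij.
Qed.

End NonInjective.

Section Sampling.
Local Open Scope ring_scope.
Variable R : realType.

(* The values at S and at ord0 are frozen to those of z.  McDiarmid is applied to
   the number f of (k - d)-tuples of the other positions completing S to an edge,
   repetitions allowed; (k - d)! times the degree of S bounds f from above. *)
Lemma link_tail (k d : nat) (G : kgraph k) (D mu : R) (s : nat)
    (S : {set 'I_s.+1}) (z : {ffun 'I_s.+1 -> vert G}) :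
  (d < k)%N -> 0 <= D <= 1 -> 0 < mu <= 1 -> (0 < #|vert G|)%N ->
  (D + mu) * 'C(#|vert G| - d, k - d)%:R <= (min_degree G d)%:R ->
  (1 - mu / 16) * #|vert G|%:R ^+ (k - d) <= ((#|vert G| - d) ^_ (k - d))%:R ->
  (1 - mu / 16) * s.+1%:R ^+ (k - d) <= ((s.+1 - d.+1) ^_ (k - d))%:R ->
  #|S| = d -> {in S &, injective z} ->
  #|[set x | (set_degree (G := pullG (glue (ord0 |: S) z x)) S)%:R <
      (D + mu / 2) * 'C(s.+1 - d, k - d)%:R]|%:R <=
  (#|vert G| ^ s.+1)%:R * expR (- (s.+1%:R * (mu ^+ 2 / (128 * (k - d)%:R ^+ 2)))).
Proof.
move=> dk /andP[D0 D1] /andP[mu0 mu1] V0 degG nbig sbig Sd zinj.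
set r := (k - d)%N in nbig sbig degG *; set V := vert G in V0 nbig degG z zinj *.
have r0 : (0 < r)%N by rewrite subn_gt0.
have r0R : 0 < r%:R :> R by rewrite ltr0n.
pose A := ord0 |: S.
pose L (u : {ffun 'I_r -> V}) := (z @: S) :|: u @: [set: 'I_r] \in edges G.
pose comp (x : {ffun 'I_s.+1 -> V}) (tau : {ffun 'I_r -> 'I_s.+1}) :=
  [ffun i => x (tau i)].
pose off (tau : {ffun 'I_r -> 'I_s.+1}) := tau \in ffun_on (mem (~: A)).
pose f (x : {ffun 'I_s.+1 -> V}) : R := (\sum_(tau | off tau) (L (comp x tau) : nat))%:R.
have zSd : #|z @: S| = d by rewrite card_in_imset.
have edgeE (x : {ffun 'I_s.+1 -> V}) tau : off tau -> L (comp x tau) ->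
   S :|: tau @: [set: 'I_r] \in pull (glue A z x).
  move=> offt Lx; have imE : glue A z x @: (S :|: tau @: [set: 'I_r]) =
      (z @: S) :|: comp x tau @: [set: 'I_r].
    rewrite imsetU; congr (_ :|: _).
      by apply: eq_in_imset => i iS; rewrite ffunE /A !inE iS orbT.
    rewrite -imset_comp; apply: eq_imset => i /=; rewrite !ffunE.
    by have /ffun_onP/(_ i) := offt; rewrite inE => /negbTE->.
  have Lx1 := Lx; rewrite /L in Lx1; rewrite inE imE Lx1 andbT eqn_leq; apply/andP; split.
    apply: leq_trans (leq_card_setU _ _).1 _; rewrite Sd.
    have := leq_imset_card tau [set: 'I_r]; rewrite cardsT card_ord => h.
    by rewrite -[leqRHS](subnKC (ltnW dk)) leq_add2l.
  by rewrite -(edges_uniform Lx) -/r -imE leq_imset_card.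
have f_le x : f x <= (r`! * set_degree (G := pullG (glue A z x)) S)%:R.
  have /= := @card_link k d (pullG (glue A z x)) S Sd (ltnW dk).
  rewrite -/r => <-; rewrite /f ler_nat.
  rewrite card_sum_mem big_mkcond /=; apply: leq_sum => tau _.
  case: ifP => // offt; case Lx: (L _) => //.
  by rewrite (edgeE x tau).
(* Changing the entry at [i] affects only the maps [tau] that take the value [i], at most
   [r * s.+1 ^ r.-1] of them. *)
have bdd x i v : f (fupd x i v) - f x <= (r * s.+1 ^ r.-1)%:R.
  rewrite lerBlDl /f -natrD ler_nat.
  have -> : (r * s.+1 ^ r.-1 = \sum_(j : 'I_r) #|[set tau : {ffun 'I_r -> 'I_s.+1} | tau j == i]|)%N.
    rewrite (eq_bigr (fun=> s.+1 ^ r.-1)%N) => [|j _].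
      by rewrite sum_nat_const card_ord.
    have := @card_fupd 'I_r 'I_s.+1 j i predT.
    rewrite (_ : [set _ | _] = setT); last by apply/setP => ?; rewrite !inE.
    rewrite cardsT card_ffun !card_ord.
    have -> : (s.+1 ^ r = s.+1 * s.+1 ^ r.-1)%N by rewrite -expnS prednK.
    move/eqP; rewrite eqn_pmul2l // => /eqP->; apply: eq_card => tau.
    by rewrite !inE andbT.
  under [X in (_ <= _ + X)%N]eq_bigr do rewrite card_sum_mem.
  rewrite exchange_big /= big_mkcond [X in (_ <= X + _)%N]big_mkcond -big_split /=.
  apply: leq_sum => tau _; case: ifP => // _.
  have [/existsP[j tj]|] := boolP [exists j, tau j == i].
    rewrite (bigD1 j) //= tj; case: (L _); case: (L _) => //=; lia.
  rewrite negb_exists => /forallP ti.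
  suff -> : comp (fupd x i v) tau = comp x tau by rewrite leq_addr.
  by apply/ffunP => j; rewrite !ffunE (negbTE (ti j)).
have n0 : 0 < #|V|%:R :> R by rewrite ltr0n.
have s0 : 0 < s.+1%:R :> R by rewrite ltr0n.
have rs : (r <= s.+1)%N.
  rewrite leqNgt; apply/negP => srr; move: sbig.
  rewrite ffact_small; last by rewrite (leq_ltn_trans (leq_subr _ _)).
  by rewrite leNgt => /negP; apply; rewrite mulr_gt0 ?exprn_gt0 //; lra.
have cL : (D + mu) * (1 - mu / 16) * #|V|%:R ^+ r <= #|[set u | L u]|%:R.
  have /= := @card_link k d G (z @: S) zSd (ltnW dk).
  rewrite -/r => ->; rewrite natrM -mulrA.
  apply: (@le_trans _ _ ((D + mu) * ((#|V| - d) ^_ r)%:R)).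
    by rewrite ler_wpM2l //; lra.
  rewrite -bin_ffact natrM mulrA mulrC ler_wpM2l ?ler0n //.
  by apply: le_trans degG _; rewrite ler_nat min_degree_le.
(* For injective [tau] avoiding [A] the entries [x (tau i)] are independent and uniform, so each
   such [tau] contributes the edge density at the image of [S]. The factor [(1 - mu / 16) ^ 2] costs
   at most [mu / 4]. *)
have favg_ge : (D + 3 / 4 * mu) * s.+1%:R ^+ r <= favg f.
  rewrite /favg ler_pdivlMr ?ltr0n ?expn_gt0 ?V0 //.
  rewrite /f -natr_sum exchange_big /=.
  apply: (@le_trans _ _ ((s.+1 - d.+1) ^_ r * (#|[set u | L u]| * #|V| ^ (s.+1 - r)))%N%:R); last first.
    rewrite ler_nat.
    apply: (@leq_trans (\sum_(tau | off tau && injectiveb tau) #|[set u | L u]| * #|V| ^ (s.+1 - r))%N).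
      rewrite sum_nat_const leq_mul2r; apply/orP; right.
      apply: (@leq_trans (#|~: A| ^_ r)).
        apply: leq_ffact2l.
        have := cardsC A; rewrite card_ord.
        have : (#|A| <= d.+1)%N by rewrite /A cardsU1 Sd; case: (_ \notin _).
        by move=> cA cC; rewrite leq_subLR -[leqLHS]cC leq_add2r.
      rewrite -[X in _ ^_ X](card_ord r) -card_inj_ffuns_on cardsE.
      by apply: eq_leq; apply: eq_card => tau; rewrite ?inE.
    rewrite big_mkcondr /=; apply: leq_sum => tau offt.
    case: injectiveP => // injt.
    have := @card_comp_inj _ _ V tau L injt; rewrite !card_ord => <-.
    by rewrite card_sum_mem.
  rewrite !natrM !natrX.
  have -> : #|V|%:R ^+ s.+1 = #|V|%:R ^+ r * #|V|%:R ^+ (s.+1 - r) :> R.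
    by rewrite -exprD subnKC.
  rewrite !mulrA ler_wpM2r ?exprn_ge0 ?ler0n //.
  set X := s.+1%:R ^+ r in sbig *; set Y := #|V|%:R ^+ r in cL *.
  have X0 : 0 < X by rewrite exprn_gt0.
  have Y0 : 0 < Y by rewrite exprn_gt0.
  have h1 : 0 <= (1 - mu / 16) * X by rewrite mulr_ge0 ?ltW //; lra.
  have h2 : 0 <= (D + mu) * (1 - mu / 16) * Y.
    by rewrite !mulr_ge0 ?ltW //; lra.
  apply: le_trans (ler_pM h1 h2 sbig cL).
  rewrite [leRHS](_ : _ = (1 - mu / 16) ^+ 2 * (D + mu) * (X * Y)); last by ring.
  rewrite -[leLHS]mulrA; apply: ler_wpM2r; first by rewrite mulr_ge0 ?ltW.
  nra.
pose c : R := (r * s.+1 ^ r.-1)%:R.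
have c0 : 0 < c by rewrite ltr0n muln_gt0 r0 expn_gt0.
(* Since [s.+1 ^ r = c * s.+1 / r], the exponent is [s.+1] times [2 theta^2 - theta mu / (4 r)],
   which is least at this [theta]. *)
pose theta : R := mu / (16 * r%:R).
have th0 : 0 < theta by rewrite divr_gt0 // mulr_gt0.
have lc : theta / c * c = theta by rewrite divfK ?gt_eqF.
have th1 : theta <= 1 / 2.
  rewrite /theta ler_pdivrMr ?mulr_gt0 //.
  have : 1 <= r%:R :> R by rewrite ler1n.
  lra.
have := @mcdiarmid R V s.+1 f c (theta / c) (mu / 4 * s.+1%:R ^+ r) V0 bdd.
rewrite lc => /(_ (ltW (divr_gt0 th0 c0)) th1).
have -> : s.+1%:R * (2 * theta ^+ 2) - theta / c * (mu / 4 * s.+1%:R ^+ r)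
   = - (s.+1%:R * (mu ^+ 2 / (128 * r%:R ^+ 2))).
  have -> : s.+1%:R ^+ r = c * s.+1%:R / r%:R :> R.
    rewrite /c natrM natrX -[X in _ ^+ X = _](prednK r0) exprSr.
    by field; rewrite gt_eqF.
  by rewrite /theta; field; rewrite !gt_eqF ?ltr0n ?expn_gt0 ?r0.
move=> Htail; apply: le_trans Htail; rewrite ler_nat; apply: subset_leq_card; apply/subsetP => x.
rewrite !inE => Hx; apply: le_lt_trans (f_le x) _.
rewrite natrM; apply: (@lt_le_trans _ _ ((D + mu / 2) * s.+1%:R ^+ r)); last first.
  have : 0 < s.+1%:R ^+ r :> R by rewrite exprn_gt0.
  nra.
have fact0 : 0 < r`!%:R :> R by rewrite ltr0n fact_gt0.
apply: (@lt_le_trans _ _ (r`!%:R * ((D + mu / 2) * 'C(s.+1 - d, r)%:R))).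
  by rewrite ltr_pM2l.
rewrite mulrC -mulrA -natrM bin_ffact ler_wpM2l //; first lra.
rewrite -natrX ler_nat; by apply: leq_trans (ffact_le_expn _ _) _; rewrite leq_exp2r // leq_subr.
Qed.
End Sampling.

Section Sampling2.
Local Open Scope ring_scope.
Variable R : realType.

Definition degree_good (k d : nat) (D : R) (H : kgraph k) : bool :=
  D * 'C(#|vert H| - d, k - d)%:R <= (min_degree H d)%:R.

(** A bad tuple either repeats a vertex, with probability of order [s^2 / n], or fails at one of at
    most [s.+1 ^ d] sets [S], with probability exponentially small in [s]. Hence any factor
    [c * s.+1 ^ q] is affordable: [s] is taken large for the second kind, then [n] for the first. *)
Lemma sampling (k d c q : nat) (D mu : R) :
  (d < k)%N -> 0 <= D <= 1 -> 0 < mu <= 1 ->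
  exists S0, forall s, (S0 <= s)%N -> exists N, forall G : kgraph k,
    (N <= #|vert G|)%N -> degree_good d (D + mu) G -> forall v : vert G,
    (c * s.+1 ^ q * #|[set y : {ffun 'I_s.+1 -> vert G} |
       ~~ degree_good d (D + mu / 2) (pullG (fupd y ord0 v))]| <= #|vert G| ^ s.+1)%N.
Proof.
move=> dk D01 mu01; have /andP[D0 D1] := D01; have /andP[mu0 mu1] := mu01.
set r := (k - d)%N.
have r0 : (0 < r)%N by rewrite subn_gt0.
have r0R : 0 < r%:R :> R by rewrite ltr0n.
have k0 : 0 < mu / 16 by lra.
have [S1 HS1] := ffact_lower d.+1 r k0.
have [N1 HN1] := ffact_lower d r k0.
pose a := mu ^+ 2 / (128 * r%:R ^+ 2).
have a0 : 0 < a by rewrite divr_gt0 ?mulr_gt0 ?exprn_gt0.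
have [S2 HS2] := poly_expR_small (d + q) a0 (ler0n R c).
exists (maxn S1 (maxn S2 k)) => s; rewrite !geq_max => /and3P[sS1 sS2 sk].
exists (maxn N1 (maxn (2 * c * s.+1 ^ (q + 2)) 1))%N => G.
rewrite !geq_max => /and3P[nN1 nc n0] degG v.
set n := #|vert G| in nN1 nc n0 *.
pose Bad := [set y : {ffun 'I_s.+1 -> vert G} |
       ~~ degree_good d (D + mu / 2) (pullG (fupd y ord0 v))].
rewrite -/Bad.
pose NI := [set y : {ffun 'I_s.+1 -> vert G} | ~~ injectiveb (fupd y ord0 v)].
pose BS (S : {set 'I_s.+1}) := [set y : {ffun 'I_s.+1 -> vert G} |
   injectiveb (fupd y ord0 v) &&
   ((set_degree (G := pullG (fupd y ord0 v)) S)%:R < (D + mu / 2) * 'C(s.+1 - d, k - d)%:R)].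
have subB : Bad \subset NI :|: \bigcup_(S : {set 'I_s.+1} | #|S| == d) BS S.
  apply/subsetP => y; rewrite !inE => /negP yB.
  case: (boolP (injectiveb _)) => //= yinj.
  apply/bigcupP; apply: contrapT => H; apply: yB; rewrite /degree_good.
  apply: min_degree_ge; first by rewrite /= card_ord (leq_trans (ltnW dk)) // leqW.
  move=> S Sd; rewrite /= card_ord leNgt; apply/negP => HS; apply: H.
  by exists S; [rewrite Sd|rewrite inE yinj].
have cBS (S : {set 'I_s.+1}) : #|S| == d -> #|BS S|%:R <= (n ^ s.+1)%:R * expR (- (s.+1%:R * a)).
  move=> /eqP Sd.
  have h0 : 0 < (n ^ s.+1)%:R :> R by rewrite ltr0n expn_gt0 n0.
  rewrite -(ler_pM2l h0) -natrM.
  have := card_glue (ord0 |: S) (mem (BS S)); rewrite card_ord -/n.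
  rewrite (_ : [set y | mem (BS S) y] = BS S); last by apply/setP => y; rewrite inE.
  move=> ->; rewrite natr_sum.
  apply: (@le_trans _ _ (\sum_(z : {ffun 'I_s.+1 -> vert G}) ((n ^ s.+1)%:R * expR (- (s.+1%:R * a))))); last first.
    by rewrite sumr_const card_ffun card_ord -/n -[leLHS]mulr_natl.
  apply: ler_sum => z _.
  have [zinj|zninj] := boolP [forall i in S, forall j in S, (fupd z ord0 v i == fupd z ord0 v j) ==> (i == j)].
    have := @link_tail R k d G D mu s S (fupd z ord0 v) dk D01 mu01 n0 degG _ _ Sd.
    move=> H; apply: le_trans (H _ _ _) => //.
    - rewrite ler_nat; apply: subset_leq_card; apply/subsetP => x; rewrite !inE => /andP[_].
      suff -> : fupd (glue (ord0 |: S) z x) ord0 v = glue (ord0 |: S) (fupd z ord0 v) x by [].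
      by apply/ffunP => i; rewrite !ffunE !inE; case: eqP.
    - exact: HN1.
    - by apply: HS1; rewrite leqW.
    - move=> i j iS jS Hij; apply/eqP; move: zinj => /forallP/(_ i); rewrite iS => /forallP/(_ j).
      by rewrite jS Hij eqxx.
  rewrite (_ : [set x | _] = set0) ?cards0 ?mulr_ge0 ?ler0n ?expR_ge0 //.
  apply/setP => x; rewrite !inE; apply/negbTE; apply: contra zninj => /andP[/injectiveP inj _].
  apply/forallP => i; apply/implyP => iS; apply/forallP => j; apply/implyP => jS.
  apply/implyP => /eqP Hij; apply/eqP; apply: inj.
  by move: Hij; rewrite !ffunE !inE iS jS !orbT.
have cNI := card_noninj s v; rewrite -/NI -/n in cNI.
have cBad : (#|Bad| <= #|NI| + \sum_(S : {set 'I_s.+1} | #|S| == d) #|BS S|)%N.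
  apply: leq_trans (subset_leq_card subB) _; apply: leq_trans (leq_card_setU _ _).1 _.
  by rewrite leq_add2l card_bigcup_le.
have cSum : (\sum_(S : {set 'I_s.+1} | #|S| == d) #|BS S|)%:R <=
   s.+1%:R ^+ d * ((n ^ s.+1)%:R * expR (- (s.+1%:R * a))) :> R.
  rewrite natr_sum; apply: le_trans (ler_sum _ cBS) _.
  rewrite sumr_const -[leLHS]mulr_natl ler_wpM2r ?mulr_ge0 ?ler0n ?expR_ge0 //.
  rewrite -natrX ler_nat; apply: leq_trans (bin_le_expn _ _).
  have := card_draws 'I_s.+1 d; rewrite card_ord => <-.
  by apply: eq_leq; apply: eq_card => S; rewrite inE.
have NI2 : (2 * c * s.+1 ^ q * #|NI| <= n ^ s.+1)%N.
  rewrite -(leq_pmul2l n0).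
  have : (2 * c * s.+1 ^ q * (n * #|NI|) <= 2 * c * s.+1 ^ q * (s.+1 ^ 2 * n ^ s.+1))%N.
    by rewrite leq_mul2l cNI orbT.
  have -> : (2 * c * s.+1 ^ q * (s.+1 ^ 2 * n ^ s.+1) = (2 * c * s.+1 ^ (q + 2)) * n ^ s.+1)%N by rewrite expnD; ring.
  have : (2 * c * s.+1 ^ (q + 2) * n ^ s.+1 <= n * n ^ s.+1)%N by rewrite leq_mul2r nc orbT.
  by move=> h1 h2; rewrite mulnCA; apply: leq_trans h2 h1.
rewrite -(ler_nat R) natrM natrM natrX.
have h2 := HS2 s.+1 (leqW sS2).
have NI3 : c%:R * s.+1%:R ^+ q * #|NI|%:R <= 1 / 2 * (n ^ s.+1)%:R :> R.
  by move: NI2; rewrite -(ler_nat R) !natrM natrX; lra.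
have cBadR : #|Bad|%:R <= #|NI|%:R + s.+1%:R ^+ d * ((n ^ s.+1)%:R * expR (- (s.+1%:R * a))) :> R.
  apply: (@le_trans _ _ (#|NI| + \sum_(S : {set 'I_s.+1} | #|S| == d) #|BS S|)%:R).
    by rewrite ler_nat.
  by rewrite natrD lerD2l.
have cs0 : 0 <= c%:R * s.+1%:R ^+ q :> R by rewrite mulr_ge0 ?exprn_ge0.
apply: le_trans (ler_wpM2l cs0 cBadR) _.
rewrite mulrDr.
have -> : c%:R * s.+1%:R ^+ q * (s.+1%:R ^+ d * ((n ^ s.+1)%:R * expR (- (s.+1%:R * a)))) =
  (c%:R * s.+1%:R ^+ (d + q) * expR (- (s.+1%:R * a))) * (n ^ s.+1)%:R :> R.
  by rewrite exprD; ring.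
have h3 := ler_wpM2r (ler0n R (n ^ s.+1)) h2.
lra.
Qed.

End Sampling2.

(** * Lattices and cones of homomorphism vectors *)

Section Span.
Local Open Scope ring_scope.
Variables (k : nat) (F : kgraph k).
Let m := #|vert F|.

Definition homs (I : finType) (E : {set {set I}}) (phi : {ffun vert F -> I}) :=
  [forall e in edges F, phi @: e \in E].

Definition vec (I : finType) (phi : {ffun vert F -> I}) (i : I) : nat :=
  #|[set f | phi f == i]|.

Lemma sum_vec (I : finType) (phi : {ffun vert F -> I}) : (\sum_i vec phi i = m)%N.
Proof.
rewrite /m -sum1_card (partition_big phi predT) //=; apply: eq_bigr => i _.
by rewrite sum1dep_card.
Qed.

Lemma vec_le (I : finType) (phi : {ffun vert F -> I}) i : (vec phi i <= m)%N.
Proof. exact: max_card. Qed.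

(** [S] restricts the coefficients: all integers give the lattice, nonnegative reals the cone.
    Coefficients are indexed by all functions and vanish off the homomorphisms. *)
Definition span (A : nzSemiRingType) (S : A -> Prop) (I : finType) (E : {set {set I}})
    (z : I -> A) : Prop :=
  exists c : {ffun vert F -> I} -> A,
    [/\ forall phi, S (c phi), forall phi, ~~ homs E phi -> c phi = 0 &
        forall i, z i = \sum_phi c phi * (vec phi i)%:R].

Lemma span_ext (A : nzSemiRingType) (S : A -> Prop) (I : finType) (E : {set {set I}})
    (z z' : I -> A) : (forall i, z i = z' i) -> span S E z -> span S E z'.
Proof. by move=> zz' [c [Sc c0 zE]]; exists c; split=> // i; rewrite -zz'. Qed.

Lemma span_family (A : nzSemiRingType) (S : A -> Prop) (I J : finType) (E : {set {set I}})
    (c : J -> A) (phi : J -> {ffun vert F -> I}) (z : I -> A) :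
  S 0 -> (forall a b, S a -> S b -> S (a + b)) ->
  (forall j, S (c j)) -> (forall j, homs E (phi j)) ->
  (forall i, z i = \sum_j c j * (vec (phi j) i)%:R) -> span S E z.
Proof.
move=> S0 SD Sc hphi zE; exists (fun psi => \sum_(j | phi j == psi) c j); split.
- by move=> psi; elim/big_ind: _.
- move=> psi npsi; rewrite big1 // => j /eqP e.
  by case/negP: npsi; rewrite -e.
- move=> i; rewrite zE (partition_big phi predT) //=; apply: eq_bigr => psi _.
  by rewrite mulr_suml; apply: eq_bigr => j /eqP->.
Qed.

Lemma span_lin (A : comNzRingType) (S : A -> Prop) (I J : finType) (E : {set {set I}})
    (a : J -> A) (z : J -> I -> A) :
  S 0 -> (forall a b, S a -> S b -> S (a + b)) -> (forall j b, S b -> S (a j * b)) ->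
  (forall j, span S E (z j)) -> span S E (fun i => \sum_j a j * z j i).
Proof.
move=> S0 SD SM /fin_all_exists[c Hc].
exists (fun psi => \sum_j a j * c j psi); split.
- by move=> psi; elim/big_ind: _ => // j _; apply: SM; have [] := Hc j.
- by move=> psi npsi; rewrite big1 // => j _; have [_ -> //] := Hc j; rewrite mulr0.
- move=> i; under eq_bigr => j _ do (have [_ _ ->] := Hc j; rewrite mulr_sumr).
  rewrite exchange_big /=; apply: eq_bigr => psi _; rewrite mulr_suml.
  by apply: eq_bigr => j _; rewrite mulrA.
Qed.

Definition lat (I : finType) (E : {set {set I}}) (z : I -> int) := span (fun=> True) E z.
Definition cone (R : realType) (I : finType) (E : {set {set I}}) (z : I -> R) :=
  span (fun a => 0 <= a) E z.

(** The cone is only asked for the vectors with one entry 0 and all others 1: in terms of these, a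
    nearly constant vector has nonnegative coefficients. *)
Definition hom_full (R : realType) t (E : {set {set 'I_t}}) : Prop :=
  (forall u, cone E (fun i => (i != u)%:R : R)) /\
  (forall z : 'I_t -> int, (m%:Z %| \sum_i z i)%Z -> lat E z).

(** For a complete blow-up of the k-graph with edges [E] and parts of sizes [z], such a combination
    is the type of a perfect F-tiling; [realize] turns it into one. *)
Definition comb (I : finType) (E : {set {set I}}) (z : I -> nat) : Prop :=
  exists c : {ffun vert F -> I} -> nat,
    (forall phi, ~~ homs E phi -> c phi = 0%N) /\
    forall i, (z i = \sum_phi c phi * vec phi i)%N.

(** Subtracting a multiple of one homomorphism vector, whose entries sum to [m], leaves a vector of
    sum zero, and differences of unit vectors generate all of these. *)
Lemma full_lattice (I : finType) (E : {set {set I}}) (i0 : I) (phi0 : {ffun vert F -> I}) :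
  homs E phi0 -> (forall u, lat E (fun i => (i == u)%:R - (i == i0)%:R)) ->
  forall z : I -> int, (m%:Z %| \sum_i z i)%Z -> lat E z.
Proof.
move=> h0 hd z /dvdzP[q Hq].
have h1 : lat E (fun i => (vec phi0 i)%:R).
  apply: (span_family (J := unit) (c := fun=> 1) (phi := fun=> phi0)) => // i.
  by rewrite big_const card_unit /= addr0 mul1r.
pose y i := z i - q * (vec phi0 i)%:R.
pose zz (o : option I) : I -> int := if o is Some u then fun i => (i == u)%:R - (i == i0)%:R
   else fun i => (vec phi0 i)%:R.
pose a (o : option I) : int := if o is Some u then y u else q.
have H := @span_lin int (fun=> True) I (option I) E a zz Logic.I (fun _ _ _ _ => Logic.I) (fun _ _ _ => Logic.I).
have Hzz j : span (fun=> True) E (zz j) by case: j => [u|]; [exact: hd|exact: h1].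
apply: span_ext (H Hzz).
move=> i; rewrite (bigD1 None) //=.
rewrite (reindex_omap Some id) /=; last by case.
rewrite (eq_bigl predT) => [|u]; last by rewrite eqxx.
under eq_bigr do rewrite mulrBr.
rewrite sumrB -mulr_suml.
have -> : \sum_u y u = 0.
  rewrite sumrB -mulr_sumr -natr_sum sum_vec Hq; apply/eqP; rewrite subr_eq0.
  by rewrite -/m natz.
rewrite mul0r subr0 (bigD1 i) //= eqxx mulr1 big1 ?addr0 => [|u ui].
  by rewrite /y; ring.
by rewrite eq_sym (negbTE ui) mulr0.
Qed.

End Span.

Section PullSpan.
Local Open Scope ring_scope.
Variables (R : realType) (k : nat) (F G : kgraph k).
Let m := #|vert F|.

Lemma homs_comp (I J : finType) (E : {set {set I}}) (E' : {set {set J}}) (j : I -> J)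
    (phi : {ffun vert F -> I}) :
  (forall e, e \in E -> j @: e \in E') -> homs E phi -> homs E' [ffun f => j (phi f)].
Proof.
move=> jE /forallP H; apply/forallP => e; apply/implyP => eF.
have /implyP/(_ eF) := H e => /jE; rewrite -imset_comp.
by congr (_ \in E'); apply: eq_imset => f; rewrite ffunE.
Qed.

Lemma vec_comp (I J : finType) (j : I -> J) (phi : {ffun vert F -> I}) i :
  injective j -> vec [ffun f => j (phi f)] (j i) = vec phi i.
Proof. by move=> ji; apply: eq_card => f; rewrite !inE ffunE (inj_eq ji). Qed.

Lemma vec_comp0 (I J : finType) (j : I -> J) (phi : {ffun vert F -> I}) i :
  i \notin codom j -> vec [ffun f => j (phi f)] i = 0%N.
Proof.
move=> ni; apply/eqP; rewrite cards_eq0 -subset0; apply/subsetP => f; rewrite !inE ffunE.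
by move=> /eqP e; case/negP: ni; rewrite -e codom_f.
Qed.

Lemma pull_comp (I J : finType) (x : {ffun J -> vert G}) (j : I -> J) e :
  injective j -> e \in pull [ffun i => x (j i)] -> j @: e \in pull x.
Proof.
move=> ji; rewrite !inE card_imset // => /andP[-> /=].
rewrite -imset_comp; suff -> : [ffun i => x (j i)] @: e = (x \o j) @: e by [].
by apply: eq_imset => i; rewrite ffunE.
Qed.

Lemma homs_khom (H : kgraph k) (phi : khom F H) : homs (edges H) (val phi).
Proof. by case: phi. Qed.

Variable s : nat.
Let t := s.+1.
Variable x : {ffun 'I_s.+1 -> vert G}.
Let y u : {ffun 'I_s -> vert G} := [ffun i => x (lift u i)].

Let span_lift (A : nzSemiRingType) (S : A -> Prop) u (w : khom F (pullG (y u)) -> A) :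
  S 0 -> (forall a b, S a -> S b -> S (a + b)) -> (forall phi, S (w phi)) ->
  (forall v : 'I_s, \sum_phi w phi * (fiber_size phi v)%:R = 1) ->
  span F S (pull x) (fun i => (i != u)%:R).
Proof.
move=> S0 SD Sw wE.
apply: (span_family (c := w) (phi := fun phi => [ffun f => lift u (val phi f)])) => //.
  move=> phi; apply: homs_comp (homs_khom phi) => e eE.
  by apply: (pull_comp (j := lift u)) eE; exact: lift_inj.
move=> i; case: (unliftP u i) => [i' ->|->].
  rewrite eq_sym neq_lift -[LHS](wE i'); apply: eq_bigr => phi _.
  by rewrite vec_comp //; exact: lift_inj.
rewrite eqxx big1 // => phi _; rewrite vec_comp0 ?mulr0 //.
by apply/codomP => -[j e]; move: (neq_lift u j); rewrite -e eqxx.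
Qed.

Lemma hom_full_pull : (0 < s)%N -> (m %| s)%N ->
  (forall u, Spa R F (pullG (y u))) -> (forall u, Div R F (pullG (y u))) ->
  hom_full F R (pull x).
Proof.
move=> s0 ms HS HD; split.
  move=> u; have [w w01 wE] := HS u.
  by apply: (span_lift (w := w)) => // [a b|phi]; [exact: addr_ge0|have /andP[] := w01 phi].
have latu u : lat F (pull x) (fun i => (i != u)%:R).
  have [w wint wE] := HD u.
  apply: (span_lift (w := fun phi => Num.floor (w phi))) => // v.
  apply: (@intr_inj R); rewrite rmorph_sum /= -[RHS](wE v); apply: eq_bigr => phi _.
  by rewrite rmorphM /= (floorK (wint phi)) rmorph_nat.
(* Without homomorphisms the span would be zero, but [latu ord0] puts a vector with an entry 1 into
   it. *)
have [phi0 hphi0] : exists phi0 : {ffun vert F -> 'I_s.+1}, homs (pull x) phi0.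
  have [c [_ c0 cE]] := latu ord0.
  case: (pickP [pred phi : {ffun vert F -> 'I_s.+1} | homs (pull x) phi]) => [phi0 Hp|H].
    by exists phi0.
  have := cE (lift ord0 (Ordinal s0)); rewrite big1.
    by rewrite eq_sym neq_lift.
  by move=> phi _; have /negbT := H phi => /= /c0->; rewrite mul0r.
apply: (full_lattice (i0 := ord0) hphi0) => u.
pose z (b : bool) i : int := if b then (i != ord0 :> 'I_s.+1)%:R else (i != u)%:R.
pose a (b : bool) : int := if b then 1 else -1.
have Hz b : span F (fun=> True) (pull x) (z b) by case: b; exact: latu.
have := @span_lin k F int (fun=> True) _ bool (pull x) a z Logic.I (fun _ _ _ _ => Logic.I) (fun _ _ _ => Logic.I) Hz.
apply: span_ext => i; rewrite big_bool /= /z /a mul1r mulN1r.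
by case: (i == ord0); case: (i == u).
Qed.

End PullSpan.

(** * From lattices and cones to nonnegative integer combinations *)

Section Exact.
Local Open Scope ring_scope.
Variables (R : realType) (k : nat) (F : kgraph k).
Let m := #|vert F|.

Lemma dvdz_nat (a b : nat) : (a%:Z %| b%:Z)%Z = (a %| b)%N.
Proof. by rewrite dvdzE. Qed.

(* C copies of every homomorphism are set aside before rounding down a cone
   representation of the rest: they compensate the possibly negative coefficients
   in a lattice representation of the bounded vector zeta left by the rounding. *)
Lemma exact_comb (s M : nat) (E : {set {set 'I_s.+1}}) : (0 < s)%N -> hom_full F R E ->
  exists b0, forall b, (b0 <= b)%N -> forall x : 'I_s.+1 -> nat,
    (forall i, b - M <= x i <= b)%N -> (m %| \sum_i x i)%N -> comb F E x.
Proof.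
move=> s0 [Hcone Hlat].
pose t := s.+1.
pose Phi : finType := {ffun vert F -> 'I_t}.
(* Rounding down changes each coefficient by less than 1, so the entries of the remainder are at
   most [h]. *)
pose h := (#|Phi| * m)%N.
(* One lattice representation is fixed for each of the finitely many possible remainders, so that a
   single constant bounds all their coefficients. *)
have /fin_all_exists[cz Hcz] : forall zeta : {ffun 'I_t -> 'I_h.+1}, exists c : Phi -> int,
   (m %| \sum_i zeta i)%N -> (forall phi, ~~ homs E phi -> c phi = 0) /\
       forall i, (zeta i : nat)%:Z = \sum_phi c phi * (vec phi i)%:R.
  move=> zeta; have [mz|mz] := boolP (m %| \sum_i zeta i)%N; last by exists (fun=> 0).
  have [|c [_ c0 cE]] := Hlat (fun i => (zeta i : nat)%:Z).
    by rewrite -(big_morph Posz PoszD (erefl 0%:Z)) dvdz_nat.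
  by exists c.
pose C := (\sum_zeta \sum_phi `|cz zeta phi|)%N.
have CP zeta phi : (`|cz zeta phi| <= C)%N.
  by rewrite /C (bigD1 zeta) //= (bigD1 phi) //= -addnA leq_addr.
pose H i := (\sum_(phi : Phi | homs E phi) vec phi i)%N.
have Hh i : (H i <= h)%N.
  apply: (@leq_trans (\sum_(phi : Phi) m)); last by rewrite sum_nat_const.
  by rewrite /H big_mkcond; apply: leq_sum => phi _; case: ifP => // _; exact: vec_le.
exists (t * (M + C * h))%N => b bbig x xb mx.
pose y i : R := (x i)%:R - (C * H i)%:R.
(* The solution of [y i = \sum_(u | u != i) a u]; the lower bound on [b] makes it nonnegative. *)
pose a u : R := (\sum_i y i) / s%:R - y u.
have sR : 0 < s%:R :> R by rewrite ltr0n.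
have a0 u : 0 <= a u.
  rewrite /a subr_ge0 ler_pdivlMr //.
  have yu : y u <= b%:R.
    rewrite /y lerBlDr; apply: (@le_trans _ _ b%:R); last by rewrite lerDl.
    by rewrite ler_nat; have /andP[] := xb u.
  have ylow i : b%:R - (M + C * h)%:R <= y i.
    rewrite /y natrD opprD addrA; apply: lerB; last by rewrite ler_nat leq_mul2l Hh orbT.
    rewrite lerBlDr -natrD ler_nat; have /andP[] := xb i; lia.
  apply: (@le_trans _ _ (b%:R * s%:R)); first by rewrite ler_wpM2r ?ler0n.
  apply: (@le_trans _ _ (\sum_(i < t) (b%:R - (M + C * h)%:R : R))); last exact: ler_sum.
  rewrite sumr_const card_ord -[leRHS]mulr_natr mulrBl.
  have : (t * (M + C * h))%:R <= b%:R :> R by rewrite ler_nat.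
  rewrite natrM mulrC /t -natr1; set Q := (M + C * h)%:R; lra.
have [w [w0 wh wE]] : cone F E y.
  have := @span_lin k F R (fun a => 0 <= a) _ 'I_t E a (fun u i => (i != u)%:R) (lexx 0)
    (@addr_ge0 R) (fun j b => @mulr_ge0 R (a j) b (a0 j)) Hcone.
  apply: span_ext => i.
  have -> : \sum_j a j * (i != j)%:R = \sum_j a j - a i.
    rewrite [in RHS](bigD1 i) //= addrAC subrr add0r.
    rewrite (bigD1 i) //= eqxx mulr0 add0r; apply: eq_bigr => j; rewrite eq_sym => ->.
    by rewrite mulr1.
  rewrite /a sumrB sumr_const card_ord -[_ *+ s.+1]mulr_natr.
  have e : (\sum_j y j) / s%:R * s.+1%:R = \sum_j y j + (\sum_j y j) / s%:R.
    by rewrite -natr1 mulrDr mulr1 divfK ?gt_eqF.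
  rewrite e; ring.
pose n phi : nat := Num.truncn (w phi).
have ndef phi : (n phi)%:R <= w phi < (n phi)%:R + 1.
  have := truncn_itv (w0 phi); by rewrite -natr1.
pose zeta0 i : R := \sum_phi (w phi - (n phi)%:R) * (vec phi i)%:R.
pose z i : int := (x i)%:Z - (C * H i)%:Z - (\sum_phi n phi * vec phi i)%N%:Z.
have zR i : (z i)%:~R = zeta0 i.
  rewrite /z !rmorphB /= -!pmulrn -/(y i) wE /zeta0 natr_sum -sumrB.
  by apply: eq_bigr => phi _; rewrite natrM -mulrBl.
have z0 i : 0 <= z i.
  rewrite -(ler0z R) zR sumr_ge0 // => phi _; rewrite mulr_ge0 // subr_ge0.
  by have /andP[] := ndef phi.
have zh i : (`|z i| < h.+1)%N.
  rewrite ltnS -lez_nat gez0_abs // -(ler_int R) zR -pmulrn.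
  apply: (@le_trans _ _ (\sum_(phi : Phi) m%:R)); last by rewrite sumr_const /h natrM mulr_natl.
  apply: ler_sum => phi _; rewrite -[leRHS]mul1r; apply: ler_pM => //.
  - by rewrite subr_ge0; have /andP[] := ndef phi.
  - by have /andP[_] := ndef phi; lra.
  - by rewrite ler_nat vec_le.
pose zeta : {ffun 'I_t -> 'I_h.+1} := [ffun i => Ordinal (zh i)].
have zetaE i : (zeta i : nat)%:Z = z i by rewrite ffunE /= gez0_abs.
have swap (c : Phi -> nat) : (\sum_i \sum_phi c phi * vec phi i = \sum_phi c phi * m)%N.
  by rewrite exchange_big; apply: eq_bigr => phi _; rewrite -big_distrr /= sum_vec.
have mz : (m %| \sum_i zeta i)%N.
  rewrite -dvdz_nat (big_morph Posz PoszD (erefl 0%:Z)) (eq_bigr z) => [|i _]; last exact: zetaE.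
  rewrite /z !sumrB !rpredB //.
  - by rewrite -(big_morph Posz PoszD (erefl 0%:Z)) dvdz_nat.
  - rewrite -(big_morph Posz PoszD (erefl 0%:Z)) dvdz_nat -big_distrr /= dvdn_mull //.
    rewrite /H exchange_big /= dvdn_sum // => phi _; by rewrite sum_vec.
  - rewrite -(big_morph Posz PoszD (erefl 0%:Z)) dvdz_nat swap dvdn_sum // => phi _.
    exact: dvdn_mull.
have [c0 cE] := Hcz zeta mz.
pose d phi : int := (if homs E phi then C%:Z else 0) + (n phi)%:Z + cz zeta phi.
have n0 phi : ~~ homs E phi -> n phi = 0%N.
  by move=> nphi; rewrite /n wh // truncn0.
have d0 phi : 0 <= d phi.
  rewrite /d; case: ifP => [hphi|/negbT nphi]; last by rewrite n0 // c0.
  have := CP zeta phi; lia.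
exists (fun phi => `|d phi|%N); split.
  by move=> phi nphi; rewrite /d (negbTE nphi) n0 // c0.
move=> i; apply/eqP; rewrite -eqz_nat; apply/eqP.
rewrite (big_morph Posz PoszD (erefl 0%:Z)).
have -> : \sum_phi (`|d phi| * vec phi i)%N%:Z =
   (C * H i)%:Z + (\sum_phi n phi * vec phi i)%N%:Z + z i.
  rewrite -zetaE cE /H big_distrr /= !(big_morph Posz PoszD (erefl 0%:Z)).
  rewrite [X in X + _ + _]big_mkcond -!big_split /=; apply: eq_bigr => phi _.
  rewrite PoszM gez0_abs // /d; case: ifP => _; rewrite ?PoszM natz; ring.
rewrite /z; ring.
Qed.

End Exact.

Section Absorb.
Local Open Scope ring_scope.
Variables (k : nat) (F : kgraph k).
Let m := #|vert F|.

Lemma comb_family (I J : finType) (E : {set {set I}}) (c : J -> nat)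
    (phi : J -> {ffun vert F -> I}) (z : I -> nat) :
  (forall j, ~~ homs E (phi j) -> c j = 0%N) ->
  (forall i, z i = \sum_j c j * vec (phi j) i)%N -> comb F E z.
Proof.
move=> c0 zE; exists (fun psi => \sum_(j | phi j == psi) c j)%N; split.
  by move=> psi npsi; rewrite big1 // => j /eqP e; apply: c0; rewrite e.
move=> i; rewrite zE (partition_big phi predT) //=; apply: eq_bigr => psi _.
by rewrite big_distrl; apply: eq_bigr => j /eqP->.
Qed.

(* The indices inl l stand for single leftover vertices, which are used exactly
   once; the coefficients of the correcting copies are reduced modulo m to make
   them nonnegative. *)
Lemma absorb_comb t (E' : {set {set 'I_t}}) (E : {set {set ('I_m + 'I_t)}}) :
  (0 < m)%N -> (forall e, e \in E' -> inr @: e \in E) ->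
  (forall z : 'I_t -> int, (m%:Z %| \sum_i z i)%Z -> lat F E' z) ->
  (forall l : 'I_m, exists2 psi : {ffun vert F -> 'I_m + 'I_t}, homs E psi &
     forall l', vec psi (inl l') = (l' == l)) ->
  exists2 z : 'I_t -> nat,
    forall i, (m %| z i)%N /\ (z i <= m * m + #|{ffun vert F -> 'I_t}| * (m * m))%N &
    comb F E (fun i => match i with inl _ => 1%N | inr i => z i end).
Proof.
move=> m0 EE' Hlat /fin_all_exists2[psi hpsi vpsi].
pose y i := (\sum_l vec (psi l) (inr i))%N.
(* Each [psi l] puts one vertex on [inl l] and the other [m - 1] on ['I_t]. *)
have sumy : (\sum_i y i + m = m * m)%N.
  rewrite /y exchange_big /=.
  have -> : (m * m = \sum_(l < m) m)%N by rewrite sum_nat_const card_ord.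
  rewrite -[X in (_ + X)%N](card_ord m) -sum1_card -big_split /=.
  apply: eq_bigr => l _; rewrite -[RHS](sum_vec (psi l)) big_sumType /= addnC; congr (_ + _)%N.
  by rewrite (bigD1 l) //= vpsi eqxx big1 // => l' ll'; rewrite vpsi (negbTE ll').
have [|c [_ c0 cE]] := Hlat (fun i => - (y i)%:Z).
  rewrite sumrN rpredN -(big_morph Posz PoszD (erefl 0%:Z)) dvdz_nat.
  by rewrite -(dvdn_addl _ (dvdnn m)) sumy dvdn_mulr.
pose a phi : nat := `|(c phi %% m)%Z|%N.
have mZ : m%:Z != 0 by rewrite eqz_nat -lt0n.
have aE phi : (a phi)%:Z = (c phi %% m)%Z by rewrite gez0_abs // modz_ge0.
have am phi : (a phi <= m)%N.
  by rewrite -lez_nat aE; apply: ltW; apply: ltz_pmod; rewrite ltz_nat.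
pose z i := (y i + \sum_phi a phi * vec phi i)%N.
exists z.
  move=> i; split.
    (* The unreduced coefficients represent [- y], so [z] is a combination of the differences
       between reduced and original coefficients, all divisible by [m]. *)
    rewrite -dvdz_nat /z PoszD -[(y i)%:Z]opprK cE -sumrN.
    rewrite (big_morph Posz PoszD (erefl 0%:Z)) -big_split /= rpred_sum // => phi _.
    rewrite PoszM aE -mulNr natz -mulrDl dvdz_mulr //.
    rewrite {1}(divz_eq (c phi) m%:Z); set q := (_ %/ _)%Z; set r := (_ %% _)%Z.
    by rewrite opprD addrNK rpredN dvdz_mull.
  apply: leq_add.
    apply: (@leq_trans (\sum_(l < m) m)); last by rewrite sum_nat_const card_ord.
    by apply: leq_sum => l _; exact: vec_le.
  rewrite -sum_nat_const; apply: leq_sum => phi _; apply: leq_mul => //; exact: vec_le.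
pose ph (j : 'I_m + {ffun vert F -> 'I_t}) : {ffun vert F -> 'I_m + 'I_t} :=
  match j with inl l => psi l | inr phi => [ffun f => inr (phi f)] end.
apply: (comb_family (c := fun j => if j is inr phi then a phi else 1%N) (phi := ph)).
  case=> [l|phi] /=; first by rewrite hpsi.
  move=> nh; have nh' : ~~ homs E' phi by apply: contra nh; exact: homs_comp.
  by rewrite /a c0 // mod0z.
have inrI : injective (inr : 'I_t -> 'I_m + 'I_t) by move=> u v [].
case=> [l|i]; rewrite big_sumType /=.
  rewrite [X in (_ + X)%N]big1 => [|phi _].
    rewrite addn0 (bigD1 l) //= mul1n vpsi eqxx big1 // => l' ll'.
    by rewrite mul1n vpsi eq_sym (negbTE ll').
  by rewrite vec_comp0 ?muln0 //; apply/codomP => -[].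
rewrite /z; congr (_ + _)%N; first by apply: eq_bigr => l _; rewrite mul1n.
by apply: eq_bigr => phi _; rewrite (vec_comp (j := inr)).
Qed.

End Absorb.

(** * Disjoint copies of F *)

Section Tileable.
Local Open Scope nat_scope.
Variables (k : nat) (F G : kgraph k).

Inductive tileable : {set vert G} -> Prop :=
| tileable0 : tileable set0
| tileableU (psi : {ffun vert F -> vert G}) (X : {set vert G}) :
    is_hom psi -> injective psi -> [disjoint psi @: [set: vert F] & X] ->
    tileable X -> tileable (psi @: [set: vert F] :|: X).

Lemma tileable_union X Y : tileable X -> tileable Y -> [disjoint X & Y] ->
  tileable (X :|: Y).
Proof.
move=> tX tY; elim: tX => [|psi X' hpsi ipsi dX _ IH]; first by rewrite set0U.
rewrite disjointUl => /andP[dWY dXY]; rewrite -setUA; apply: tileableU => //.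
  by rewrite disjointUr dX.
exact: IH.
Qed.

Lemma tileable_bigcup (J : finType) (P : pred J) (X : J -> {set vert G}) :
  pwdisjoint X -> (forall j, P j -> tileable (X j)) -> tileable (\bigcup_(j | P j) X j).
Proof.
move=> dX tX.
apply: (bigcup_disjoint_ind (K := fun X _ => tileable X) (n := fun=> 0)) => //.
  exact: tileable0.
by move=> j Y _ Pj dY tY; apply: tileable_union => //; exact: tX.
Qed.

(** Induction on the number of copies: a homomorphism [phi] in use is lifted by sending the vertices
    of each fibre to distinct elements of [U i]. Edges survive because [phi] is injective on each of
    them, so the lifted edge is part of a transversal. *)
Lemma realize (I : finType) (E : {set {set I}}) (W U : I -> {set vert G}) (z : I -> nat) :
  pwdisjoint W -> (forall i, W i != set0) ->
  (forall e, e \in E -> #|e| = k) ->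
  (forall x : {ffun I -> vert G}, (forall i, x i \in W i) ->
     forall e, e \in E -> x @: e \in edges G) ->
  comb F E z -> (forall i, U i \subset W i) -> (forall i, #|U i| = z i) ->
  tileable (\bigcup_i U i).
Proof.
move=> dW nW kE trW [c [c0 zE]].
have [N] := ubnP (\sum_phi c phi); elim: N c c0 z zE U => // N IHN c c0 z zE U cN sU cU.
have dU : pwdisjoint U by apply: pwdisjoint_sub dW.
case: (pickP [pred phi | c phi != 0]) => [phi /= cphi|H]; last first.
  rewrite big1 => [|i _]; first exact: tileable0.
  apply/eqP; rewrite -cards_eq0 cU zE big1 // => phi _.
  by have /negbT := H phi; rewrite /= negbK => /eqP->.
have hphi : homs E phi by apply: contraR cphi => /c0->.
have vz i : vec phi i <= #|U i|.
  rewrite cU zE (bigD1 phi) //=; apply: leq_trans (leq_addr _ _).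
  by rewrite leq_pmull // lt0n.
pose fib i := enum [set f | phi f == i].
have sfib i : size (fib i) = vec phi i by rewrite -cardE.
have v0 i : {v | v \in W i} by apply: sigW; exact/set0Pn.
(* The position of [f] in its fibre selects its image; the default of [nth] is never reached. *)
pose psi := [ffun f => nth (sval (v0 (phi f))) (enum (U (phi f))) (index f (fib (phi f)))].
have fin f : f \in fib (phi f) by rewrite mem_enum inE.
have idx f : index f (fib (phi f)) < size (enum (U (phi f))).
  rewrite -cardE; apply: leq_trans (vz _); by rewrite -sfib index_mem.
have psiU f : psi f \in U (phi f) by rewrite ffunE -mem_enum mem_nth.
have psi_inj : injective psi.
  move=> f g fg; have e : phi f = phi g.
    by apply: (pwdisjointP (v := psi f) dU) => //; rewrite fg.
  have psiE d u : psi u = nth d (enum (U (phi u))) (index u (fib (phi u))).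
    by rewrite ffunE; apply: set_nth_default.
  have idg := idx g; rewrite -e in idg.
  move: fg; rewrite (psiE (sval (v0 (phi f))) f) (psiE (sval (v0 (phi f))) g) -e => /eqP.
  rewrite nth_uniq ?enum_uniq ?idx //.
  have gf : g \in fib (phi f) by rewrite mem_enum inE e.
  move=> /eqP ii; have := nth_index f gf; rewrite -ii nth_index //; exact: fin.
have psi_hom : is_hom psi.
  apply/forallP => e; apply/implyP => eF.
  have eE : phi @: e \in E by have /forallP/(_ e)/implyP/(_ eF) := hphi.
  have phi_inj : {in e &, injective phi}.
    by apply/imset_injP; rewrite (kE _ eE) (edges_uniform eF).
  (* A transversal that agrees with [psi] on [e]; parts not met by [e] get an arbitrary vertex. *)
  pose x : {ffun I -> vert G} := [ffun i => if [pick f in e | phi f == i] is Some f then psi f else sval (v0 i)].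
  have xW i : x i \in W i.
    rewrite ffunE; case: pickP => [f /andP[_ /eqP <-]|_]; last exact: (svalP (v0 i)).
    exact: (subsetP (sU _)).
  have := trW x xW _ eE; rewrite -imset_comp.
  suff -> : (x \o phi) @: e = psi @: e by [].
  apply: eq_in_imset => f fe; rewrite /= [x _]ffunE; case: pickP => [g /andP[ge /eqP]|/(_ f)].
    by move/phi_inj => ->.
  by rewrite fe eqxx.
pose U' i := U i :\: psi @: [set: vert F].
have cap i : U i :&: psi @: [set: vert F] = psi @: [set f | phi f == i].
  apply/setP => v; rewrite inE; apply/andP/imsetP => [[vU /imsetP[f _ vf]]|[f]].
    exists f => //; rewrite inE; apply/eqP; apply: (pwdisjointP (v := v) dU) => //.
    by rewrite vf.
  by rewrite inE => /eqP <- ->; split; [exact: psiU|exact: imset_f].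
have -> : \bigcup_i U i = psi @: [set: vert F] :|: \bigcup_i U' i.
  apply/setP => v; rewrite inE; apply/bigcupP/orP => [[i _ vi]|[/imsetP[f _ ->]|/bigcupP[i _]]].
  - case: (boolP (v \in psi @: [set: vert F])) => vp; first by left.
    by right; apply/bigcupP; exists i => //; rewrite inE vp.
  - by exists (phi f).
  - by rewrite inE => /andP[_ vi]; exists i.
apply: tileableU => //.
  apply: disjoint_bigcupr => i _; rewrite -setI_eq0.
  by apply/eqP/setP => v; rewrite !inE; case: (v \in psi @: _).
pose c' phi' := if phi' == phi then (c phi).-1 else c phi'.
have cc' phi' : c phi' = (phi' == phi) + c' phi'.
  by rewrite /c'; case: eqP => [->|//]; rewrite add1n prednK // lt0n.
apply: (IHN c' _ (fun i => z i - vec phi i)).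
- by move=> phi' nh; rewrite /c' (c0 _ nh); case: eqP => // e; rewrite e hphi in nh.
- move=> i; rewrite zE.
  rewrite (eq_bigr (fun phi' => (phi' == phi) * vec phi' i + c' phi' * vec phi' i)) => [|phi' _].
    rewrite big_split /= (bigD1 phi) //= eqxx mul1n big1 ?addn0 ?addKn // => phi' /negbTE->.
    by rewrite mul0n.
  by rewrite {1}cc' mulnDl.
- rewrite ltnS in cN; apply: leq_trans cN.
  rewrite [leqRHS](eq_bigr (fun phi' => (phi' == phi) + c' phi')) => [|phi' _]; last exact: cc'.
  rewrite big_split /= -add1n leq_add2r.
  by rewrite (bigD1 phi) //= eqxx leq_addr.
- by move=> i; rewrite (subset_trans (subsetDl _ _)).
- move=> i; rewrite cardsD cap cU card_imset //.
Qed.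

End Tileable.

(** * Absorbing leftover vertices *)

Section Absorb.
Local Open Scope nat_scope.
Variables (R : realType) (k : nat) (F : kgraph k) (s' : nat).
Let s := s'.+1.
Let t := s.+1.
Let m := #|vert F|.
Hypothesis m0 : 0 < m.

Definition hom_fullb (E : {set {set 'I_t}}) : bool := `[< hom_full F R E >].

Definition rooted_hom (E : {set {set 'I_s}}) : bool :=
  [exists phi : {ffun vert F -> 'I_s}, homs E phi && (vec phi ord0 == 1)].

(** The bound of [absorb_comb] on the number of vertices taken from one part. *)
Let M := m * m + #|{ffun vert F -> 'I_t}| * (m * m).

Lemma exact_comb_uniform : exists b0, forall b, b0 <= b -> forall E : {set {set 'I_t}}, hom_fullb E ->
  forall x : 'I_t -> nat, (forall i, b - M <= x i <= b) -> m %| \sum_i x i -> comb F E x.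
Proof.
have /fin_all_exists[f Hf] : forall E : {set {set 'I_t}}, exists b0, hom_fullb E ->
   forall b, b0 <= b -> forall x : 'I_t -> nat,
     (forall i, b - M <= x i <= b) -> m %| \sum_i x i -> comb F E x.
  move=> E; have [/asboolP fE|nE] := boolP (hom_fullb E); last by exists 0.
  by have [b0 Hb0] := exact_comb M (ltn0Sn s') fE; exists b0.
exists (\sum_E f E) => b bb E fE; apply: (Hf E fE).
by apply: leq_trans bb; rewrite (bigD1 E) //= leq_addr.
Qed.

Section Graph.
Variable G : kgraph k.

Lemma mono_transversal (W : 'I_t -> {set vert G}) (E : {set {set 'I_t}}) :
  (forall i, W i != set0) -> (forall w, transversal W w -> pull w = E) ->
  (forall e, e \in E -> #|e| = k).
Proof.
move=> nW HW e; have v0 i : {v | v \in W i} by apply: sigW; exact/set0Pn.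
rewrite -(HW [ffun i => sval (v0 i)]); first exact: pull_uniform.
by move=> i; rewrite ffunE; exact: (svalP (v0 i)).
Qed.

Lemma tile_remainder b (W D : 'I_t -> {set vert G}) : 0 < b ->
  (forall E : {set {set 'I_t}}, hom_fullb E -> forall x : 'I_t -> nat,
     (forall i, b - M <= x i <= b) -> m %| \sum_i x i -> comb F E x) ->
  tile (@pull k G 'I_t) hom_fullb b W ->
  (forall i, D i \subset W i) -> (forall i, b - M <= #|D i|) -> m %| \sum_i #|D i| ->
  tileable F (tsup D).
Proof.
move=> b0 Hex [cW dW [E fE HE]] sD lD mD.
have nW i : W i != set0 by rewrite -cards_eq0 cW -lt0n.
apply: (realize (z := fun i => #|D i|) dW nW (mono_transversal nW HE)) => //.
- by move=> w wW e; rewrite -(HE w wW) inE => /andP[].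
- by apply: Hex => // i; rewrite lD -(cW i) subset_leq_card.
Qed.

Variable v : 'I_m -> vert G.

(** Drops [w ord0] and overwrites the next entry with [v l], which gives an [s]-tuple through [v l];
    a homomorphism that hits its root once then covers [v l] and otherwise uses vertices of [w]. *)
Definition shadow (l : 'I_m) (w : {ffun 'I_t -> vert G}) : {ffun 'I_s -> vert G} :=
  fupd [ffun i => w (lift ord0 i)] ord0 (v l).

Definition absorbable (w : {ffun 'I_t -> vert G}) : bool :=
  hom_fullb (pull w) && [forall l, rooted_hom (pull (shadow l w))].

End Graph.

(** One type of tuple must serve all [m] leftover vertices at once, so the colour of [w] records its
    own k-graph and those of all its shadows. In a monochromatic box, [absorb_comb] prescribes how
    many vertices each part gives away; these numbers and the part sizes are divisible by [m], so
    [tile_remainder] applies to what is left of the tiles. *)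
Lemma absorb_step : exists b1, forall b, b1 <= b -> m %| b ->
  forall (G : kgraph k) (Gam : finType) (P : Gam -> 'I_t -> {set vert G}) (U : {set Gam})
    (v : 'I_m -> vert G),
  pwdisjoint (fun p : Gam * 'I_t => P p.1 p.2) ->
  (forall g, tile (@pull k G 'I_t) hom_fullb b (P g)) ->
  (forall l g i, v l \notin P g i) -> injective v ->
  4 * t * #|U| <= #|Gam| -> 4 * t ^ 2 < #|Gam| ->
  16 * #|[set w | ~~ absorbable v w]| <= #|vert G| ^ t ->
  #|vert G| ^ t <= 2 * (#|Gam| * t * b) ^ t ->
  exists U' : {set Gam}, [/\ [disjoint U' & U], #|U'| = t &
    tileable F (v @: [set: 'I_m] :|: \bigcup_(g in U') tsup (P g))].
Proof.
have [b0 Hb0] := exact_comb_uniform.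
pose Ct : finType := ({set {set 'I_t}} * {ffun 'I_m -> {set {set 'I_s}}})%type.
have M0 : 0 < M by rewrite /M addn_gt0 muln_gt0 m0.
have C0 : 0 < 2 * #|Ct|.+1 by [].
have [b1 Hb1] := @erdos_partite t M (2 * #|Ct|.+1) M0 C0.
exists (maxn 1 (maxn b0 b1)) => b; rewrite !geq_max => /and3P[b_gt0 bb0 bb1] mb.
move=> G Gam P U v dP tP vP vinj UG tG bad nG.
have cP g i : #|P g i| = b by have [] := tP g.
pose NG := [set w | ~~ absorbable v w].
pose BadP := [set p | halfbad b P NG p].
have cBad : 2 * #|BadP| <= (#|Gam| * t) ^ t.
  have h1 := card_halfbad b dP NG; rewrite -/BadP in h1.
  have bt0 : 0 < b ^ t by rewrite expn_gt0 b_gt0.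
  rewrite -(leq_pmul2l bt0) -expnMn [b * _]mulnC.
  move: bad nG h1; rewrite -/NG mulnCA.
  move: (b ^ t * #|BadP|) #|NG| (#|vert G| ^ t) ((#|Gam| * t * b) ^ t) => a1 a2 a3 a4; clear; lia.
have [p [pB pU pinj]] := select_groups (ltn0Sn s) UG tG cBad.
have dense : b ^ t <= 2 * #|[set w | boxed (box P p) w && absorbable v w]|.
  by apply: (dense_of_not_halfbad cP); move: pB; rewrite inE.
pose col (w : {ffun 'I_t -> vert G}) : Ct := (pull w, [ffun l => pull (shadow v l w)]).
pose gdc (c : Ct) := hom_fullb c.1 && [forall l, rooted_hom (c.2 l)].
have okE w : absorbable v w = gdc (col w).
  by rewrite /absorbable /gdc /=; congr (_ && _); apply: eq_forallb => l; rewrite ffunE.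
pose X := [set w | boxed (box P p) w && absorbable v w].
have X0 : 0 < #|X|.
  have : 0 < b ^ t by rewrite expn_gt0 b_gt0.
  by move/leq_trans => /(_ _ dense); rewrite muln_gt0.
have [c gc cX] : exists2 c, gdc c & #|X| <= #|[set c | gdc c]| * #|[set w in X | col w == c]|.
  apply: pigeonhole_sum => //.
  rewrite -sum1_card (partition_big col gdc) /=; last by move=> w; rewrite inE okE => /andP[].
  by apply: leq_sum => c gc; rewrite -sum1dep_card.
have [W cW HW] : exists2 W : 'I_t -> {set vert G}, (forall i, #|W i| = M) &
   forall w : {ffun 'I_t -> vert G}, (forall i, w i \in W i) -> w \in [set w in X | col w == c].
  apply: (Hb1 _ b _ (box P p)) => //; first by move=> i; rewrite /box cP.
    by move=> w; rewrite !inE => /andP[/andP[/forallP Hx _] _] i; exact: Hx.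
  apply: (leq_trans dense); rewrite -[leqRHS]mulnA leq_mul2l /=; apply: (leq_trans cX).
  by rewrite leq_mul2r (leq_trans (max_card _)) ?orbT.
have nW i : W i != set0 by rewrite -cards_eq0 cW -lt0n.
have w0 i : {u | u \in W i} by apply: sigW; exact/set0Pn.
have sW i : W i \subset box P p i.
  apply/subsetP => u uW; pose w := [ffun j => if j == i then u else sval (w0 j)].
  have : w \in [set w in X | col w == c].
    by apply: HW => j; rewrite ffunE; case: eqP => [->//|_]; exact: (svalP (w0 j)).
  by rewrite !inE => /andP[/andP[/forallP/(_ i)]]; rewrite ffunE eqxx.
have HW1 w : transversal W w -> pull w = c.1 /\ forall l, pull (shadow v l w) = c.2 l.
  by move/HW; rewrite inE => /andP[_ /eqP <-]; split=> // l; rewrite ffunE.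
(* Places the shadow of [l] inside the common index type: its root becomes the leftover vertex, the
   other positions keep their parts. *)
pose jl (l : 'I_m) (a : 'I_s) : 'I_m + 'I_t := if a == ord0 then inl l else inr (lift ord0 a).
pose E := [set inr @: (e : {set 'I_t}) | e in c.1] :|:
   \bigcup_l [set jl l @: (e : {set 'I_s}) | e in c.2 l].
have /andP[/asboolP[_ Hlat] /forallP Hcov] := gc.
have inrE e : e \in c.1 -> (inr @: e : {set 'I_m + 'I_t}) \in E.
  by move=> ec; rewrite inE; apply/orP; left; exact: imset_f.
have inrI : injective (inr : 'I_t -> 'I_m + 'I_t) by move=> ? ? [].
have jlI l : injective (jl l).
  move=> a a'; rewrite /jl; case: eqP => [->|_]; case: eqP => [->|_] //.
  by move/inrI/lift_inj.
have [|z Hz combz] := @absorb_comb k F t c.1 E m0 inrE Hlat.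
  move=> l; have /existsP[phi /andP[hphi /eqP vphi]] := Hcov l.
  exists [ffun f => jl l (phi f)].
    apply: homs_comp hphi => e ec; rewrite inE; apply/orP; right.
    by apply/bigcupP; exists l => //; exact: imset_f.
  move=> l'; case: (eqVneq l' l) => [->|ll'].
    have -> : inl l = jl l ord0 by rewrite /jl eqxx.
    by rewrite vec_comp //; exact: jlI.
  rewrite vec_comp0 //; apply/codomP => -[a]; rewrite /jl; case: eqP => // _ [e].
  by rewrite e eqxx in ll'.
have /fin_all_exists[Z HZ] : forall i, exists Z : {set vert G}, Z \subset W i /\ #|Z| = z i.
  move=> i; have [_ zM] := Hz i.
  have [|Z sZ cZ] := @exists_subset_card _ (W i) (z i); first by rewrite cW.
  by exists Z.
have sZ i : Z i \subset W i by have [] := HZ i.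
have cZ i : #|Z i| = z i by have [] := HZ i.
pose WW (o : 'I_m + 'I_t) := match o with inl l => [set v l] | inr i => W i end.
pose UU (o : 'I_m + 'I_t) := match o with inl l => [set v l] | inr i => Z i end.
have dbox : pwdisjoint (box P p).
  move=> i j ij; apply: (dP _ _); apply: contraNneq ij => e.
  by apply/eqP; apply: pinj; rewrite e.
have vW l i : v l \notin W i.
  by apply: contra (vP l (p i).1 (p i).2); apply/subsetP; exact: sW.
have dWW : pwdisjoint WW.
  move=> [l|i] [l'|i'] /= ij.
  - by rewrite disjoints1 inE (inj_eq vinj); apply: contraNneq ij => ->.
  - by rewrite disjoints1.
  - by rewrite disjoint_sym disjoints1.
  - by apply: disjointW (sW i) (sW i') (dbox _ _ _); apply: contraNneq ij => ->.
have t1 : tileable F (\bigcup_o UU o).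
  have trW (x : {ffun 'I_m + 'I_t -> vert G}) : (forall o, x o \in WW o) ->
     forall e, e \in E -> e \in pull x.
    move=> xW; pose w := [ffun i => x (inr i)] : {ffun 'I_t -> vert G}.
    have [|w1 w2] := HW1 w; first by move=> i; rewrite ffunE; exact: (xW (inr i)).
    move=> e; rewrite inE => /orP[/imsetP[e' ec ->]|/bigcupP[l _ /imsetP[e' ec ->]]].
      by apply: (pull_comp (j := inr)) => [//|]; rewrite -/w w1.
    apply: (pull_comp (j := jl l)); first exact: jlI.
    have <- : shadow v l w = [ffun i => x (jl l i)]; last by rewrite w2.
    apply/ffunP => a; rewrite !ffunE /jl; case: eqP => // _.
    by have := xW (inl l); rewrite inE => /eqP.
  have nWW o : WW o != set0.
    by case: o => [l|i] //=; apply/set0Pn; exists (v l); rewrite inE.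
  have x0 o : {u | u \in WW o} by apply: sigW; exact/set0Pn.
  apply: (realize dWW nWW _ _ combz).
  - move=> e eE; apply: (@pull_uniform k G _ [ffun o => sval (x0 o)]).
    by apply: trW eE => o; rewrite ffunE; exact: (svalP (x0 o)).
  - by move=> x xW e eE; have := trW x xW e eE; rewrite inE => /andP[].
  - by case=> [l|i] /=.
  - by case=> [l|i] /=; rewrite ?cards1.
pose h a := (p a).1.
(* Of the group [h a], only the part [(p a).2] gives up vertices, namely [Z a]. *)
pose D a i := if i == (p a).2 then P (h a) i :\: Z a else P (h a) i.
have sD a i : D a i \subset P (h a) i by rewrite /D; case: ifP => // _; rewrite subsetDl.
have sZP a : Z a \subset P (h a) (p a).2 by apply: subset_trans (sZ a) (sW a).
have t2 a : tileable F (tsup (D a)).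
  have [zm zM] := Hz a.
  apply: (tile_remainder b_gt0 (Hb0 _ bb0) (tP (h a)) (sD a)).
    move=> i; rewrite /D; case: eqP => [->|_]; last by rewrite cP leq_subr.
    by rewrite cardsD (setIidPr (sZP a)) cP cZ leq_sub2l.
  rewrite dvdn_sum // => i _; rewrite /D; case: eqP => [->|_]; last by rewrite cP.
  by rewrite cardsD (setIidPr (sZP a)) cP cZ dvdn_sub.
have dPt : pwdisjoint (fun g => tsup (P g)).
  move=> g g' gg'; apply: disjoint_bigcupl => i _; apply: disjoint_bigcupr => i' _.
  by apply: (dP (g, i) (g', i')); apply: contraNneq gg' => /(congr1 fst) /= ->.
exists [set h a | a in [set: 'I_t]]; split.
- rewrite disjoint_subset; apply/subsetP => g /imsetP[a _ ->]; exact: pU.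
- by rewrite card_imset // cardsT card_ord.
have -> : v @: [set: 'I_m] :|: \bigcup_(g in [set h a | a in [set: 'I_t]]) tsup (P g) =
   \bigcup_o UU o :|: \bigcup_a tsup (D a).
  apply/setP => u; rewrite !inE; apply/orP/orP.
    case=> [/imsetP[l _ ->]|/bigcupP[g /imsetP[a _ ->] /bigcupP[i _ ui]]].
      by left; apply/bigcupP; exists (inl l); rewrite ?inE.
    case: (boolP ((i == (p a).2) && (u \in Z a))) => [/andP[_ uZ]|ni].
      by left; apply/bigcupP; exists (inr a).
    right; apply/bigcupP; exists a => //; apply/bigcupP; exists i => //.
    by move: ni; rewrite /D; case: eqP => //= _; rewrite inE => ->.
  case=> [/bigcupP[[l|a] _]|/bigcupP[a _ /bigcupP[i _ /(subsetP (sD a i)) ui]]].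
  - by rewrite inE => /eqP->; left; exact: imset_f.
  - move=> /(subsetP (sZP a)) ui; right; apply/bigcupP; exists (h a); first exact: imset_f.
    by apply/bigcupP; exists (p a).2.
  - right; apply/bigcupP; exists (h a); first exact: imset_f.
    by apply/bigcupP; exists i.
apply: tileable_union => //.
  apply: tileable_bigcup => [|a _]; last exact: t2.
  move=> a a' aa'; apply: disjointW (tsup_sub (sD a)) (tsup_sub (sD a')) (dPt _ _ _).
  by apply: contraNneq aa' => /pinj->.
apply: disjoint_bigcupl => o _; apply: disjoint_bigcupr => a _; apply: disjoint_bigcupr => i _.
case: o => [l|a'] /=.
  by rewrite disjoints1; apply: contra (vP l (h a) i); exact: (subsetP (sD a i)).
have [aa'|aa'] := eqVneq a' a; last first.
  apply: disjointW (sZP a') (sD a i) (dP (h a', (p a').2) (h a, i) _).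
  by apply: contraNneq aa' => /(congr1 fst)/pinj->.
subst a'; rewrite /D; case: eqP => [->|/eqP ni].
  by rewrite -setI_eq0; apply/eqP/setP => u; rewrite !inE; case: (u \in Z a).
apply: disjointW (sZP a) (subxx _) (dP (h a, (p a).2) (h a, i) _).
by apply: contraNneq ni => /(congr1 snd) /= ->.
Qed.

End Absorb.

(** * Perfect tilings and thresholds *)

Section TilFacts.
Local Open Scope ring_scope.
Variables (R : realType) (k : nat) (F G : kgraph k).

Lemma imset_predT (T T' : finType) (f : T -> T') : [set f x | x : T] = f @: [set: T].
Proof. by apply/setP => y; apply/imsetP/imsetP => -[x _ ->]; exists x; rewrite ?inE. Qed.

Lemma tileable_Til : tileable F [set: vert G] -> Til F G.
Proof.
suff H (X : {set vert G}) : tileable F X ->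
    exists T : {set {set vert G} * {set {set vert G}}},
     [/\ forall c, c \in T -> is_copy F c, forall c, c \in T -> c.1 \subset X &
       forall v, v \in X -> #|[set c in T | v \in c.1]| = 1%N].
  by move=> /H[T [T1 _ T3]]; exists T; split=> // v; apply: T3; rewrite inE.
elim=> [|psi X' hpsi ipsi dX _ [T [T1 T2 T3]]].
  by exists set0; split=> [c|c|v]; rewrite inE.
pose c0 : {set vert G} * {set {set vert G}} :=
  ([set psi x | x : vert F], [set psi @: e | e : {set vert F} in edges F]).
have psiE : psi @: [set: vert F] = c0.1 by rewrite /= imset_predT.
exists (c0 |: T); split.
- move=> c; rewrite !inE => /orP[/eqP ->|/T1 //].
  by exists (exist _ psi hpsi).
- move=> c; rewrite !inE => /orP[/eqP ->|cT]; first by rewrite psiE subsetUl.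
  by rewrite (subset_trans (T2 c cT)) // subsetUr.
- move=> v; rewrite inE => /orP[vp|vX].
    rewrite -(cards1 c0); apply: eq_card => c; rewrite !inE.
    have [->|/= cc0] := eqVneq c c0; first by rewrite -psiE vp.
    apply/negbTE; apply/negP => /andP[cT vc].
    have := disjointFr dX vp; by rewrite (subsetP (T2 c cT)).
  have vc0 : (v \in c0.1) = false by rewrite -psiE (disjointFl dX vX).
  rewrite -(T3 v vX); apply: eq_card => c; rewrite !inE.
  by have [->|//] := eqVneq c c0; rewrite vc0 !andbF.
Qed.

Lemma perfect_tiling_homs (T : {set {set vert G} * {set {set vert G}}}) : perfect_tiling F T ->
  exists2 h : {c | c \in T} -> khom F G, injective h &
    forall j v, fiber_size (h j) v = (v \in (val j).1).
Proof.
move=> [T1 _].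
have /fin_all_exists2[h ih hE] : forall j : {c | c \in T}, exists2 phi : khom F G,
     injective (val phi) &
     val j = ([set val phi x | x : vert F], [set val phi @: e | e : {set vert F} in edges F]).
  by move=> [c cT]; have [phi iphi cE] := T1 c cT; exists phi.
exists h => [j j' hj|j v]; first by apply: val_inj; rewrite hE hj -hE.
rewrite hE /= /fiber_size; case: imsetP => [[x _ ->]|nx].
  transitivity #|[set x]|; last by rewrite cards1.
  by apply: eq_card => y; rewrite !inE (inj_eq (ih j)).
apply/eqP; rewrite cards_eq0 -subset0; apply/subsetP => y; rewrite !inE => /eqP yv.
by case: nx; exists y.
Qed.

Lemma sum_tiling (T : {set {set vert G} * {set {set vert G}}}) v : perfect_tiling F T ->
  (\sum_(j : {c | c \in T}) (v \in (val j).1 : nat) = 1)%N.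
Proof.
move=> [_ T2].
rewrite -(big_sub (mem T) (fun c => (v \in c.1 : nat))) -(T2 v) -sum1dep_card.
by rewrite big_mkcondr; apply: eq_bigr => c _; case: (v \in _).
Qed.

(** The indicator of the copies in a tiling takes only the values 0 and 1, so over [R] it is at once
    a fractional and an integral tiling. *)
Lemma Til_weights (A : nzSemiRingType) : Til F G ->
  exists2 w : khom F G -> A, (forall phi, w phi = 0 \/ w phi = 1) &
    forall v, \sum_phi w phi * (fiber_size phi v)%:R = 1.
Proof.
move=> [T tT]; have [h ih hE] := perfect_tiling_homs tT.
exists (fun phi => \sum_(j | h j == phi) 1).
  move=> phi; case: (pickP [pred j | h j == phi]) => [j /= /eqP hj|H].
    right; rewrite (bigD1 j) ?hj //= big1 ?addr0 // => i /andP[/eqP hi].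
    by rewrite -hj in hi; rewrite (ih _ _ hi) eqxx.
  by left; rewrite big_pred0.
move=> v; transitivity ((\sum_(j : {c | c \in T}) (v \in (val j).1 : nat))%N%:R : A); last by rewrite sum_tiling.
rewrite natr_sum.
rewrite [RHS](partition_big h predT) //=; apply: eq_bigr => phi _.
rewrite mulr_suml; apply: eq_bigr => j /eqP <-; by rewrite mul1r hE.
Qed.

Lemma Til_Spa : Til F G -> Spa R F G.
Proof.
move=> /(Til_weights R)[w w01 wE]; exists w => // phi.
by case: (w01 phi) => ->; rewrite ?lexx ?ler01.
Qed.

Lemma Til_Div : Til F G -> Div R F G.
Proof.
move=> /(Til_weights R)[w w01 wE]; exists w => // phi.
by case: (w01 phi) => ->; rewrite ?rpred0 ?rpred1.
Qed.

Lemma Til_Cov : Til F G -> Cov F G.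
Proof.
move=> [T tT] v; have [h _ hE] := perfect_tiling_homs tT.
have [j vj] : exists j : {c | c \in T}, v \in (val j).1.
  apply: contrapT => H; have := sum_tiling v tT; rewrite big1 // => j _.
  by apply/eqP; rewrite eqb0; apply/negP => vj; apply: H; exists j.
by exists (h j); rewrite hE vj.
Qed.

End TilFacts.

(** * Tuples all of whose subtuples are good *)

Section RandomTuples.
Local Open Scope nat_scope.
Variables (V : finType) (s' : nat).
Let s := s'.+1.
Let t := s.+1.
Variables (good : pred {ffun 'I_s -> V}) (N1 : nat).
Hypothesis few_bad : forall v, N1 * #|[set y | ~~ good (fupd y ord0 v)]| <= #|V| ^ s.

Definition allgood (x : {ffun 'I_t -> V}) : bool :=
  [forall u, good [ffun i => x (lift u i)]].

Lemma card_lift u (Q : pred {ffun 'I_s -> V}) :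
  #|[set x : {ffun 'I_t -> V} | Q [ffun i => x (lift u i)]]| = #|V| * #|[set y | Q y]|.
Proof.
have := @card_comp_inj _ _ V (lift u) Q (@lift_inj _ u).
by rewrite !card_ord /= subSnn expn1 mulnC.
Qed.

Lemma few_bad_avg : N1 * #|[set y | ~~ good y]| <= #|V| ^ s.
Proof.
have [V0|] := posnP #|V|.
  rewrite (_ : [set y | _] = set0) ?cards0 ?muln0 //; apply/setP => y.
  by have := card0_eq V0 (y ord0); rewrite !inE.
move=> V0; rewrite -(leq_pmul2l V0) mulnCA (card_resample ord0 (fun y => ~~ good y)).
under eq_bigr do rewrite card_sum_mem.
rewrite exchange_big big_distrr /= -sum_nat_const; apply: leq_sum => v _.
by rewrite -card_sum_mem; exact: few_bad.
Qed.

Lemma bad_tuples_union (f : {ffun 'I_t -> V} -> {ffun 'I_t -> V}) :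
  (forall u, N1 * #|[set x | ~~ good [ffun i => f x (lift u i)]]| <= #|V| ^ t) ->
  N1 * #|[set x | ~~ allgood (f x)]| <= t * #|V| ^ t.
Proof.
move=> Hu; apply: (@leq_trans (\sum_(u < t) #|V| ^ t)); last first.
  by rewrite sum_nat_const card_ord.
apply: leq_trans (leq_sum _ (fun u _ => Hu u)); rewrite -big_distrr leq_mul2l /=.
apply/orP; right; apply: leq_trans (card_bigcup_le _ _); apply: subset_leq_card.
apply/subsetP => x; rewrite inE => /forallPn[u gu]; apply/bigcupP; exists u => //.
by rewrite inE.
Qed.

Lemma bad_tuples : N1 * #|[set x | ~~ allgood x]| <= t * #|V| ^ t.
Proof.
apply: (bad_tuples_union (f := id)) => u; rewrite [#|V| ^ t]expnS.
by rewrite (card_lift _ (fun y => ~~ good y)) mulnCA leq_mul2l few_bad_avg orbT.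
Qed.

Lemma bad_tuples_at v :
  N1 * #|[set x | ~~ allgood (fupd x ord0 v)]| <= t * #|V| ^ t.
Proof.
apply: (bad_tuples_union (f := fun x => fupd x ord0 v)) => u; rewrite [#|V| ^ t]expnS.
(* For [u = ord0] the prescribed entry is dropped and the average bound applies; otherwise it
   becomes the entry [ord0] of the subtuple. *)
have [->|u0] := eqVneq u ord0.
  rewrite (_ : [set x | _] = [set x : {ffun 'I_t -> V} | ~~ good [ffun i => x (lift ord0 i)]]).
    by rewrite (card_lift _ (fun y => ~~ good y)) mulnCA leq_mul2l few_bad_avg orbT.
  apply/setP => x; rewrite !inE; congr (~~ good _); apply/ffunP => i; rewrite !ffunE.
  by rewrite eq_sym (negbTE (neq_lift _ _)).
rewrite (_ : [set x | _] = [set x : {ffun 'I_t -> V} | ~~ good (fupd [ffun i => x (lift u i)] ord0 v)]).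
  by rewrite (card_lift _ (fun y => ~~ good (fupd y ord0 v))) mulnCA leq_mul2l few_bad orbT.
apply/setP => x; rewrite !inE; congr (~~ good _); apply/ffunP => i; rewrite !ffunE.
have -> : ord0 = lift u (ord0 : 'I_s).
  by apply: val_inj; rewrite /= /bump leqn0; move: u0; rewrite -val_eqE /= => /negbTE->.
by rewrite (inj_eq lift_inj).
Qed.

End RandomTuples.

Section Core.
Local Open Scope nat_scope.
Variables (R : realType) (k : nat) (F : kgraph k).
Let m := #|vert F|.
Hypothesis m0 : 0 < m.

(** With [s = s'.+1] and [t = s + 1], the constant [256 * s ^ 3] is [32 * (2 * s) ^ 3], at least the
    [32 * t ^ 3] that [mindeg_good] needs after a union over [t] subtuples. It also covers the union
    over subtuples and [m <= s] shadows in the absorption. *)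
Lemma tiling_of_few_bad (s' : nat) : m %| s'.+1 ->
  exists N, forall (G : kgraph k) (good : pred {ffun 'I_s'.+1 -> vert G}),
    N <= #|vert G| -> m %| #|vert G| ->
    (forall y, good y -> [/\ Spa R F (pullG y), Div R F (pullG y) & Cov F (pullG y)]) ->
    (forall v, 256 * s'.+1 ^ 3 * #|[set y | ~~ good (fupd y ord0 v)]| <= #|vert G| ^ s'.+1) ->
    Til F G.
Proof.
set s := s'.+1; set t := s.+1 => ms.
have [b1 Hb1] := @absorb_step R k F s' m0.
have [b2 Hb2] := @exact_comb_uniform R k F s'.
have [b mb bb] : exists2 b, m %| b & b1 + b2 + 1 <= b.
  by exists (m * (b1 + b2 + 1)); rewrite ?dvdn_mulr // leq_pmull.
have b0 : 0 < b by apply: leq_trans bb; rewrite addn1.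
(* Makes [4 * t ^ 2 * #|L| <= #|Gam|]. Absorption uses [t] tiles for [m] leftover vertices, so those
   already used stay within the fraction [1 / (4 * t)] that [absorb_step] tolerates. *)
pose g := 8 * t ^ 3 * b.
have g0 : 0 < g by rewrite !muln_gt0 b0.
have [N1 HN1] := @almost_tiling s ({set {set 'I_t}} : finType) (@hom_fullb R k F s') g g0 b b0.
exists (maxn N1 (t * b * (8 * t ^ 2 + 2))) => G good; rewrite geq_max => /andP[nN1 nbig] mn Hgood few.
set n := #|vert G| in nN1 nbig mn few.
have ms_le : m <= s by apply: dvdn_leq.
have s3 : 32 * t ^ 3 <= 256 * s ^ 3.
  by rewrite (_ : 256 * s ^ 3 = 32 * (2 * s) ^ 3) ?leq_mul2l ?leq_exp2r //=; [rewrite /t /s; lia|rewrite expnMn; ring].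
have allgood_full w : allgood good w -> @hom_fullb R k F s' (pull w).
  move=> /forallP gw; apply/asboolP; apply: hom_full_pull => // u.
    by have [] := Hgood _ (gw u).
  by have [] := Hgood _ (gw u).
have mdg : mindeg_good (@hom_fullb R k F s') (@pull k G 'I_t).
  move=> v; have h1 := bad_tuples_at few v.
  have h2 : #|[set x | ~~ @hom_fullb R k F s' (pull (fupd x ord0 v))]| <=
     #|[set x | ~~ allgood good (fupd x ord0 v)]|.
    apply: subset_leq_card; apply/subsetP => x; rewrite !inE; apply: contra; exact: allgood_full.
  rewrite -/s -/t -/n in h1 *; set a1 := #|_| in h2 *; set a2 := #|_| in h1 h2.
  have t0 : 0 < t by [].
  rewrite -(leq_pmul2l t0); apply: leq_trans h1.
  have -> : t * (32 * t ^ 2 * a1) = 32 * t ^ 3 * a1 by ring.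
  exact: leq_mul.
have [X bX gX] := HN1 (vert G) _ nN1 mdg.
have [Gam [P [tP dP eX]]] := btil_index bX.
pose L := ~: X.
have cX : #|X| = #|Gam| * t * b.
  rewrite eX card_pwbigcup.
    rewrite (eq_bigr (fun=> t * b)) => [|h _]; first by rewrite sum_nat_const mulnA.
    by have [c2 d2 _] := tP h; exact: card_tsup.
  move=> h h' hh'; apply: disjoint_bigcupl => i _; apply: disjoint_bigcupr => i' _.
  by apply: (dP (h, i) (h', i')); apply: contraNneq hh' => -[->].
have nE : n = #|X| + #|L| by rewrite cardsC.
have mL : m %| #|L|.
  by rewrite -(dvdn_addr _ (_ : m %| #|X|)) -?nE // cX dvdn_mull.
have sPX h i : P h i \subset X.
  rewrite eX; have sub1 : P h i \subset tsup (P h) by apply: bigcup_sup.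
  by apply: subset_trans sub1 _; apply: (@bigcup_sup _ _ h xpredT (fun h => tsup (P h))).
have dLP (U : {set Gam}) : [disjoint L & \bigcup_(h in U) tsup (P h)].
  apply: disjoint_bigcupr => h _; apply: disjoint_bigcupr => i _.
  by apply: disjointWr (sPX h i) _; rewrite -setI_eq0 setIC setICr.
have tb0 : 0 < t * b by rewrite muln_gt0 b0.
have gt3 : 2 * t < g.
  rewrite /g (_ : 8 * t ^ 3 * b = 2 * t * (4 * t ^ 2 * b)); last by ring.
  by rewrite ltn_Pmulr // (leq_trans (_ : 1 < 4)) // -mulnA leq_pmulr // muln_gt0 b0.
have n2 : n <= 2 * (t * b) * #|Gam|.
  have -> : 2 * (t * b) * #|Gam| = 2 * #|X| by rewrite cX; ring.
  have h2 : 2 * #|L| <= n.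
    have g2 : 1 < g by apply: leq_ltn_trans gt3; rewrite muln_gt0.
    by apply: leq_trans gX; rewrite leq_mul2r g2 orbT.
  by move: h2; rewrite nE; move: #|X| #|L| => a1 a2; clear; lia.
have tb20 : 0 < 2 * (t * b) by rewrite muln_gt0.
have tG : 4 * t ^ 2 < #|Gam|.
  rewrite -(ltn_pmul2l tb20); apply: leq_trans n2; apply: leq_trans nbig.
  have -> : t * b * (8 * t ^ 2 + 2) = (2 * (t * b) * (4 * t ^ 2)) + 2 * (t * b) by ring.
  by rewrite -[leqLHS]addn1 leq_add2l.
have LG : 4 * t ^ 2 * #|L| <= #|Gam|.
  rewrite -(leq_pmul2l tb20); apply: leq_trans n2; apply: leq_trans gX.
  by rewrite /g (_ : 8 * t ^ 3 * b = 2 * (t * b) * (4 * t ^ 2)) ?mulnA //; ring.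
(* All but a fraction [1 / g] of G is covered and [g] exceeds [2 * t], so the [t]-th power of the
   covered proportion is at least 1/2. *)
have nG : n ^ t <= 2 * (#|Gam| * t * b) ^ t.
  rewrite -cX; have g1 : 2 * t <= g.-1 by rewrite -ltnS prednK.
  have h1 : g.-1 * n <= g * #|X|.
    rewrite -(leq_add2r (1 * n)) -mulnDl addn1 prednK // nE mulnDr.
    by rewrite leq_add2l mul1n -nE.
  have h2 := expn_succ_le g1; rewrite prednK // in h2.
  have gt0 : 0 < g.-1 ^ t by rewrite expn_gt0 (leq_trans _ g1).
  rewrite -(leq_pmul2l gt0) -expnMn; apply: leq_trans (leq_expl t h1) _.
  by rewrite expnMn mulnCA mulnA leq_mul2r h2 orbT.
have dPt : pwdisjoint (fun h => tsup (P h)).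
  move=> h h' hh'; apply: disjoint_bigcupl => i _; apply: disjoint_bigcupr => i' _.
  by apply: (dP (h, i) (h', i')); apply: contraNneq hh' => /(congr1 fst) /= ->.
have greedy j : j * m <= #|L| -> exists (L' : {set vert G}) (U : {set Gam}),
   [/\ L' \subset L, #|L'| = j * m, #|U| = t * j &
      tileable F (L' :|: \bigcup_(h in U) tsup (P h))].
  elim: j => [_|j IHj jL].
    exists set0, set0; split; rewrite ?sub0set ?cards0 ?muln0 //.
    by rewrite big_set0 setU0; exact: tileable0.
  have jL' : j * m + m <= #|L| by rewrite -mulSnr.
  have [L' [U [sL' cL' cU tU]]] := IHj (leq_trans (leq_addr _ _) jL').
  have [A sA cA] : exists2 A : {set vert G}, A \subset L :\: L' & #|A| = m.
    apply: exists_subset_card; rewrite cardsD (setIidPr sL') cL'.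
    by rewrite leq_subRL // (leq_trans (leq_addr _ _) jL').
  pose v (l : 'I_m) : vert G := enum_val (cast_ord (esym cA) l).
  have vinj : injective v by move=> l l' /enum_val_inj/cast_ord_inj.
  have vA l : v l \in A by exact: enum_valP.
  have vL l : v l \in L by have := subsetP sA _ (vA l); rewrite inE => /andP[].
  have vE : v @: [set: 'I_m] = A.
    apply/eqP; rewrite eqEcard card_imset // cardsT card_ord cA leqnn andbT.
    by apply/subsetP => u /imsetP[l _ ->].
  have vP l h i : v l \notin P h i.
    by apply: contraL (vL l) => /(subsetP (sPX h i)); rewrite inE negbK.
  have UG : 4 * t * #|U| <= #|Gam|.
    apply: leq_trans LG; rewrite cU mulnA (_ : 4 * t * t = 4 * t ^ 2); last by ring.
    rewrite leq_mul2l; apply/orP; right; apply: leq_trans jL'.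
    by apply: leq_trans (leq_addr _ _); rewrite leq_pmulr.
  have bad : 16 * #|[set w : {ffun 'I_t -> vert G} | ~~ absorbable R v w]| <= n ^ t.
    have few_l l : 256 * s ^ 3 * #|[set w : {ffun 'I_t -> vert G} | ~~ good (shadow v l w)]| <= n ^ t.
      rewrite (card_lift ord0 (fun y => ~~ good (fupd y ord0 (v l)))) [n ^ t]expnS.
      by rewrite mulnCA leq_mul2l few orbT.
    have sub : [set w : {ffun 'I_t -> vert G} | ~~ absorbable R v w] \subset [set w | ~~ allgood good w] :|:
        \bigcup_l [set w : {ffun 'I_t -> vert G} | ~~ good (shadow v l w)].
      apply/subsetP => w; rewrite !inE; apply: contraR; rewrite negb_or negbK => /andP[gw /negP gs].
      rewrite /absorbable allgood_full //=; apply/forallP => l.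
      have gl : good (shadow v l w).
        by apply/negPn/negP => ngl; apply: gs; apply/bigcupP; exists l => //; rewrite inE.
      have [_ _ cov] := Hgood _ gl; have [phi phi1] := cov ord0.
      by apply/existsP; exists (val phi); rewrite (homs_khom phi); apply/eqP.
    have h1 : 256 * s ^ 3 * #|[set w : {ffun 'I_t -> vert G} | ~~ absorbable R v w]| <= (t + m) * n ^ t.
      apply: (@leq_trans (256 * s ^ 3 * (#|[set w | ~~ allgood good w]| +
          \sum_l #|[set w : {ffun 'I_t -> vert G} | ~~ good (shadow v l w)]|))).
        rewrite leq_mul2l; apply/orP; right; apply: leq_trans (subset_leq_card sub) _.
        by apply: leq_trans (leq_card_setU _ _).1 _; rewrite leq_add2l card_bigcup_le.
      rewrite mulnDr mulnDl; apply: leq_add; first exact: bad_tuples few.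
      rewrite big_distrr /=; apply: leq_trans (leq_sum _ (fun l _ => few_l l)) _.
      by rewrite sum_nat_const card_ord.
    have s30 : 0 < 256 * s ^ 3 by [].
    rewrite -(leq_pmul2l s30) mulnCA.
    apply: (@leq_trans (16 * ((t + m) * n ^ t))); first by rewrite leq_mul2l h1.
    rewrite mulnA leq_mul2r; apply/orP; right.
    apply: (@leq_trans (16 * (3 * s))).
      by rewrite leq_mul2l /= /t; move: ms_le; rewrite /s; move: (m); clear; lia.
    by rewrite mulnA leq_mul // -{1}(expn1 s) leq_pexp2l.
  have [|U' [dU' cU' tU']] := Hb1 b _ mb G Gam P U v dP tP vP vinj UG tG bad nG.
    by apply: leq_trans bb; rewrite -addnA leq_addr.
  exists (A :|: L'), (U' :|: U); split.
  - by rewrite subUset sL' andbT (subset_trans sA) // subsetDl.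
  - rewrite card_disjointU ?cA ?cL' ?mulSn //.
    by have := sA; rewrite subsetD => /andP[].
  - by rewrite card_disjointU // cU cU' mulnS.
  rewrite bigcup_setU (_ : _ :|: _ = (v @: [set: 'I_m] :|: \bigcup_(g in U') tsup (P g)) :|: (L' :|: \bigcup_(h in U) tsup (P h))); last first.
    by rewrite vE setUACA.
  apply: tileable_union => //; rewrite vE disjointUl !disjointUr.
  have [sAL dAL] : A \subset L /\ [disjoint A & L'].
    by move: sA; rewrite subsetD => /andP[].
  rewrite dAL /= (disjointWl sAL (dLP U)) /= disjoint_sym (disjointWl sL' (dLP U')) /=.
  apply: disjoint_bigcupl => h hU'; apply: disjoint_bigcupr => h' h'U; apply: dPt.
  apply: contraTneq h'U => <-.
  by have := dU'; rewrite disjoint_subset => /subsetP/(_ h hU').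
have [L' [U [sL' cL' cU tU]]] := greedy (#|L| %/ m) ltac:(by rewrite divnK).
rewrite divnK // in cL'.
have eL : L' = L by apply/eqP; rewrite eqEcard sL' cL' leqnn.
have tAll h : tileable F (tsup (P h)).
  have bb2 : b2 <= b by apply: leq_trans bb; rewrite addnAC leq_addl.
  have [cPh _ _] := tP h.
  apply: (tile_remainder b0 (Hb2 b bb2) (tP h)) => [i|i|]; first exact: subxx.
    by rewrite cPh leq_subr.
  by rewrite dvdn_sum // => i _; rewrite cPh.
apply: tileable_Til.
have -> : [set: vert G] = (L' :|: \bigcup_(h in U) tsup (P h)) :|: \bigcup_(h in ~: U) tsup (P h).
  rewrite -setUA -bigcup_setU setUCr eL (eq_bigl predT) => [|h]; last by rewrite inE.
  by rewrite -eX setUC setUCr.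
apply: tileable_union => //; first by apply: tileable_bigcup => // h _; exact: tAll.
rewrite disjointUl eL dLP /=.
apply: disjoint_bigcupl => h hU; apply: disjoint_bigcupr => h' h'U; apply: dPt.
by apply: contraTneq h'U => <-; rewrite inE hU.
Qed.

End Core.

(** * Thresholds as infima *)

Section Thresholds.
Local Open Scope ring_scope.
Variables (R : realType) (k d m : nat).
Hypothesis dk : (d < k)%N.

Definition suffices (X : kgraph k -> Prop) (a : R) : Prop :=
  exists N : nat, forall n : nat, (N <= n)%N -> (m %| n)%N ->
    forall G : kgraph k, #|vert G| = n ->
      a * 'C(n - d, k - d)%:R <= (min_degree G d)%:R -> X G.

Lemma set_degree_le (G : kgraph k) (S : {set vert G}) : #|S| = d ->
  (set_degree S <= 'C(#|vert G| - d, k - d))%N.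
Proof.
move=> Sd; have <- : #|~: S| = (#|vert G| - d)%N by rewrite -Sd -(cardsC S) addKn.
rewrite -cards_draws.
have <- : #|(fun e => e :\: S) @: [set e in edges G | S \subset e]| = set_degree S.
  apply: card_in_imset => e e'; rewrite !inE => /andP[_ Se] /andP[_ Se'] ee'.
  by rewrite -(setID e S) -(setID e' S) ee' (setIidPr Se) (setIidPr Se').
apply: subset_leq_card; apply/subsetP => _ /imsetP[e + ->]; rewrite !inE => /andP[eG Se].
by rewrite setDE subsetIr -setDE cardsD (setIidPr Se) Sd (edges_uniform eG) /=.
Qed.

(** No degree exceeds the binomial coefficient, so for large [n] the degree condition is void. This
    puts 1 into the set whose infimum is the threshold. *)
Lemma suffices_gt1 X a : 1 < a -> suffices X a.
Proof.
move=> a1; exists k => n kn _ G nG /= H; exfalso.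
have [S Sd] : exists S : {set vert G}, #|S| = d.
  have : (0 < #|[set S : {set vert G} | #|S| == d]|)%N.
    by rewrite card_draws bin_gt0 nG (leq_trans (ltnW dk)).
  by case/card_gt0P => S; rewrite inE => /eqP; exists S.
have h1 : (min_degree G d <= 'C(n - d, k - d))%N.
  by rewrite -nG; apply: leq_trans (min_degree_le Sd) (set_degree_le Sd).
have h2 : 0 < 'C(n - d, k - d)%:R :> R by rewrite ltr0n bin_gt0 leq_sub2r.
have h3 : (min_degree G d)%:R <= 'C(n - d, k - d)%:R :> R by rewrite ler_nat.
by have := le_trans H h3; rewrite leNgt ltr_pMl // a1.
Qed.

Let thr (X : kgraph k -> Prop) : R := threshold R d m X.

Lemma suffices_mono X Y a b : (forall G, X G -> Y G) -> a <= b -> suffices X a -> suffices Y b.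
Proof.
move=> XY ab [N HN]; exists N => n nN mn G nG H; apply: XY; apply: HN nG _ => //.
by apply: le_trans H; rewrite ler_wpM2r.
Qed.

Lemma threshold_range X : 0 <= thr X <= 1.
Proof.
apply/andP; split.
  apply: lb_le_inf; last by move=> x /= [/andP[]].
  by exists 1; split; [rewrite ler01 lexx|move=> mu mu0; apply: suffices_gt1; rewrite ltrDl].
apply: ge_inf; first by exists 0 => x /= [/andP[]].
by split; [rewrite ler01 lexx|move=> mu mu0; apply: suffices_gt1; rewrite ltrDl].
Qed.

Lemma threshold_le X a : 0 <= a <= 1 -> (forall mu, 0 < mu -> suffices X (a + mu)) -> thr X <= a.
Proof. by move=> a01 H; apply: ge_inf => //; exists 0 => x /= [/andP[]]. Qed.

(** Half of [mu] is spent on reaching an element of the set near its infimum, the other half on the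
    margin in the definition of that set. *)
Lemma threshold_suffices X mu : 0 < mu -> suffices X (thr X + mu).
Proof.
move=> mu0; have mu2 : 0 < mu / 2 by lra.
have [|x [/= x01 Hx] xlt] := @inf_adherent R [set delta : R | 0 <= delta <= 1 /\
    forall mu : R, 0 < mu -> suffices X (delta + mu)]%classic (mu / 2) mu2.
  split; last by exists 0 => x /= [/andP[]].
  by exists 1; split; [rewrite ler01 lexx|move=> nu nu0; apply: suffices_gt1; rewrite ltrDl].
apply: suffices_mono (Hx _ mu2) => //.
move: xlt; rewrite -/(thr X); lra.
Qed.

Lemma threshold_mono X Y : (forall G, X G -> Y G) -> thr Y <= thr X.
Proof.
move=> XY; apply: threshold_le; first exact: threshold_range.
by move=> mu mu0; apply: suffices_mono XY (lexx _) (threshold_suffices X mu0).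
Qed.

End Thresholds.

Section Main.
Local Open Scope ring_scope.
Variables (R : realType) (k d : nat) (F : kgraph k).
Let m := #|vert F|.
Hypotheses (dk : (d < k)%N) (m0 : (0 < m)%N).

Lemma suffices_Til (D mu : R) : 0 <= D <= 1 -> 0 < mu <= 1 ->
  suffices d m (Spa R F) (D + mu / 2) -> suffices d m (Div R F) (D + mu / 2) ->
  suffices d m (Cov F) (D + mu / 2) -> suffices d m (Til F) (D + mu).
Proof.
move=> D01 mu01 [N1 H1] [N2 H2] [N3 H3].
have [S0 HS0] := sampling 256 3 dk D01 mu01.
(* The sample size [s'.+1] is a multiple of [m] beyond the bounds of all three properties and of the
   sampling; it is fixed before [n] is taken large. *)
pose s' := (m * (N1 + N2 + N3 + S0 + 1)).-1.
have sE : s'.+1 = (m * (N1 + N2 + N3 + S0 + 1))%N by rewrite prednK // muln_gt0 m0 addn1.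
have ms : (m %| s'.+1)%N by rewrite sE dvdn_mulr.
have sbig : (N1 + N2 + N3 + S0 + 1 <= s'.+1)%N by rewrite sE leq_pmull.
have [N1s N2s N3s S0s] : [/\ N1 <= s'.+1, N2 <= s'.+1, N3 <= s'.+1 & S0 <= s']%N.
  by move: sbig; clear; move: (s') => x; split; lia.
have [N HN] := HS0 s' S0s.
have [N' HN'] := @tiling_of_few_bad R k F m0 s' ms.
exists (maxn N N') => n; rewrite geq_max => /andP[nN nN'] mn G nG degG.
subst n.
apply: (HN' G (fun y => degree_good d (D + mu / 2) (pullG y))) => //.
  move=> y; rewrite /degree_good /= card_ord => gy.
  by split; [apply: (H1 s'.+1)|apply: (H2 s'.+1)|apply: (H3 s'.+1)]; rewrite /= ?card_ord.
exact: HN.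
Qed.

End Main.

Local Open Scope ring_scope.

Theorem theorem1p1 (R : realType) (k d : nat) (F : kgraph k)
    (d_ge1 : (1 <= d)%N) (d_ltk : (d < k)%N) :
  threshold R d #|vert F| (Til F) =
  Num.max (threshold R d #|vert F| (Spa R F))
    (Num.max (threshold R d #|vert F| (Div R F))
             (threshold R d #|vert F| (Cov F))).
Proof.
apply/eqP; rewrite eq_le; apply/andP; split; last first.
  rewrite !ge_max; apply/and3P; split; apply: threshold_mono => // G.
  - exact: Til_Spa.
  - exact: Til_Div.
  - exact: Til_Cov.
set a := threshold R d _ (Spa R F); set b := threshold R d _ (Div R F).
set c := threshold R d _ (Cov F); set D := Num.max _ _.
have /andP[a0 a1] : (0 <= a <= 1) := threshold_range _ _ d_ltk _.
have /andP[b0 b1] : (0 <= b <= 1) := threshold_range _ _ d_ltk _.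
have /andP[c0 c1] : (0 <= c <= 1) := threshold_range _ _ d_ltk _.
have D01 : (0 <= D <= 1) by rewrite /D !le_max a0 /= !ge_max a1 b1 c1.
apply: threshold_le => // mu mu0.
have [m0|m0] := posnP #|vert F|.
  (* 0 %| n only holds for n = 0, so there is nothing to check for n >= 1. *)
  by exists 1%N => n n1; rewrite m0 dvd0n => /eqP n0; rewrite n0 in n1.
(* Capped at 1, as the sampling estimates require. *)
pose nu := Num.min mu 1.
have nu01 : (0 < nu <= 1) by rewrite /nu lt_min mu0 ltr01 ge_min lexx orbT.
have nu2 : (0 < nu / 2) by have /andP[] := nu01; lra.
apply: (@suffices_mono _ _ _ _ (Til F) _ (D + nu)) => //.
  by rewrite lerD2l /nu ge_min lexx.
have aD : a <= D by rewrite /D le_max lexx.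
have bD : (b <= D) by rewrite /D !le_max lexx orbT.
have cD : (c <= D) by rewrite /D !le_max lexx !orbT.
apply: suffices_Til => //.
- by apply: suffices_mono (threshold_suffices #|vert F| d_ltk (Spa R F) nu2) => //; rewrite lerD2r.
- by apply: suffices_mono (threshold_suffices #|vert F| d_ltk (Div R F) nu2) => //; rewrite lerD2r.
- by apply: suffices_mono (threshold_suffices #|vert F| d_ltk (Cov F) nu2) => //; rewrite lerD2r.
Qed.
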